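(* Let ${\tt PFT}$ be the predicative Fregean theory and ${\tt PA}^2$ be second-order Peano arithmetic, both as defined in the context. Then ${\tt PFT}$ interprets ${\tt PA}^2$.
   Context: **Signature $L_0$.** $L_0$ is the many-sorted first-order signature with: (i) a sort for objects and, for each $n\geq 1$, a sort for $n$-ary concepts; (ii) for each $n\geq 1$, an $(n+1)$-ary predication relation symbol $R(a_1,\ldots,a_n)$ relating an $n$-ary concept $R$ and an $n$-tuple of objects; (iii) for each $n,m\geq 1$, an $(m+1)$-ary projection function symbol $(R,a_1,\ldots,a_m)\mapsto R[a_1,\ldots,a_m]$ taking an $(m+n)$-ary concept $R$ and an $m$-tuple of objects to an $n$-ary concept. Each sort has its own identity symbol. Derivability is in ordinary many-sorted first-order logic. Lower-case variables $x,y,a,b,\ldots$ range over objects; $R,S,T$ etc. range over concepts of the indicated arity; $\overline{a}$ abbreviates a tuple $a_1,\ldots,a_n$. Quantifiers over $n$-ary concepts ($n\geq 1$) are called second-order (higher-order) quantifiers. A $\Sigma^1_1$-formula is one that begins with a block of existential quantifiers over concepts (of various arities) and contains no further second-order quantifiers. **Axioms and schemas.** Let $L$ be an expansion of $L_0$. Below, formulas may contain parameters (further free variables of any sort), and the axioms are understood to be universally closed. - Extensionality axioms: for each $m\geq 1$, $\forall R,S\,[R=S\leftrightarrow \forall \overline{a}\,(R(\overline{a})\leftrightarrow S(\overline{a}))]$ for $m$-ary concepts $R,S$. - Projection axioms: for each $m,n\geq 1$, $\forall R\,\forall \overline{a},\overline{b}\,[(R[\overline{a}])(\overline{b})\leftrightarrow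 R(\overline{a},\overline{b})]$ for $(m+n)$-ary $R$, $\overline{a}=a_1,\ldots,a_m$, $\overline{b}=b_1,\ldots,b_n$. - First-Order Comprehension Schema for $L$-formulas: all axioms $\exists R\,\forall\overline{a}\,(R(\overline{a})\leftrightarrow\varphi(\overline{a}))$, where $\varphi(\overline{x})$ is an $L$-formula with no second-order quantifiers (but perhaps with parameters), $\overline{x}=(x_1,\ldots,x_n)$, and $R$ is an $n$-ary concept variable, $n\geq 1$, not free in $\varphi(\overline{x})$. - $\Sigma^1_1$-Choice Schema for $L$-formulas: all axioms $[\forall\overline{x}\,\exists R'\,\varphi(R',\overline{x})]\rightarrow\exists R\,[\forall\overline{x}\,\varphi(R[\overline{x}],\overline{x})]$, where $\varphi(R',\overline{x})$ is a $\Sigma^1_1$ $L$-formula, perhaps with parameters, $\overline{x}=(x_1,\ldots,x_m)$, $R'$ is an $n$-ary concept variable, and $R$ is an $(m+n)$-ary concept variable not free in $\varphi(R',\overline{x})$, $n,m\geq 1$. **Weak background theory.** ${\tt \Sigma^1_1\mbox{-}OS}$ is the $L_0$-theory consisting of the extensionality axioms, the projection axioms, the $\Sigma^1_1$-Choice Schema for $L_0$-formulas, and the First-Order Comprehension Schema for $L_0$-formulas. **Provable equivalence relations.** For an $L_0$-formula $E(R,S)$ with two free $n_E$-ary concept variables ($n_E\geq 1$) and no further free variables, $\mathrm{Equiv}(E)$ is the $L_0$-sentence saying that $E$ is an equivalence relation on $n_E$-ary concepts, i.e. the universal closure of $E(R,R)\wedge (E(R,S)\rightarrow E(S,R))\wedge((E(R,S)\wedge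 E(S,T))\rightarrow E(R,T))$. Let $\mathrm{ProvEquiv}(L_0)$ be the set of all such $L_0$-formulas $E(R,S)$ with ${\tt \Sigma^1_1\mbox{-}OS}\vdash\mathrm{Equiv}(E)$. **The theory ${\tt PFT}$.** $L_1$ is the expansion of $L_0$ by a new function symbol $\partial_E$ from $n_E$-ary concepts to objects, for each $E\in\mathrm{ProvEquiv}(L_0)$. The abstraction principle $A[E]$ is $\forall R,S\,(\partial_E(R)=\partial_E(S)\leftrightarrow E(R,S))$. The predicative Fregean theory ${\tt PFT}$ is the $L_1$-theory consisting of (i) the extensionality and projection axioms, (ii) the $\Sigma^1_1$-Choice Schema for $L_1$-formulas, (iii) the First-Order Comprehension Schema for $L_1$-formulas, and (iv) the abstraction principle $A[E]$ for each $E\in\mathrm{ProvEquiv}(L_0)$. **Second-order Peano arithmetic.** ${\tt PA}^2$ is the usual two-sorted first-order theory (number variables $m,n,\ldots$; set variables $X,Y,\ldots$; symbols $0,1,+,\cdot,<,\in$) with the axioms: $n+1\neq 0$; $m+1=n+1\rightarrow m=n$; $m+0=m$; $m+(n+1)=(m+n)+1$; $m\cdot 0=0$; $m\cdot(n+1)=(m\cdot n)+m$; $\neg(m<0)$; $m<n+1\leftrightarrow(m<n\vee m=n)$; the induction axiom $\forall X\,[(0\in X\wedge\forall n\,(n\in X\rightarrow n+1\in X))\rightarrow\forall n\,(n\in X)]$; and the full comprehension schema $\exists X\,\forall n\,(n\in X\leftrightarrow\varphi(n))$ for every formula $\varphi(n)$ of this language (possibly with set quantifiers and with number and set parameters) in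 which $X$ is not free. **Interpretability.** A theory $T$ interprets a theory $U$ when the primitives of $U$ can be defined in terms of the resources of $T$ so that the translations of theorems of $U$ are theorems of $T$. Concretely: there are formulas of the language of $T$ defining, for each sort of $U$, a domain (within sorts of $T$) that $T$ proves non-empty, and formulas defining on these domains each non-logical symbol of $U$, such that the induced translation (commuting with the connectives and relativizing quantifiers to the corresponding domains) sends every theorem of $U$ to a theorem of $T$. *)

(* Defs.v *)
From Stdlib Require Import List.
Import ListNotations.

(** * Many-sorted first-order logic with identity

    Syntax is well-scoped and well-sorted: a context is the list of the sorts
    of the free variables (the head is the variable bound last), and
    [var G s] is the type of the variables of sort [s] declared in [G]. *)

Record signature : Type := Signature {
  sort : Set;
  func : Set;
  fdom : func -> list sort;
  fcod : func -> sort;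
  rel : Set;
  rdom : rel -> list sort
}.

Arguments fdom {s} f : rename.
Arguments fcod {s} f : rename.
Arguments rdom {s} r : rename.

Section Variables.
Context {X : Set}.

Inductive var : list X -> X -> Set :=
| vz : forall (G : list X) (s : X), var (s :: G) s
| vs : forall (G : list X) (s t : X), var G s -> var (t :: G) s.

Arguments vz {G s}.
Arguments vs {G s t} x : rename.

Definition ren (G H : list X) : Set := forall s, var G s -> var H s.

Definition shift {G : list X} {t : X} : ren G (t :: G) := fun s x => vs x.

Definition vnil {P : X -> Set} : forall s, var [] s -> P s :=
  fun s x =>
    match x in var G' s' return
      match G' with [] => P s' | _ :: _ => unit end
    with
    | vz => tt
    | vs _ => tt
    end.

Definition vcons {P : X -> Set} {G : list X} {t : X}
    (h : P t) (f : forall s, var G s -> P s) : forall s, var (t :: G) s -> P s :=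
  fun s x =>
    match x in var G' s' return
      match G' with
      | [] => unit
      | t' :: G'' => P t' -> (forall r, var G'' r -> P r) -> P s'
      end
    with
    | vz => fun h _ => h
    | vs y => fun _ f => f _ y
    end h f.

Definition ren_up {G H : list X} {t : X} (xi : ren G H) : ren (t :: G) (t :: H) :=
  vcons (P := var (t :: H)) vz (fun s x => vs (xi s x)).

Fixpoint ren_ups (l : list X) {G H : list X} (xi : ren G H) :
    ren (l ++ G) (l ++ H) :=
  match l return ren (l ++ G) (l ++ H) with
  | [] => xi
  | t :: l' => ren_up (ren_ups l' xi)
  end.

Fixpoint vleft (l : list X) {G : list X} : ren l (l ++ G) :=
  match l return ren l (l ++ G) with
  | [] => vnil
  | t :: l' => ren_up (vleft l')
  end.

Fixpoint vright (l : list X) {G : list X} : ren G (l ++ G) :=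
  match l return ren G (l ++ G) with
  | [] => fun s x => x
  | t :: l' => fun s x => vs (vright l' s x)
  end.

End Variables.

Arguments vz {X G s}.
Arguments vs {X G s t} x : rename.
Arguments ren {X} G H.

Section Syntax.
Context {L : signature}.

Inductive term (G : list (sort L)) : sort L -> Set :=
| Var : forall s, var G s -> term G s
| App : forall f : func L, args G (fdom f) -> term G (fcod f)
with args (G : list (sort L)) : list (sort L) -> Set :=
| anil : args G []
| acons : forall s l, term G s -> args G l -> args G (s :: l).

Inductive form (G : list (sort L)) : Set :=
| Bot : form G
| Eq : forall s, term G s -> term G s -> form G
| Rel : forall r : rel L, args G (rdom r) -> form G
| And : form G -> form G -> form G
| Or : form G -> form G -> form G
| Imp : form G -> form G -> form G
| All : forall s, form (s :: G) -> form G
| Ex : forall s, form (s :: G) -> form G.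

Arguments Var {G s} x : rename.
Arguments App {G f} a : rename.
Arguments anil {G}.
Arguments acons {G s l} t a : rename.
Arguments Bot {G}.
Arguments Eq {G s} t u : rename.
Arguments Rel {G r} a : rename.
Arguments And {G} p q : rename.
Arguments Or {G} p q : rename.
Arguments Imp {G} p q : rename.
Arguments All {G s} p : rename.
Arguments Ex {G s} p : rename.

Definition sentence : Set := form [].
Definition theory : Type := sentence -> Prop.

Definition Not {G} (p : form G) : form G := Imp p Bot.
Definition Iff {G} (p q : form G) : form G := And (Imp p q) (Imp q p).

Fixpoint ren_term {G H} (xi : ren G H) {s} (t : term G s) : term H s :=
  match t with
  | Var x => Var (xi _ x)
  | App a => App (ren_args xi a)
  end
with ren_args {G H} (xi : ren G H) {l} (a : args G l) : args H l :=
  match a with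
  | anil => anil
  | acons t a' => acons (ren_term xi t) (ren_args xi a')
  end.

Fixpoint ren_form {G H} (xi : ren G H) (p : form G) : form H :=
  match p with
  | Bot => Bot
  | Eq t u => Eq (ren_term xi t) (ren_term xi u)
  | Rel a => Rel (ren_args xi a)
  | And p q => And (ren_form xi p) (ren_form xi q)
  | Or p q => Or (ren_form xi p) (ren_form xi q)
  | Imp p q => Imp (ren_form xi p) (ren_form xi q)
  | All p => All (ren_form (ren_up xi) p)
  | Ex p => Ex (ren_form (ren_up xi) p)
  end.

Definition sub (G H : list (sort L)) : Set := forall s, var G s -> term H s.

Definition sub_up {G H} {t : sort L} (sg : sub G H) : sub (t :: G) (t :: H) :=
  vcons (P := term (t :: H)) (Var vz) (fun s x => ren_term shift (sg s x)).

Fixpoint sub_term {G H} (sg : sub G H) {s} (t : term G s) : term H s :=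
  match t with
  | Var x => sg _ x
  | App a => App (sub_args sg a)
  end
with sub_args {G H} (sg : sub G H) {l} (a : args G l) : args H l :=
  match a with
  | anil => anil
  | acons t a' => acons (sub_term sg t) (sub_args sg a')
  end.

Fixpoint sub_form {G H} (sg : sub G H) (p : form G) : form H :=
  match p with
  | Bot => Bot
  | Eq t u => Eq (sub_term sg t) (sub_term sg u)
  | Rel a => Rel (sub_args sg a)
  | And p q => And (sub_form sg p) (sub_form sg q)
  | Or p q => Or (sub_form sg p) (sub_form sg q)
  | Imp p q => Imp (sub_form sg p) (sub_form sg q)
  | All p => All (sub_form (sub_up sg) p)
  | Ex p => Ex (sub_form (sub_up sg) p)
  end.

Definition inst {G} {s : sort L} (p : form (s :: G)) (t : term G s) : form G :=
  sub_form (vcons (P := term G) t (fun r x => Var x)) p.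

Definition lift {G} {s : sort L} (p : form G) : form (s :: G) :=
  ren_form shift p.

(** [foralls l p] binds the initial segment [l] of the context of [p]. *)
Fixpoint foralls (l : list (sort L)) {G} : form (l ++ G) -> form G :=
  match l return form (l ++ G) -> form G with
  | [] => fun p => p
  | s :: l' => fun p => foralls l' (All p)
  end.

(** Universal closure. *)
Fixpoint close {G : list (sort L)} : form G -> sentence :=
  match G return form G -> sentence with
  | [] => fun p => p
  | s :: G' => fun p => close (All p)
  end.

Fixpoint var_args {l G : list (sort L)} : ren l G -> args G l :=
  match l return ren l G -> args G l with
  | [] => fun _ => anil
  | s :: l' => fun xi => acons (Var (xi _ vz)) (var_args (fun r x => xi r (vs x)))
  end.

(** The tuple of the variables bound by [foralls l]. *)
Definition block (l : list (sort L)) {G} : args (l ++ G) l := var_args (vleft l).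

Definition args_hd {G} {s : sort L} {l} (a : args G (s :: l)) : term G s :=
  match a in args _ l' return
    match l' with [] => unit | s' :: _ => term G s' end
  with anil => tt | acons t _ => t end.

Definition args_tl {G} {s : sort L} {l} (a : args G (s :: l)) : args G l :=
  match a in args _ l' return
    match l' with [] => unit | _ :: l'' => args G l'' end
  with anil => tt | acons _ a' => a' end.

(** Classical natural deduction with identity.  Since open formulas are kept
    in explicit contexts, the non-emptiness of the sorts is a rule. *)
Inductive prv (T : theory) : forall {G : list (sort L)}, list (form G) -> form G -> Prop :=
| prv_ax : forall G (A : list (form G)) (p : sentence),
    T p -> prv T A (ren_form vnil p)
| prv_hyp : forall G (A : list (form G)) p, In p A -> prv T A p
| prv_raa : forall G (A : list (form G)) p, prv T (Not p :: A) Bot -> prv T A p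
| prv_andI : forall G (A : list (form G)) p q,
    prv T A p -> prv T A q -> prv T A (And p q)
| prv_andE1 : forall G (A : list (form G)) p q, prv T A (And p q) -> prv T A p
| prv_andE2 : forall G (A : list (form G)) p q, prv T A (And p q) -> prv T A q
| prv_orI1 : forall G (A : list (form G)) p q, prv T A p -> prv T A (Or p q)
| prv_orI2 : forall G (A : list (form G)) p q, prv T A q -> prv T A (Or p q)
| prv_orE : forall G (A : list (form G)) p q r,
    prv T A (Or p q) -> prv T (p :: A) r -> prv T (q :: A) r -> prv T A r
| prv_impI : forall G (A : list (form G)) p q, prv T (p :: A) q -> prv T A (Imp p q)
| prv_impE : forall G (A : list (form G)) p q,
    prv T A (Imp p q) -> prv T A p -> prv T A q
| prv_allI : forall G (A : list (form G)) s (p : form (s :: G)),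
    prv T (map lift A) p -> prv T A (All p)
| prv_allE : forall G (A : list (form G)) s (p : form (s :: G)) (t : term G s),
    prv T A (All p) -> prv T A (inst p t)
| prv_exI : forall G (A : list (form G)) s (p : form (s :: G)) (t : term G s),
    prv T A (inst p t) -> prv T A (Ex p)
| prv_exE : forall G (A : list (form G)) s (p : form (s :: G)) (q : form G),
    prv T A (Ex p) -> prv T (p :: map lift A) (lift q) -> prv T A q
| prv_eqI : forall G (A : list (form G)) s (t : term G s), prv T A (Eq t t)
| prv_eqE : forall G (A : list (form G)) s (p : form (s :: G)) (t u : term G s),
    prv T A (Eq t u) -> prv T A (inst p t) -> prv T A (inst p u)
| prv_inh : forall G (A : list (form G)) (s : sort L),
    prv T A (Ex (Eq (Var (vz : var (s :: G) s)) (Var vz))).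

Definition proves (T : theory) (p : sentence) : Prop := prv T [] p.

End Syntax.

Arguments term L G s : clear implicits.
Arguments args L G l : clear implicits.
Arguments form L G : clear implicits.
Arguments sentence L : clear implicits.
Arguments theory L : clear implicits.
Arguments sub L G H : clear implicits.
Arguments Var {L G s} x : rename.
Arguments App {L G f} a : rename.
Arguments anil {L G}.
Arguments acons {L G s l} t a : rename.
Arguments Bot {L G}.
Arguments Eq {L G s} t u : rename.
Arguments Rel {L G r} a : rename.
Arguments And {L G} p q : rename.
Arguments Or {L G} p q : rename.
Arguments Imp {L G} p q : rename.
Arguments All {L G s} p : rename.
Arguments Ex {L G s} p : rename.
Arguments foralls {L} l {G} p : rename.
Arguments close {L G} p : rename.
Arguments block {L} l {G}.
Arguments prv {L} T {G} A p : rename.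

Declare Scope form_scope.
Delimit Scope form_scope with form.
Bind Scope form_scope with form.

Notation "p /\ q" := (And p q) : form_scope.
Notation "p \/ q" := (Or p q) : form_scope.
Notation "p --> q" := (Imp p q) (at level 90, right associativity) : form_scope.
Notation "p <-> q" := (Iff p q) : form_scope.
Notation "~ p" := (Not p) : form_scope.
Notation "t == u" := (Eq t u) (at level 70) : form_scope.

(** De Bruijn variables: [#0] is the head of the context. *)
Notation "#0" := (Var vz).
Notation "#1" := (Var (vs vz)).
Notation "#2" := (Var (vs (vs vz))).

(** * Interpretations *)

(** A function symbol [f] is defined by a formula for its graph: variable [#0]
    is the value, and the remaining variables are the arguments of [f]. *)
Record translation (S T : signature) : Type := Translation {
  tsort : sort S -> sort T;
  tdom : forall s : sort S, form T [tsort s];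
  tfun : forall f : func S, form T (tsort (fcod f) :: map tsort (fdom f));
  trel : forall r : rel S, form T (map tsort (rdom r))
}.

Arguments tsort {S T} _ _.
Arguments tdom {S T} _ _.
Arguments tfun {S T} _ _.
Arguments trel {S T} _ _.

Section Translate.
Context {S T : signature} (I : translation S T).

Definition in_dom {G : list (sort T)} (s : sort S) (x : var G (tsort I s)) : form T G :=
  ren_form (vcons (P := var G) x vnil) (tdom I s).

Definition AllD {G : list (sort T)} (s : sort S) (p : form T (tsort I s :: G)) : form T G :=
  All (in_dom s vz --> p).

Definition ExD {G : list (sort T)} (s : sort S) (p : form T (tsort I s :: G)) : form T G :=
  Ex (in_dom s vz /\ p).

Fixpoint AllDs (l : list (sort S)) {G : list (sort T)} :
    form T (map (tsort I) l ++ G) -> form T G :=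
  match l return form T (map (tsort I) l ++ G) -> form T G with
  | [] => fun p => p
  | s :: l' => fun p => AllDs l' (AllD s p)
  end.

Fixpoint ExDs (l : list (sort S)) {G : list (sort T)} :
    form T (map (tsort I) l ++ G) -> form T G :=
  match l return form T (map (tsort I) l ++ G) -> form T G with
  | [] => fun p => p
  | s :: l' => fun p => ExDs l' (ExD s p)
  end.

(** An environment sends the variables of the source formula to variables of
    the corresponding sorts in the target context. *)
Definition env (G : list (sort S)) (H : list (sort T)) : Set :=
  forall s, var G s -> var H (tsort I s).

Definition env_up {G H} {s : sort S} (rho : env G H) : env (s :: G) (tsort I s :: H) :=
  vcons (P := fun r => var (tsort I s :: H) (tsort I r)) vz (fun r x => vs (rho r x)).

(** [tr_term rho t y]: "[y] is the value of [t]"; [tr_args rho a ys]: "the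
    variables [ys] are the values of the tuple [a]".  Compound terms are
    unnested with existential quantifiers over the domains. *)
Fixpoint tr_term {G s} (t : term S G s) :
    forall {H}, env G H -> var H (tsort I s) -> form T H :=
  match t in term _ _ s return
    forall H, env G H -> var H (tsort I s) -> form T H
  with
  | Var x => fun H rho y => Var y == Var (rho _ x)
  | @App _ _ f a => fun H rho y =>
      let l := map (tsort I) (fdom f) in
      ExDs (fdom f)
        (tr_args a (fun r x => vright l _ (rho r x)) (vleft l) /\
         ren_form (vcons (P := var (l ++ H)) (vright l _ y) (vleft l)) (tfun I f))
  end%form
with tr_args {G l} (a : args S G l) :
    forall {H}, env G H -> ren (map (tsort I) l) H -> form T H :=
  match a in args _ _ l return
    forall H, env G H -> ren (map (tsort I) l) H -> form T H
  with
  | anil => fun H rho ys => ~ Bot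
  | acons t a' => fun H rho ys =>
      tr_term t rho (ys _ vz) /\ tr_args a' rho (fun r x => ys r (vs x))
  end%form.

Fixpoint tr_form {G} (p : form S G) : forall {H}, env G H -> form T H :=
  match p with
  | Bot => fun H rho => Bot
  | @Eq _ _ s t u => fun H rho =>
      ExD s (tr_term t (fun r x => vs (rho r x)) vz /\
                    tr_term u (fun r x => vs (rho r x)) vz)
  | @Rel _ _ r a => fun H rho =>
      let l := map (tsort I) (rdom r) in
      ExDs (rdom r)
        (tr_args a (fun r x => vright l _ (rho r x)) (vleft l) /\
         ren_form (vleft l) (trel I r))
  | And p q => fun H rho => tr_form p rho /\ tr_form q rho
  | Or p q => fun H rho => tr_form p rho \/ tr_form q rho
  | Imp p q => fun H rho => tr_form p rho --> tr_form q rho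
  | All p => fun H rho => AllD _ (tr_form p (env_up rho))
  | Ex p => fun H rho => ExD _ (tr_form p (env_up rho))
  end%form.

Definition tr_sentence (p : sentence S) : sentence T :=
  tr_form p (vnil (P := fun r => var [] (tsort I r))).

Definition dom_nonempty (s : sort S) : sentence T := Ex (tdom I s).

(** For all arguments in the domains there is exactly one value in the domain. *)
Definition fun_total (f : func S) : sentence T :=
  let l := map (tsort I) (fdom f) in
  let c := fcod f in
  AllDs (fdom f)
    (ExD c
      (ren_form (ren_up (vleft l)) (tfun I f) /\
       AllD c
         (ren_form (vcons (P := var (tsort I c :: tsort I c :: l ++ []))
                      vz (fun r x => vs (vs (vleft l _ x)))) (tfun I f)
          --> #0 == #1)))%form.

End Translate.

Definition interprets {S T : signature} (TT : theory T) (UU : theory S) : Prop :=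
  exists I : translation S T,
    (forall s, proves TT (dom_nonempty I s)) /\
    (forall f, proves TT (fun_total I f)) /\
    (forall p, proves UU p -> proves TT (tr_sentence I p)).

(** * Fregean signatures *)

(** [Con k] is the sort of the (k+1)-ary concepts: as arities are positive,
    every arity is shifted by one.  In particular [m + S n] codes the arity
    (m+1) + (n+1). *)
Inductive fsort : Set :=
| Obj
| Con (k : nat).

Inductive ffunc (A : Set) : Set :=
| Proj (m n : nat)
| Abs (e : A).

Arguments Proj {A} m n.
Arguments Abs {A} e.

Definition objs (n : nat) : list fsort := repeat Obj n.

(** [L_0] expanded by one function symbol from (ar e + 1)-ary concepts to
    objects for each [e : A]. *)
Definition freg {A : Set} (ar : A -> nat) : signature := {|
  sort := fsort;
  func := ffunc A;
  fdom := fun f => match f with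
                   | Proj m n => Con (m + S n) :: objs (S m)
                   | Abs e => [Con (ar e)]
                   end;
  fcod := fun f => match f with
                   | Proj m n => Con n
                   | Abs _ => Obj
                   end;
  rel := nat;
  rdom := fun k => Con k :: objs (S k)
|}.

Definition no_abs : Empty_set -> nat := fun e => match e with end.

Definition L0 : signature := freg no_abs.

Section Fregean.
Context {A : Set} {ar : A -> nat}.
Notation L := (freg ar).

Definition pred {G} {k : nat} (R : term L G (Con k)) (a : args L G (objs (S k))) :
  form L G := Rel (L := L) (r := k) (acons R a).

Definition proj {G} {m n : nat} (R : term L G (Con (m + S n)))
    (a : args L G (objs (S m))) : term L G (Con n) :=
  App (L := L) (f := Proj m n) (acons R a).

Definition abs {G} (e : A) (R : term L G (Con (ar e))) : term L G Obj :=
  App (L := L) (f := Abs e) (acons R anil).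

Fixpoint obj_app {G} {m n : nat} :
    args L G (objs m) -> args L G (objs n) -> args L G (objs (m + n)) :=
  match m return args L G (objs m) -> args L G (objs n) -> args L G (objs (m + n)) with
  | 0 => fun _ b => b
  | S m' => fun a b => acons (args_hd a) (obj_app (args_tl a) b)
  end.

Fixpoint first_order {G} (p : form L G) : Prop :=
  match p with
  | Bot | Eq _ _ | Rel _ => True
  | And p q | Or p q | Imp p q => first_order p /\ first_order q
  | @All _ _ s p | @Ex _ _ s p => s = Obj /\ first_order p
  end.

(** The block of second-order quantifiers may be empty. *)
Inductive sigma11 : forall {G}, form L G -> Prop :=
| sigma11_fo : forall G (p : form L G), first_order p -> sigma11 p
| sigma11_ex : forall G n (p : form L (Con n :: G)), sigma11 p -> sigma11 (Ex p).

Definition extensionality (k : nat) : sentence L :=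
  close (L := L) (G := [Con k; Con k])
    (#0 == #1 <->
     foralls (L := L) (objs (S k))
       (pred (Var (L := L) (vright (objs (S k)) _ vz)) (block (L := L) (objs (S k))) <->
        pred (Var (L := L) (vright (objs (S k)) _ (vs vz))) (block (L := L) (objs (S k)))))%form.

Definition projection (m n : nat) : sentence L :=
  close (L := L) (G := [Con (m + S n)])
    (foralls (L := L) (objs (S m)) (foralls (L := L) (objs (S n))
      (let a := ren_args (L := L) (vright (objs (S n))) (block (L := L) (objs (S m))) in
       let b := block (L := L) (objs (S n)) in
       let R := Var (L := L) (vright (objs (S n)) _ (vright (objs (S m)) _ vz)) in
       pred (proj R a) b <-> pred R (obj_app a b))))%form.

(** In both schemas [G] lists the parameters. *)
Definition comprehension {G} (k : nat) (p : form L (objs (S k) ++ G)) : sentence L :=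
  close
    (Ex (L := L) (s := Con k)
      (foralls (L := L) (objs (S k))
        (pred (Var (L := L) (vright (objs (S k)) _ vz)) (block (L := L) (objs (S k))) <->
         ren_form (L := L) (ren_ups (objs (S k)) shift) p)))%form.

Definition choice {G} (m n : nat) (p : form L (Con n :: objs (S m) ++ G)) : sentence L :=
  close
    (foralls (L := L) (objs (S m)) (Ex p)
     -->
     Ex (L := L) (s := Con (m + S n))
       (foralls (L := L) (objs (S m))
         (sub_form
           (vcons (P := term L (objs (S m) ++ Con (m + S n) :: G))
              (proj (Var (L := L) (vright (objs (S m)) _ vz)) (block (L := L) (objs (S m))))
              (fun s x => Var (L := L) (ren_ups (objs (S m)) shift _ x)))
           p)))%form.

Inductive OS : theory L :=
| OS_ext : forall k, OS (extensionality k)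
| OS_proj : forall m n, OS (projection m n)
| OS_choice : forall G m n (p : form L (Con n :: objs (S m) ++ G)),
    sigma11 p -> OS (choice m n p)
| OS_compr : forall G k (p : form L (objs (S k) ++ G)),
    first_order p -> OS (comprehension k p).

Fixpoint emb_term {G s} (t : term L0 G s) : term L G s :=
  match t in term _ _ s return term L G s with
  | Var x => Var (L := L) x
  | @App _ _ f a =>
      match f return args L G (fdom (s := L0) f) -> term L G (fcod (s := L0) f) with
      | Proj m n => fun a => App (L := L) (f := Proj m n) a
      | Abs e => match e with end
      end (emb_args a)
  end
with emb_args {G l} (a : args L0 G l) : args L G l :=
  match a in args _ _ l return args L G l with
  | anil => anil (L := L)
  | acons t a' => acons (L := L) (emb_term t) (emb_args a')
  end.

(** Every [L_0]-formula is a formula of the expansion. *)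
Fixpoint emb {G} (p : form L0 G) : form L G :=
  match p with
  | Bot => Bot
  | @Eq _ _ s t u => Eq (L := L) (s := s) (emb_term t) (emb_term u)
  | @Rel _ _ k a => Rel (L := L) (r := k) (emb_args a)
  | And p q => And (emb p) (emb q)
  | Or p q => Or (emb p) (emb q)
  | Imp p q => Imp (emb p) (emb q)
  | @All _ _ s p => All (L := L) (s := s) (emb p)
  | @Ex _ _ s p => Ex (L := L) (s := s) (emb p)
  end.

Definition app2 {G} {k : nat} (E : form L [Con k; Con k]) (R S : term L G (Con k)) :
    form L G :=
  sub_form (vcons (P := term L G) R (vcons (P := term L G) S vnil)) E.

End Fregean.

(** The theory Sigma^1_1-OS. *)
Definition SOS : theory L0 := OS.

Definition Equiv {k : nat} (E : form L0 [Con k; Con k]) : sentence L0 :=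
  close (L := L0) (G := [Con k; Con k; Con k])
    (app2 E #0 #0 /\
     (app2 E #0 #1 --> app2 E #1 #0) /\
     (app2 E #0 #1 /\ app2 E #1 #2 --> app2 E #0 #2))%form.

(** The formula [pe_form] has its first argument as [#0] and its second as [#1].
    An element of this type carries a proof, so [L1] may a priori contain
    copies of one symbol for one formula; the copies satisfy the same
    abstraction principle (and coincide under proof irrelevance). *)
Record ProvEquiv : Set := {
  pe_ar : nat;
  pe_form : form L0 [Con pe_ar; Con pe_ar];
  pe_prf : proves SOS (Equiv pe_form)
}.

Definition L1 : signature := freg pe_ar.

Definition abstraction (E : ProvEquiv) : sentence L1 :=
  close (L := L1) (G := [Con (pe_ar E); Con (pe_ar E)])
    (abs E #0 == abs E #1 <-> emb (pe_form E))%form.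

Inductive PFT : theory L1 :=
| PFT_OS : forall p, OS p -> PFT p
| PFT_abs : forall E, PFT (abstraction E).

(** * Second-order Peano arithmetic *)

Inductive pa_sort : Set := Num | Sets.
Inductive pa_func : Set := Zero | One | Plus | Times.
Inductive pa_rel : Set := Less | Mem.

Definition LPA2 : signature := {|
  sort := pa_sort;
  func := pa_func;
  fdom := fun f => match f with
                   | Zero | One => []
                   | Plus | Times => [Num; Num]
                   end;
  fcod := fun _ => Num;
  rel := pa_rel;
  rdom := fun r => match r with
                   | Less => [Num; Num]
                   | Mem => [Num; Sets]
                   end
|}.

Section PA2.
Context {G : list pa_sort}.

Definition zero : term LPA2 G Num := App (L := LPA2) (f := Zero) anil.
Definition one : term LPA2 G Num := App (L := LPA2) (f := One) anil.
Definition plus (t u : term LPA2 G Num) : term LPA2 G Num :=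
  App (L := LPA2) (f := Plus) (acons t (acons u anil)).
Definition times (t u : term LPA2 G Num) : term LPA2 G Num :=
  App (L := LPA2) (f := Times) (acons t (acons u anil)).
Definition less (t u : term LPA2 G Num) : form LPA2 G :=
  Rel (L := LPA2) (r := Less) (acons t (acons u anil)).
Definition mem (t : term LPA2 G Num) (u : term LPA2 G Sets) : form LPA2 G :=
  Rel (L := LPA2) (r := Mem) (acons t (acons u anil)).

End PA2.

Definition pa_forall (l : list pa_sort) (p : form LPA2 l) : sentence LPA2 :=
  close (L := LPA2) p.
Arguments pa_forall l p%_form.

Inductive PA2 : theory LPA2 :=
| PA2_succ_nz : PA2 (pa_forall [Num] (~ (plus #0 one == zero)))
| PA2_succ_inj : PA2 (pa_forall [Num; Num] (plus #1 one == plus #0 one --> #1 == #0))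
| PA2_plus0 : PA2 (pa_forall [Num] (plus #0 zero == #0))
| PA2_plusS : PA2 (pa_forall [Num; Num]
    (plus #1 (plus #0 one) == plus (plus #1 #0) one))
| PA2_times0 : PA2 (pa_forall [Num] (times #0 zero == zero))
| PA2_timesS : PA2 (pa_forall [Num; Num]
    (times #1 (plus #0 one) == plus (times #1 #0) #1))
| PA2_less0 : PA2 (pa_forall [Num] (~ less #0 zero))
| PA2_lessS : PA2 (pa_forall [Num; Num]
    (less #1 (plus #0 one) <-> (less #1 #0 \/ #1 == #0)))
| PA2_induction : PA2 (pa_forall [Sets]
    (mem zero #0 /\
     All (L := LPA2) (s := Num) (mem #0 #1 --> mem (plus #0 one) #1)
     --> All (L := LPA2) (s := Num) (mem #0 #1)))
| PA2_compr : forall (G : list pa_sort) (p : form LPA2 (Num :: G)),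
    PA2 (pa_forall G
      (Ex (L := LPA2) (s := Sets) (All (L := LPA2) (s := Num)
        (mem #0 #1 <-> ren_form (ren_up shift) p)))).

(* Main.v *)
Require Import Defs.
From Stdlib Require Import List Arith Lia Cantor.
From Stdlib Require Import Classical ClassicalEpsilon FunctionalExtensionality.
From Stdlib Require Import PropExtensionality ProofIrrelevance Eqdep.
Import ListNotations.

(** The schemas of PFT are predicative, but its abstraction operators smuggle in
    impredicative comprehension.  For an L0-formula [p(R)] in one concept variable,
    having the same truth value, [p(R) <-> p(S)], is provably an equivalence relation,
    by pure logic.  So L1 has an operator d with [d(R) = d(S)] exactly when
    [p(R)] and [p(S)] agree, and the condition [d(R) = c] is quantifier-free although
    [p] may have any second-order quantifiers.  Applied to the projections [R[a]] of
    one concept [R], first-order comprehension yields [{a | p(R[a])}]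
    ([section_compr]).  Now let [q(Q, a)] be any L0-formula with a concept parameter
    [Q].  A single concept [R], defined without quantifiers, has as its projection
    [R[a]] a code of the pair [({a}, Q)] ([exists_codes]), and [q(Q, a)] is an
    L0-property of that code ([decoded]).  Hence full comprehension for L0-formulas
    holds in PFT ([comprehension_definable]); several parameters are first coded into
    one ([def_common]).

    The identity of concepts is also an admissible equivalence relation, so PFT has
    Frege's extension operator.  The extension of the empty concept serves as zero and
    the extension of [{x}] as the successor of [x]: the successor is injective, omits
    zero, and its graph is a concept.  From there on the argument is Dedekind's: the
    numbers are the objects in every concept that contains zero and is closed under
    successor, sum and product are the least relations closed under their recursion
    clauses, and comprehension gives induction ([num_ind]) and recursion ([Rec_total]).
    The translation of a formula of arithmetic only mentions concepts, objects and
    relations that are L0-definable with parameters ([def_tr_form]), so comprehension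
    for L0-formulas gives comprehension for arithmetic ([sat_comprehension]).

    All of this is carried out in models.  Goedel's completeness theorem
    ([completeness]), together with [soundness] and the fact that an interpretation
    carves a structure for the source language out of every model of the target theory
    ([sat_tr_form]), reduces interpretability to a statement about the models of PFT
    ([interprets_by_models]). *)

(** * Variables, renamings and substitutions *)

Scheme term_args_ind := Induction for term Sort Prop
with args_term_ind := Induction for args Sort Prop.
Combined Scheme term_args_mutind from term_args_ind, args_term_ind.

(** Inversion for the indexed family [var], in a form that leaves the predicate
    [P] to unification. *)
Lemma var_cons_case {X : Set} {G : list X} {t : X}
    (P : forall s, var (t :: G) s -> Prop) :
  P t vz -> (forall s x, P s (vs x)) -> forall s x, P s x.
Proof.
  intros h0 hS s x.
  refine (match x as x' in var G' s' return
    match G' return var G' s' -> Prop with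
    | [] => fun _ => True
    | t' :: G'' => fun x' => forall (P : forall s, var (t' :: G'') s -> Prop),
        P t' vz -> (forall s x, P s (vs x)) -> P s' x'
    end x' with
    | vz => _ | vs y => _ end P h0 hS); auto.
Qed.

Lemma var_nil_case {X : Set} (P : forall s, var (X := X) [] s -> Prop) :
  forall s x, P s x.
Proof.
  intros s x.
  refine (match x as x' in var G' s' return
    match G' return var G' s' -> Prop with
    | [] => fun x' => P s' x'
    | _ => fun _ => True end x' with vz => I | vs _ => I end).
Qed.

Ltac funext2 s x := apply functional_extensionality_dep; intro s;
  apply functional_extensionality_dep; intro x.

Ltac case_var x :=
  match type of x with
  | var (_ :: _) ?s => revert s x; refine (var_cons_case _ _ _); [|intros s x]
  | var [] ?s => revert s x; refine (var_nil_case _)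
  end.

Lemma vcons_eta {X : Set} {P : X -> Set} {G : list X} {t : X}
    (f : forall s, var (t :: G) s -> P s) :
  vcons (f t vz) (fun s x => f s (vs x)) = f.
Proof. funext2 s x. case_var x; reflexivity. Qed.

Lemma vnil_eta {X : Set} {P : X -> Set} (f : forall s, var [] s -> P s) : vnil = f.
Proof. funext2 s x. case_var x. Qed.

Section SyntaxLemmas.
Context {L : signature}.

Lemma ren_up_comp {G H K : list (sort L)} {t : sort L} (xi : ren G H) (ze : ren H K) :
  (fun s x => ren_up (t := t) ze s (ren_up xi s x)) = ren_up (fun s x => ze s (xi s x)).
Proof. funext2 s x. case_var x; reflexivity. Qed.

Lemma ren_up_id {G : list (sort L)} {t : sort L} :
  ren_up (fun s (x : var G s) => x) = (fun s (x : var (t :: G) s) => x).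
Proof. funext2 s x. case_var x; reflexivity. Qed.

Lemma ren_ren_term_args {G} :
  (forall s (t : term L G s) H K (xi : ren G H) (ze : ren H K),
     ren_term ze (ren_term xi t) = ren_term (fun s x => ze s (xi s x)) t) /\
  (forall l (a : args L G l) H K (xi : ren G H) (ze : ren H K),
     ren_args ze (ren_args xi a) = ren_args (fun s x => ze s (xi s x)) a).
Proof.
  apply (term_args_mutind L G
    (fun s t => forall H K (xi : ren G H) (ze : ren H K),
     ren_term ze (ren_term xi t) = ren_term (fun s x => ze s (xi s x)) t)
    (fun l a => forall H K (xi : ren G H) (ze : ren H K),
     ren_args ze (ren_args xi a) = ren_args (fun s x => ze s (xi s x)) a));
  intros; cbn; f_equal; auto.
Qed.

Lemma ren_ren_term {G H K s} (xi : ren G H) (ze : ren H K) (t : term L G s) :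
  ren_term ze (ren_term xi t) = ren_term (fun s x => ze s (xi s x)) t.
Proof. apply ren_ren_term_args. Qed.

Lemma ren_ren_args {G H K l} (xi : ren G H) (ze : ren H K) (a : args L G l) :
  ren_args ze (ren_args xi a) = ren_args (fun s x => ze s (xi s x)) a.
Proof. apply ren_ren_term_args. Qed.

Lemma ren_ren {G} (p : form L G) : forall H K (xi : ren G H) (ze : ren H K),
  ren_form ze (ren_form xi p) = ren_form (fun s x => ze s (xi s x)) p.
Proof.
  induction p; intros; cbn; rewrite ?ren_ren_term, ?ren_ren_args;
    f_equal; auto; rewrite IHp, ren_up_comp; reflexivity.
Qed.

Lemma sub_up_ren {G H K : list (sort L)} {t : sort L} (xi : ren G H) (sg : sub L H K) :
  (fun s x => sub_up (t := t) sg s (ren_up xi s x)) = sub_up (fun s x => sg s (xi s x)).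
Proof. funext2 s x. case_var x; reflexivity. Qed.

Lemma sub_ren_term_args {G} :
  (forall s (t : term L G s) H K (xi : ren G H) (sg : sub L H K),
     sub_term sg (ren_term xi t) = sub_term (fun s x => sg s (xi s x)) t) /\
  (forall l (a : args L G l) H K (xi : ren G H) (sg : sub L H K),
     sub_args sg (ren_args xi a) = sub_args (fun s x => sg s (xi s x)) a).
Proof.
  apply (term_args_mutind L G
    (fun s t => forall H K (xi : ren G H) (sg : sub L H K),
     sub_term sg (ren_term xi t) = sub_term (fun s x => sg s (xi s x)) t)
    (fun l a => forall H K (xi : ren G H) (sg : sub L H K),
     sub_args sg (ren_args xi a) = sub_args (fun s x => sg s (xi s x)) a));
  intros; cbn; f_equal; auto.
Qed.

Lemma sub_ren_term {G H K s} (xi : ren G H) (sg : sub L H K) (t : term L G s) :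
  sub_term sg (ren_term xi t) = sub_term (fun s x => sg s (xi s x)) t.
Proof. apply sub_ren_term_args. Qed.

Lemma sub_ren_args {G H K l} (xi : ren G H) (sg : sub L H K) (a : args L G l) :
  sub_args sg (ren_args xi a) = sub_args (fun s x => sg s (xi s x)) a.
Proof. apply sub_ren_term_args. Qed.

Lemma sub_ren {G} (p : form L G) : forall H K (xi : ren G H) (sg : sub L H K),
  sub_form sg (ren_form xi p) = sub_form (fun s x => sg s (xi s x)) p.
Proof.
  induction p; intros; cbn; rewrite ?sub_ren_term, ?sub_ren_args;
    f_equal; auto; rewrite IHp, sub_up_ren; reflexivity.
Qed.

Lemma ren_sub_up {G H K : list (sort L)} {t : sort L} (sg : sub L G H) (xi : ren H K) :
  (fun s x => ren_term (ren_up (t := t) xi) (sub_up sg s x)) =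
  sub_up (fun s x => ren_term xi (sg s x)).
Proof.
  funext2 s x. case_var x; [reflexivity|]. cbn. rewrite !ren_ren_term. reflexivity.
Qed.

Lemma ren_sub_term_args {G} :
  (forall s (t : term L G s) H K (sg : sub L G H) (xi : ren H K),
     ren_term xi (sub_term sg t) = sub_term (fun s x => ren_term xi (sg s x)) t) /\
  (forall l (a : args L G l) H K (sg : sub L G H) (xi : ren H K),
     ren_args xi (sub_args sg a) = sub_args (fun s x => ren_term xi (sg s x)) a).
Proof.
  apply (term_args_mutind L G
    (fun s t => forall H K (sg : sub L G H) (xi : ren H K),
     ren_term xi (sub_term sg t) = sub_term (fun s x => ren_term xi (sg s x)) t)
    (fun l a => forall H K (sg : sub L G H) (xi : ren H K),
     ren_args xi (sub_args sg a) = sub_args (fun s x => ren_term xi (sg s x)) a));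
  intros; cbn; f_equal; auto.
Qed.

Lemma ren_sub_term {G H K s} (sg : sub L G H) (xi : ren H K) (t : term L G s) :
  ren_term xi (sub_term sg t) = sub_term (fun s x => ren_term xi (sg s x)) t.
Proof. apply ren_sub_term_args. Qed.

Lemma ren_sub_args {G H K l} (sg : sub L G H) (xi : ren H K) (a : args L G l) :
  ren_args xi (sub_args sg a) = sub_args (fun s x => ren_term xi (sg s x)) a.
Proof. apply ren_sub_term_args. Qed.

Lemma ren_sub {G} (p : form L G) : forall H K (sg : sub L G H) (xi : ren H K),
  ren_form xi (sub_form sg p) = sub_form (fun s x => ren_term xi (sg s x)) p.
Proof.
  induction p; intros; cbn; rewrite ?ren_sub_term, ?ren_sub_args;
    f_equal; auto; rewrite IHp, ren_sub_up; reflexivity.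
Qed.

Lemma sub_sub_up {G H K : list (sort L)} {t : sort L} (sg : sub L G H) (ta : sub L H K) :
  (fun s x => sub_term (sub_up (t := t) ta) (sub_up sg s x)) =
  sub_up (fun s x => sub_term ta (sg s x)).
Proof.
  funext2 s x. case_var x; [reflexivity|]. cbn.
  rewrite sub_ren_term, ren_sub_term. reflexivity.
Qed.

Lemma sub_sub_term_args {G} :
  (forall s (t : term L G s) H K (sg : sub L G H) (ta : sub L H K),
     sub_term ta (sub_term sg t) = sub_term (fun s x => sub_term ta (sg s x)) t) /\
  (forall l (a : args L G l) H K (sg : sub L G H) (ta : sub L H K),
     sub_args ta (sub_args sg a) = sub_args (fun s x => sub_term ta (sg s x)) a).
Proof.
  apply (term_args_mutind L G
    (fun s t => forall H K (sg : sub L G H) (ta : sub L H K),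
     sub_term ta (sub_term sg t) = sub_term (fun s x => sub_term ta (sg s x)) t)
    (fun l a => forall H K (sg : sub L G H) (ta : sub L H K),
     sub_args ta (sub_args sg a) = sub_args (fun s x => sub_term ta (sg s x)) a));
  intros; cbn; f_equal; auto.
Qed.

Lemma sub_sub {G} (p : form L G) : forall H K (sg : sub L G H) (ta : sub L H K),
  sub_form ta (sub_form sg p) = sub_form (fun s x => sub_term ta (sg s x)) p.
Proof.
  induction p; intros; cbn;
    rewrite ?(proj1 sub_sub_term_args), ?(proj2 sub_sub_term_args);
    f_equal; auto; rewrite IHp, sub_sub_up; reflexivity.
Qed.

Lemma sub_up_Var {G H : list (sort L)} {t : sort L} (xi : ren G H) :
  sub_up (t := t) (fun s x => Var (xi s x)) = (fun s x => Var (ren_up xi s x)).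
Proof. funext2 s x. case_var x; reflexivity. Qed.

Lemma sub_Var_term_args {G} :
  (forall s (t : term L G s) H (xi : ren G H),
     sub_term (fun s x => Var (xi s x)) t = ren_term xi t) /\
  (forall l (a : args L G l) H (xi : ren G H),
     sub_args (fun s x => Var (xi s x)) a = ren_args xi a).
Proof.
  apply (term_args_mutind L G
    (fun s t => forall H (xi : ren G H),
     sub_term (fun s x => Var (xi s x)) t = ren_term xi t)
    (fun l a => forall H (xi : ren G H),
     sub_args (fun s x => Var (xi s x)) a = ren_args xi a));
  intros; cbn; f_equal; auto.
Qed.

Lemma sub_Var {G} (p : form L G) : forall H (xi : ren G H),
  sub_form (fun s x => Var (xi s x)) p = ren_form xi p.
Proof.
  induction p; intros; cbn;
    rewrite ?(proj1 sub_Var_term_args), ?(proj2 sub_Var_term_args);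
    f_equal; auto; rewrite sub_up_Var; apply IHp.
Qed.

Lemma ren_id_term_args {G} :
  (forall s (t : term L G s), ren_term (fun s x => x) t = t) /\
  (forall l (a : args L G l), ren_args (fun s x => x) a = a).
Proof.
  apply (term_args_mutind L G
    (fun s t => ren_term (fun s x => x) t = t)
    (fun l a => ren_args (fun s x => x) a = a));
  intros; cbn; f_equal; auto.
Qed.

Lemma ren_id {G} (p : form L G) : ren_form (fun s x => x) p = p.
Proof.
  induction p; cbn; rewrite ?(proj1 ren_id_term_args), ?(proj2 ren_id_term_args);
    f_equal; auto; rewrite ren_up_id; apply IHp.
Qed.

Lemma inst_ren {G H s} (xi : ren G H) (p : form L (s :: G)) (t : term L G s) :
  ren_form xi (inst p t) = inst (ren_form (ren_up xi) p) (ren_term xi t).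
Proof.
  unfold inst. rewrite ren_sub, sub_ren. f_equal.
  funext2 r x. case_var x; reflexivity.
Qed.

Lemma inst_lift {G s} (p : form L G) (t : term L G s) : inst (lift p) t = p.
Proof.
  unfold inst, lift. rewrite sub_ren. cbn. rewrite <- (ren_id p) at 2.
  apply (sub_Var p G (fun s x => x)).
Qed.

Lemma lift_ren {G H s} (xi : ren G H) (p : form L G) :
  ren_form (ren_up (t := s) xi) (lift p) = lift (ren_form xi p).
Proof. unfold lift. rewrite !ren_ren. reflexivity. Qed.

Lemma map_lift_ren {G H s} (xi : ren G H) (A : list (form L G)) :
  map (ren_form (ren_up (t := s) xi)) (map lift A) = map lift (map (ren_form xi) A).
Proof. rewrite !map_map. apply map_ext. intro; apply lift_ren. Qed.

(** * Weakening, renaming and cut *)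

Context (T : theory L).

Lemma prv_weak {G} {A : list (form L G)} {p} :
  prv T A p -> forall B, incl A B -> prv T B p.
Proof.
  induction 1; intros B HB.
  - now apply prv_ax.
  - now apply prv_hyp, HB.
  - apply prv_raa, IHprv. intros x [->|Hx]; [now left|right; auto].
  - apply prv_andI; auto.
  - eapply prv_andE1; eauto.
  - eapply prv_andE2; eauto.
  - apply prv_orI1; auto.
  - apply prv_orI2; auto.
  - eapply prv_orE; [apply IHprv1; auto|apply IHprv2|apply IHprv3];
      intros x [->|Hx]; (now left) || (right; auto).
  - apply prv_impI, IHprv. intros x [->|Hx]; [now left|right; auto].
  - eapply prv_impE; eauto.
  - apply prv_allI, IHprv. now apply incl_map.
  - apply prv_allE; auto.
  - eapply prv_exI; eauto.
  - eapply prv_exE; [apply IHprv1; auto|]. apply IHprv2.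
    intros x [->|Hx]; [now left|right; now apply (incl_map _ HB)].
  - apply prv_eqI.
  - eapply prv_eqE; eauto.
  - apply prv_inh.
Qed.

Lemma prv_ren {G} {A : list (form L G)} {p} :
  prv T A p -> forall H (xi : ren G H), prv T (map (ren_form xi) A) (ren_form xi p).
Proof.
  induction 1; intros K xi; cbn in *.
  - rewrite ren_ren, <- (vnil_eta (fun s x => xi s (vnil s x))). now apply prv_ax.
  - apply prv_hyp. now apply in_map.
  - apply prv_raa. apply (IHprv _ xi).
  - apply prv_andI; auto.
  - eapply prv_andE1; apply IHprv.
  - eapply prv_andE2; apply IHprv.
  - apply prv_orI1; auto.
  - apply prv_orI2; auto.
  - eapply prv_orE; [apply IHprv1|apply (IHprv2 _ xi)|apply (IHprv3 _ xi)].
  - apply prv_impI. apply (IHprv _ xi).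
  - eapply prv_impE; [apply (IHprv1 _ xi)|apply IHprv2].
  - apply prv_allI. rewrite <- map_lift_ren. apply IHprv.
  - rewrite inst_ren. apply prv_allE. apply (IHprv _ xi).
  - apply prv_exI with (t := ren_term xi t). rewrite <- inst_ren. apply IHprv.
  - eapply prv_exE; [apply (IHprv1 _ xi)|].
    rewrite <- map_lift_ren, <- lift_ren. apply (IHprv2 _ (ren_up xi)).
  - apply prv_eqI.
  - rewrite inst_ren. eapply prv_eqE; [apply (IHprv1 _ xi)|].
    rewrite <- inst_ren. apply IHprv2.
  - apply prv_inh.
Qed.

Lemma prv_cut {G} {A B : list (form L G)} {p} :
  (forall q, In q B -> prv T A q) -> prv T B p -> prv T A p.
Proof.
  revert p. induction B as [|q B IH]; intros p HB Hp.
  - apply (prv_weak Hp). intros x [].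
  - apply prv_impE with q; [|apply HB; now left].
    apply IH; [intros r Hr; apply HB; now right|]. now apply prv_impI.
Qed.

End SyntaxLemmas.

(** * Structures and satisfaction *)

(** Assignments are extensional functions on variables, so that functional
    extensionality makes equal assignments interchangeable. *)
Definition valu {X : Set} (D : X -> Type) (G : list X) : Type := forall s, var G s -> D s.

(** [nov] and [cons_v] are [vnil] and [vcons] for values that live in [Type]. *)
Definition nov {X : Set} {D : X -> Type} : valu D [] :=
  fun s x => match x in var G s' return
    match G with [] => D s' | _ :: _ => unit end with vz => tt | vs _ => tt end.

Definition cons_v {X : Set} {D : X -> Type} {G : list X} {t : X}
    (v : D t) (e : valu D G) : valu D (t :: G) :=
  fun s x =>
    match x in var G' s' return
      match G' with
      | [] => unit
      | t' :: G'' => D t' -> valu D G'' -> D s'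
      end
    with
    | vz => fun v _ => v
    | vs y => fun _ e => e _ y
    end v e.

Definition tl_v {X : Set} {D : X -> Type} {G : list X} {t : X}
    (e : valu D (t :: G)) : valu D G := fun s x => e s (vs x).

Fixpoint app_v {X : Set} {D : X -> Type} (l : list X) {G : list X} :
    valu D l -> valu D G -> valu D (l ++ G) :=
  match l return valu D l -> valu D G -> valu D (l ++ G) with
  | [] => fun _ e => e
  | t :: l' => fun a e => cons_v (a t vz) (app_v l' (tl_v a) e)
  end.

Section Valuations.
Context {X : Set} {D : X -> Type}.

Lemma cons_v_eta {G : list X} {t : X} (e : valu D (t :: G)) :
  cons_v (e t vz) (tl_v e) = e.
Proof. funext2 s x. case_var x; reflexivity. Qed.

Lemma nov_eta (e : valu D []) : nov = e.
Proof. funext2 s x. case_var x. Qed.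

Lemma cons_v_ren_up {G H : list X} {t : X} (xi : ren G H) (v : D t) (e : valu D H) :
  (fun s x => cons_v v e s (ren_up xi s x)) = cons_v v (fun s x => e s (xi s x)).
Proof. funext2 s x. case_var x; reflexivity. Qed.

Lemma app_v_left (l : list X) {G : list X} (a : valu D l) (e : valu D G) :
  (fun s x => app_v l a e s (vleft l s x)) = a.
Proof.
  induction l as [|t l IH]; [funext2 s x; case_var x|].
  cbn. rewrite cons_v_ren_up, IH. apply cons_v_eta.
Qed.

Lemma app_v_right (l : list X) {G : list X} (a : valu D l) (e : valu D G) :
  (fun s x => app_v l a e s (vright l s x)) = e.
Proof. induction l as [|t l IH]; [reflexivity|]. apply (IH (tl_v a)). Qed.

Lemma app_v_vleft (l : list X) {G : list X} (a : valu D l) (e : valu D G) s x :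
  app_v l a e s (vleft l s x) = a s x.
Proof. apply (f_equal (fun f => f s x) (app_v_left l a e)). Qed.

Lemma app_v_vright (l : list X) {G : list X} (a : valu D l) (e : valu D G) s x :
  app_v l a e s (vright l s x) = e s x.
Proof. apply (f_equal (fun f => f s x) (app_v_right l a e)). Qed.

Lemma app_v_ren_ups (l : list X) {G H : list X} (xi : ren G H) (a : valu D l) (e : valu D H) :
  (fun s x => app_v l a e s (ren_ups l xi s x)) = app_v l a (fun s x => e s (xi s x)).
Proof.
  induction l as [|t l IH]; [reflexivity|]. cbn. rewrite cons_v_ren_up, IH. reflexivity.
Qed.

Lemma app_v_map {D' : X -> Type} (h : forall s, D s -> D' s) (l : list X) {G : list X}
    (a : valu D l) (e : valu D G) : forall s x,
  h s (app_v l a e s x) = app_v l (fun r y => h r (a r y)) (fun r y => h r (e r y)) s x.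
Proof.
  induction l as [|t l IH]; intros s x; [reflexivity|]. cbn in x.
  case_var x; [reflexivity|]. apply (IH (tl_v a)).
Qed.

End Valuations.

Lemma app_v_vars {X : Set} (l G : list X) : forall s x,
  app_v (D := var (l ++ G)) l (vleft l) (vright l) s x = x.
Proof.
  induction l as [|t l IH]; intros s x; [reflexivity|]. cbn in x.
  case_var x; [reflexivity|]. cbn. rewrite <- (IH s x) at 2. symmetry.
  apply (app_v_map (D := var (l ++ G)) (D' := var (t :: l ++ G)) (fun s x => vs x)).
Qed.

Record structure (L : signature) : Type := Structure {
  dom : sort L -> Type;
  dom_inh : forall s, inhabited (dom s);
  fint : forall f : func L, valu dom (fdom f) -> dom (fcod f);
  rint : forall r : rel L, valu dom (rdom r) -> Prop
}.

Arguments dom {L} _ _.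
Arguments dom_inh {L} _ _.
Arguments fint {L} _ _ _.
Arguments rint {L} _ _ _.

Section Semantics.
Context {L : signature} (M : structure L).

Fixpoint eval {G s} (t : term L G s) (e : valu (dom M) G) : dom M s :=
  match t with
  | Var x => e _ x
  | @App _ _ f a => fint M f (eval_args a e)
  end
with eval_args {G l} (a : args L G l) (e : valu (dom M) G) : valu (dom M) l :=
  match a with
  | anil => nov
  | acons t a' => cons_v (eval t e) (eval_args a' e)
  end.

Fixpoint sat {G} (p : form L G) (e : valu (dom M) G) : Prop :=
  match p with
  | Bot => False
  | Eq t u => eval t e = eval u e
  | @Rel _ _ r a => rint M r (eval_args a e)
  | And p q => sat p e /\ sat q e
  | Or p q => sat p e \/ sat q e
  | Imp p q => sat p e -> sat q e
  | All p => forall v, sat p (cons_v v e)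
  | Ex p => exists v, sat p (cons_v v e)
  end.

Definition models (T : theory L) : Prop := forall p, T p -> sat p nov.

Lemma forall_eq {A : Type} (P Q : A -> Prop) :
  (forall x, P x = Q x) -> (forall x, P x) = (forall x, Q x).
Proof. intro E. now rewrite (functional_extensionality _ _ E). Qed.

Lemma exists_eq {A : Type} (P Q : A -> Prop) :
  (forall x, P x = Q x) -> (exists x, P x) = (exists x, Q x).
Proof. intro E. now rewrite (functional_extensionality _ _ E). Qed.

Lemma eval_sub_term_args {G} :
  (forall s (t : term L G s) H (sg : sub L G H) (e : valu (dom M) H),
     eval (sub_term sg t) e = eval t (fun r x => eval (sg r x) e)) /\
  (forall l (a : args L G l) H (sg : sub L G H) (e : valu (dom M) H),
     eval_args (sub_args sg a) e = eval_args a (fun r x => eval (sg r x) e)).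
Proof.
  apply (term_args_mutind L G
    (fun s t => forall H (sg : sub L G H) (e : valu (dom M) H),
     eval (sub_term sg t) e = eval t (fun r x => eval (sg r x) e))
    (fun l a => forall H (sg : sub L G H) (e : valu (dom M) H),
     eval_args (sub_args sg a) e = eval_args a (fun r x => eval (sg r x) e)));
  intros; cbn; f_equal; auto.
Qed.

Lemma eval_sub {G H s} (sg : sub L G H) (t : term L G s) (e : valu (dom M) H) :
  eval (sub_term sg t) e = eval t (fun r x => eval (sg r x) e).
Proof. apply eval_sub_term_args. Qed.

Lemma eval_args_sub {G H l} (sg : sub L G H) (a : args L G l) (e : valu (dom M) H) :
  eval_args (sub_args sg a) e = eval_args a (fun r x => eval (sg r x) e).
Proof. apply eval_sub_term_args. Qed.

Lemma eval_ren {G H s} (xi : ren G H) (t : term L G s) (e : valu (dom M) H) :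
  eval (ren_term xi t) e = eval t (fun r x => e r (xi r x)).
Proof. rewrite <- (proj1 sub_Var_term_args), eval_sub. reflexivity. Qed.

Lemma eval_args_ren {G H l} (xi : ren G H) (a : args L G l) (e : valu (dom M) H) :
  eval_args (ren_args xi a) e = eval_args a (fun r x => e r (xi r x)).
Proof. rewrite <- (proj2 sub_Var_term_args), eval_args_sub. reflexivity. Qed.

(** Stated as an equality of propositions, so that it can be used for rewriting
    below the connectives. *)
Lemma sat_sub {G} (p : form L G) : forall H (sg : sub L G H) (e : valu (dom M) H),
  sat (sub_form sg p) e = sat p (fun r x => eval (sg r x) e).
Proof.
  assert (U : forall G H t (sg : sub L G H) (v : dom M t) (e : valu (dom M) H),
    (fun r x => eval (sub_up sg r x) (cons_v v e)) =
    cons_v v (fun r x => eval (sg r x) e)).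
  { intros. funext2 r x. case_var x; [reflexivity|]. cbn. now rewrite eval_ren. }
  induction p; intros; cbn; rewrite ?eval_sub, ?eval_args_sub, ?IHp1, ?IHp2; auto.
  - apply forall_eq. intro v. now rewrite IHp, U.
  - apply exists_eq. intro v. now rewrite IHp, U.
Qed.

Lemma sat_ren {G H} (xi : ren G H) (p : form L G) (e : valu (dom M) H) :
  sat (ren_form xi p) e = sat p (fun r x => e r (xi r x)).
Proof. rewrite <- sub_Var, sat_sub. reflexivity. Qed.

Lemma sat_lift {G s} (p : form L G) (v : dom M s) (e : valu (dom M) G) :
  sat (lift p) (cons_v v e) = sat p e.
Proof. unfold lift. rewrite sat_ren. reflexivity. Qed.

Lemma sat_inst {G s} (p : form L (s :: G)) (t : term L G s) (e : valu (dom M) G) :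
  sat (inst p t) e = sat p (cons_v (eval t e) e).
Proof.
  unfold inst. rewrite sat_sub. f_equal. funext2 r x. case_var x; reflexivity.
Qed.

Lemma sat_Iff {G} (p q : form L G) e : sat (Iff p q) e <-> (sat p e <-> sat q e).
Proof. reflexivity. Qed.

Lemma sat_foralls (l : list (sort L)) {G} (p : form L (l ++ G)) (e : valu (dom M) G) :
  sat (foralls l p) e <-> forall a : valu (dom M) l, sat p (app_v l a e).
Proof.
  induction l as [|s l IH]; cbn.
  - split; [auto|]. intro h. apply (h nov).
  - rewrite IH. split.
    + intros h a. apply (h (tl_v a) (a s vz)).
    + intros h a v. apply (h (cons_v v a)).
Qed.

Lemma sat_close {G} (p : form L G) : sat (close p) nov <-> forall e, sat p e.
Proof.
  induction G as [|s G IH]; cbn.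
  - split; [|auto]. intros h e. now rewrite <- (nov_eta e).
  - rewrite IH. cbn. split.
    + intros h e. rewrite <- (cons_v_eta e). apply h.
    + intros h e v. apply h.
Qed.

Lemma eval_var_args {l G : list (sort L)} (xi : ren l G) (e : valu (dom M) G) :
  eval_args (var_args xi) e = (fun s x => e s (xi s x)).
Proof.
  induction l as [|t l IH]; [apply nov_eta|]. cbn. rewrite IH.
  funext2 s x. case_var x; reflexivity.
Qed.

Lemma eval_block (l : list (sort L)) {G} (a : valu (dom M) l) (e : valu (dom M) G) :
  eval_args (block l) (app_v l a e) = a.
Proof. unfold block. rewrite eval_var_args. apply app_v_left. Qed.

(** * Soundness *)

Theorem soundness (T : theory L) : models T ->
  forall G (A : list (form L G)) p, prv T A p ->
  forall e, (forall q, In q A -> sat q e) -> sat p e.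
Proof.
  intros HT G A p Hp. induction Hp; intros e He; cbn in *.
  - rewrite sat_ren, <- (nov_eta (fun r x => e r (vnil r x))). now apply HT.
  - auto.
  - apply NNPP. intro N. apply (IHHp e). intros q [<-|Hq]; auto.
  - auto.
  - apply (IHHp e He).
  - apply (IHHp e He).
  - auto.
  - auto.
  - destruct (IHHp1 e He); [apply IHHp2|apply IHHp3]; intros q' [<-|Hq]; auto.
  - intro Hs. apply IHHp. intros q' [<-|Hq]; auto.
  - apply (IHHp1 e He); auto.
  - intro v. apply IHHp. intros q Hq. apply in_map_iff in Hq as (q' & <- & Hq).
    rewrite sat_lift. auto.
  - rewrite sat_inst. now apply IHHp.
  - exists (eval t e). rewrite <- sat_inst. auto.
  - destruct (IHHp1 e He) as [v Hv]. rewrite <- (sat_lift q v). apply IHHp2.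
    intros q' [<-|Hq]; [auto|]. apply in_map_iff in Hq as (q'' & <- & Hq).
    rewrite sat_lift. auto.
  - reflexivity.
  - rewrite sat_inst, <- (IHHp1 e He), <- sat_inst. auto.
  - destruct (dom_inh M s) as [v]. now exists v.
Qed.

End Semantics.

(** * Henkin construction *)

Lemma inst_shift {L : signature} {G s} (p : form L (s :: G)) :
  inst (ren_form (ren_up shift) p) (Var vz) = p.
Proof.
  unfold inst. rewrite sub_ren.
  replace (fun r y => _) with (fun r (y : var (s :: G) r) => @Var L _ r y)
    by (funext2 r y; case_var y; reflexivity).
  now rewrite (sub_Var p _ (fun r y => y)), ren_id.
Qed.

Section Henkin.
Context {L : signature} (T : theory L) (s0 : sort L).

(** No constants are added to the language: the witnesses are the variables of a
    growing chain of contexts, so that the elimination rule for [Ex] is all that the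
    consistency of a new witness requires.  A task asks for a witness of an
    existential formula, given by its body. *)

Definition task (G : list (sort L)) : Type := {s : sort L & form L (s :: G)}.

Definition ren_task {G H} (xi : ren G H) (t : task G) : task H :=
  existT _ (projT1 t) (ren_form (ren_up xi) (projT2 t)).

Context (enum : forall G, nat -> task G).
Context (enum_surj : forall G (t : task G), exists j, enum G j = t).
Context (A0 : list (sentence L)) (A0_cons : ~ prv T A0 Bot).

(** [todo k j] is the [j]-th task in the context of stage [k], renamed to the present
    context; only the rows up to the present stage are meaningful. *)
Record stage : Type := Stage {
  ctx : list (sort L);
  hyps : list (form L ctx);
  todo : nat -> nat -> task ctx
}.

(** The pairing function lists every task of a stage at some later stage. *)
Definition current (n : nat) (S : stage) : task (ctx S) :=
  todo S (fst (of_nat n)) (snd (of_nat n)).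

(** The new variable is added whether or not the task is consistent, so that the sort
    bound at each stage does not depend on that decision. *)
Definition advance (n : nat) (S : stage) (t : task (ctx S)) : stage :=
  let s := projT1 t in
  let r := projT2 t in
  Stage (s :: ctx S)
    ((if excluded_middle_informative (prv T (Ex r :: hyps S) Bot)
      then lift (Not (Ex r)) else r) :: map lift (hyps S))
    (fun k j => if k =? Datatypes.S n then enum (s :: ctx S) j
                else ren_task shift (todo S k j)).

Fixpoint st (n : nat) : stage :=
  match n with
  | 0 => Stage [] A0 (fun _ j => enum [] j)
  | S n' => advance n' (st n') (current n' (st n'))
  end.

Definition srt (n : nat) : sort L := projT1 (current n (st n)).

(** De Bruijn indices shift from one stage to the next; the stage at which a
    variable was bound names it once and for all. *)
Definition name (s : sort L) : Type := {n : nat | srt n = s}.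

Fixpoint names (n : nat) : valu name (ctx (st n)) :=
  match n return valu name (ctx (st n)) with
  | 0 => nov
  | S n' => cons_v (exist _ n' eq_refl) (names n')
  end.

(** A witness for [r] is harmless when [Ex r] is consistent; otherwise [Not (Ex r)] is
    derivable, and the unused variable is harmless because sorts are inhabited. *)
Lemma stage_consistent n : ~ prv T (hyps (st n)) Bot.
Proof.
  induction n as [|n IH]; [exact A0_cons|]. cbn.
  set (S := st n) in *. destruct (current n S) as [s r]. cbn.
  destruct excluded_middle_informative as [E|E]; intro H.
  - apply IH, prv_impE with (Not (Ex r)); [|now apply prv_impI].
    apply prv_impI, prv_exE with (1 := prv_inh T _ _ s).
    apply (prv_weak T H). intros x Hx. right. exact Hx.
  - apply E, prv_exE with (p := r); [apply prv_hyp; now left|].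
    apply (prv_weak T H). intros x [<-|Hx]; [now left|right; now right].
Qed.

Lemma names_lt n s x : proj1_sig (names n s x) < n.
Proof.
  revert s x. induction n as [|n IH]; intros s x; cbn in x.
  - case_var x.
  - case_var x; cbn; [lia|]. specialize (IH s x). lia.
Qed.

(** Comparing variables of different sorts lets the induction go through without
    any transport along equalities of sorts. *)
Lemma names_inj_sig n : forall s x s' x',
  proj1_sig (names n s x) = proj1_sig (names n s' x') ->
  existT (var (ctx (st n))) s x = existT _ s' x'.
Proof.
  induction n as [|n IH]; intros s x; cbn in x |- *.
  - case_var x.
  - case_var x; intros s' x'; case_var x'; cbn; intro E; auto.
    + pose proof (names_lt n s' x'). lia.
    + pose proof (names_lt n s x). lia.
    + apply IH in E. now inversion E.
Qed.

Lemma names_inj n s (x y : var (ctx (st n)) s) : names n s x = names n s y -> x = y.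
Proof.
  intro E. apply inj_pair2 with (P := var (ctx (st n))).
  apply names_inj_sig. now rewrite E.
Qed.

(** The three facts concern one and the same renaming, the inclusion of contexts, which
    is determined by the first. *)
Lemma stage_mono n N : n <= N ->
  exists xi : ren (ctx (st n)) (ctx (st N)),
    (forall s x, names N s (xi s x) = names n s x) /\
    (forall p, prv T (hyps (st n)) p -> prv T (hyps (st N)) (ren_form xi p)) /\
    (forall j, todo (st N) n j = ren_task xi (enum _ j)).
Proof.
  induction 1 as [|N HN (xi & H1 & H2 & H3)].
  - exists (fun s x => x). repeat split; auto.
    + intro p. now rewrite ren_id.
    + intro j. unfold ren_task. rewrite ren_up_id, ren_id.
      destruct n; cbn; [now destruct (enum [] j)|].
      rewrite Nat.eqb_refl. now destruct (enum _ j).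
  - exists (fun s x => vs (xi s x)). repeat split.
    + intros s x. apply H1.
    + intros p Hp. apply H2 in Hp. apply prv_ren with (xi := shift (t := srt N)) in Hp.
      rewrite ren_ren in Hp. apply (prv_weak T Hp). cbn. intros q Hq. now right.
    + intro j. cbn. replace (n =? S N) with false by (symmetry; apply Nat.eqb_neq; lia).
      rewrite H3. unfold ren_task. cbn. rewrite ren_ren, ren_up_comp. reflexivity.
Qed.

Lemma names_reach s (v : name s) : exists x, names (S (proj1_sig v)) s x = v.
Proof. destruct v as [n <-]. now exists vz. Qed.

Lemma reach {H} (a : valu name H) : exists n, forall N, n <= N ->
  exists xi : ren H (ctx (st N)), (fun s x => names N s (xi s x)) = a.
Proof.
  induction H as [|s H IH].
  - exists 0. intros N _. exists vnil. funext2 r x. case_var x.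
  - destruct (IH (tl_v a)) as [n Hn].
    destruct (names_reach s (a s vz)) as [x Hx].
    exists (n + S (proj1_sig (a s vz))). intros N HN.
    destruct (Hn N) as [xi Hxi]; [lia|].
    destruct (stage_mono (S (proj1_sig (a s vz))) N) as (ze & Hze & _); [lia|].
    exists (vcons (P := var (ctx (st N))) (ze s x) xi). rewrite <- (cons_v_eta a), <- Hxi.
    funext2 r y. case_var y; cbn; [|reflexivity]. now rewrite Hze, Hx.
Qed.

Lemma ren_names_inj {H} n (xi ze : ren H (ctx (st n))) :
  (fun s x => names n s (xi s x)) = (fun s x => names n s (ze s x)) -> xi = ze.
Proof.
  intro E. funext2 s x. apply names_inj. exact (f_equal (fun f => f s x) E).
Qed.

(** Truth in the limit of the chain, for a formula whose variables are assigned
    names. *)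
Definition Tr {H} (p : form L H) (a : valu name H) : Prop :=
  exists n (xi : ren H (ctx (st n))),
    (fun s x => names n s (xi s x)) = a /\ prv T (hyps (st n)) (ren_form xi p).

(** Inclusions of contexts being unique, truth at one stage persists under every
    admissible renaming at all later stages. *)
Lemma Tr_large {H} (p : form L H) a : Tr p a -> exists n, forall N, n <= N ->
  forall xi : ren H (ctx (st N)), (fun s x => names N s (xi s x)) = a ->
    prv T (hyps (st N)) (ren_form xi p).
Proof.
  intros (n & xi & E & Hp). exists n. intros N HN ze Hze.
  destruct (stage_mono n N HN) as (up & H1 & H2 & _).
  apply H2 in Hp. rewrite ren_ren in Hp.
  replace ze with (fun s x => up s (xi s x)); [exact Hp|].
  apply ren_names_inj. rewrite Hze, <- E. funext2 s x. apply H1.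
Qed.

Lemma Tr_prv {H} (B : list (form L H)) p a :
  prv T B p -> (forall q, In q B -> Tr q a) -> Tr p a.
Proof.
  intros Hp HB.
  assert (exists n, forall N, n <= N ->
    forall xi : ren H (ctx (st N)), (fun s x => names N s (xi s x)) = a ->
    forall q, In q B -> prv T (hyps (st N)) (ren_form xi q)) as [n Hn].
  { clear Hp. induction B as [|q B IH]; [now exists 0|].
    destruct IH as [n Hn]; [intros; apply HB; now right|].
    destruct (Tr_large q a) as [m Hm]; [apply HB; now left|].
    exists (n + m). intros N HN xi E q' [<-|Hq']; [apply Hm; auto; lia|].
    apply Hn; auto; lia. }
  destruct (reach a) as [m Hm]. destruct (Hm (n + m)) as [xi Hxi]; [lia|].
  exists (n + m), xi. split; [exact Hxi|].
  apply prv_cut with (B := map (ren_form xi) B); [|now apply prv_ren].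
  intros q Hq. apply in_map_iff in Hq as (q' & <- & Hq'). apply Hn; auto; lia.
Qed.

Lemma Tr_prv1 {H} (q p : form L H) a : Tr q a -> prv T [q] p -> Tr p a.
Proof. intros Hq Hp. apply (Tr_prv [q] p a Hp). now intros r [<-|[]]. Qed.

Lemma Tr_ren {H K} (ze : ren H K) (p : form L H) a :
  Tr (ren_form ze p) a <-> Tr p (fun s x => a s (ze s x)).
Proof.
  split.
  - intros (n & xi & <- & Hp). exists n, (fun s x => xi s (ze s x)).
    split; [reflexivity|]. now rewrite ren_ren in Hp.
  - intro Hp. destruct (Tr_large _ _ Hp) as [n Hn]. destruct (reach a) as [m Hm].
    destruct (Hm (n + m)) as [xi Hxi]; [lia|]. exists (n + m), xi.
    split; [exact Hxi|]. rewrite ren_ren. apply Hn; [lia|].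
    funext2 s x. exact (f_equal (fun f => f s (ze s x)) Hxi).
Qed.

Lemma Tr_lift {H s} (p : form L H) (v : name s) a : Tr (lift p) (cons_v v a) <-> Tr p a.
Proof. unfold lift. rewrite Tr_ren. reflexivity. Qed.

Lemma Tr_Bot {H} (a : valu name H) : ~ Tr Bot a.
Proof. intros (n & xi & _ & Hp). now apply (stage_consistent n). Qed.

Lemma advance_witness n (S : stage) {s} (r : form L (s :: ctx S)) :
  ~ prv T (Ex r :: hyps S) Bot ->
  prv T (hyps (advance n S (existT _ s r)))
    (ren_form (vcons (P := var (s :: ctx S)) vz (fun s x => vs x)) r).
Proof.
  intro C. cbn. destruct excluded_middle_informative as [E|E]; [contradiction|].
  apply prv_hyp. left. rewrite <- (ren_id r) at 1. f_equal.
  symmetry. apply (vcons_eta (fun s x => x)).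
Qed.

Lemma st_witness n {s} (r : form L (s :: ctx (st n))) :
  current n (st n) = existT _ s r -> ~ prv T (Ex r :: hyps (st n)) Bot ->
  exists x : var (ctx (st (S n))) s,
    prv T (hyps (st (S n)))
      (ren_form (vcons (P := var (ctx (st (S n)))) x
         (fun t (y : var (ctx (st n)) t) => vs y)) r).
Proof.
  intros E C.
  change (exists x : var (ctx (advance n (st n) (current n (st n)))) s,
    prv T (hyps (advance n (st n) (current n (st n))))
      (ren_form (vcons (P := var (ctx (advance n (st n) (current n (st n))))) x
         (fun t (y : var (ctx (st n)) t) => vs y)) r)).
  rewrite E. exists vz. now apply advance_witness.
Qed.

(** The Henkin property: the task given by [p] comes up at some stage, and that stage
    either provides a witness or refutes [Ex p]. *)
Lemma Tr_witness {H s} (p : form L (s :: H)) a :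
  (exists v, Tr p (cons_v v a)) \/ Tr (Not (Ex p)) a.
Proof.
  destruct (reach a) as [n Hn]. destruct (Hn n) as [xi Hxi]; [lia|].
  destruct (enum_surj _ (existT _ s (ren_form (ren_up xi) p))) as [j Hj].
  (* The task in row [n], column [j] is treated at stage [N = to_nat (n, j)]. *)
  assert (HN : n <= to_nat (n, j)) by (pose proof (to_nat_non_decreasing n j); lia).
  destruct (stage_mono n _ HN) as (up & H1 & _ & H3). set (N := to_nat (n, j)) in *.
  set (ze := fun s x => up s (xi s x)).
  assert (Hcur : current N (st N) = existT _ s (ren_form (ren_up ze) p)).
  { unfold current. replace (of_nat N) with (n, j) by (symmetry; apply cancel_of_to).
    cbn [fst snd]. rewrite H3, Hj.
    unfold ren_task. cbn. now rewrite ren_ren, ren_up_comp. }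
  assert (E : (fun s x => names N s (ze s x)) = a).
  { rewrite <- Hxi. funext2 t x. apply H1. }
  destruct (classic (prv T (Ex (ren_form (ren_up ze) p) :: hyps (st N)) Bot)) as [C|C].
  - right. exists N, ze. split; [exact E|]. apply prv_impI. exact C.
  - left. destruct (st_witness N _ Hcur C) as [x Hx].
    exists (names (S N) s x), (S N), (vcons (P := var (ctx (st (S N)))) x
        (fun s y => vs (ze s y))). split.
    + rewrite <- E. funext2 t y. case_var y; reflexivity.
    + rewrite ren_ren in Hx. replace (vcons _ _) with
        (fun t y => vcons (P := var (ctx (st (S N)))) x
          (fun s (z : var (ctx (st N)) s) => vs z) t (ren_up ze t y));
        [exact Hx|].
      funext2 t y. case_var y; reflexivity.
Qed.

(** A formula is decided together with its vacuous existential quantification. *)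
Lemma Tr_complete {H} (p : form L H) a : Tr p a \/ Tr (Not p) a.
Proof.
  destruct (Tr_witness (s := s0) (lift p) a) as [[v Hv]|Hn].
  - left. now rewrite Tr_lift in Hv.
  - right. apply (Tr_prv [Not (Ex (lift (s := s0) p))]); [|intros q [<-|[]]; exact Hn].
    apply prv_impI, prv_exE with (1 := prv_inh T _ _ s0).
    apply prv_impE with (p := lift (Ex (lift (s := s0) p)));
      [apply prv_hyp; cbn; auto|].
    assert (E : prv T [lift (s := s0) p] (lift (Ex (lift (s := s0) p)))).
    { change (prv T [lift (s := s0) p]
        (Ex (ren_form (ren_up (shift (t := s0))) (lift (s := s0) p)))).
      apply prv_exI with (t := Var vz). rewrite lift_ren, inst_lift.
      apply prv_hyp. now left. }
    apply (prv_weak T E). intros q [<-|[]]. cbn. auto.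
Qed.

Lemma Tr_Not {H} (p : form L H) a : Tr (Not p) a <-> ~ Tr p a.
Proof.
  split.
  - intros Hn Hp. apply (Tr_Bot a), (Tr_prv [Not p; p]); [|intros q [<-|[<-|[]]]; auto].
    apply prv_impE with p; apply prv_hyp; cbn; auto.
  - destruct (Tr_complete p a); tauto.
Qed.

Lemma Tr_And {H} (p q : form L H) a : Tr (And p q) a <-> Tr p a /\ Tr q a.
Proof.
  split.
  - intro Hpq. split; apply (Tr_prv [And p q]); try (intros r [<-|[]]; exact Hpq).
    + eapply prv_andE1, prv_hyp. now left.
    + eapply prv_andE2, prv_hyp. now left.
  - intros [Hp Hq]. apply (Tr_prv [p; q]); [|intros r [<-|[<-|[]]]; auto].
    apply prv_andI; apply prv_hyp; cbn; auto.
Qed.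

Lemma Tr_Or {H} (p q : form L H) a : Tr (Or p q) a <-> Tr p a \/ Tr q a.
Proof.
  split.
  - intro Hpq. destruct (Tr_complete p a) as [Hp|Hp]; auto.
    destruct (Tr_complete q a) as [Hq|Hq]; auto. exfalso.
    apply (Tr_Bot a), (Tr_prv [Or p q; Not p; Not q]);
      [|intros r [<-|[<-|[<-|[]]]]; auto].
    apply prv_orE with p q; [apply prv_hyp; cbn; auto| |].
    + apply prv_impE with p; apply prv_hyp; cbn; auto.
    + apply prv_impE with q; apply prv_hyp; cbn; auto.
  - intros [Hp|Hp]; [apply (Tr_prv [p])|apply (Tr_prv [q])];
      try (intros r [<-|[]]; exact Hp).
    + apply prv_orI1, prv_hyp. now left.
    + apply prv_orI2, prv_hyp. now left.
Qed.

Lemma Tr_Imp {H} (p q : form L H) a : Tr (Imp p q) a <-> (Tr p a -> Tr q a).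
Proof.
  split.
  - intros Hpq Hp. apply (Tr_prv [Imp p q; p]); [|intros r [<-|[<-|[]]]; auto].
    apply prv_impE with p; apply prv_hyp; cbn; auto.
  - intro Hpq. destruct (Tr_complete p a) as [Hp|Hp].
    + apply (Tr_prv [q]); [|intros r [<-|[]]; auto].
      apply prv_impI, prv_hyp. cbn; auto.
    + apply (Tr_prv [Not p]); [|intros r [<-|[]]; auto].
      apply prv_impI, prv_raa, prv_impE with p; apply prv_hyp; cbn; auto.
Qed.

Lemma Tr_inst {H K s} (p : form L (s :: H)) (xi : ren H K) (x : var K s) a :
  Tr (inst (ren_form (ren_up xi) p) (Var x)) a <->
  Tr p (cons_v (a s x) (fun r y => a r (xi r y))).
Proof.
  unfold inst. rewrite sub_ren.
  replace (fun r y => _) with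
    (fun r y => @Var L K r (vcons (P := var K) x xi r y))
    by (funext2 r y; case_var y; reflexivity).
  rewrite sub_Var, Tr_ren.
  replace (fun r y => a r _) with (cons_v (a s x) (fun r y => a r (xi r y)));
    [reflexivity|funext2 r y; case_var y; reflexivity].
Qed.

Lemma Tr_inst0 {H s} (p : form L (s :: H)) (v : name s) a :
  Tr (inst (ren_form (ren_up shift) p) (Var vz)) (cons_v v a) <-> Tr p (cons_v v a).
Proof. apply (Tr_inst p shift vz (cons_v v a)). Qed.

Lemma Tr_Ex {H s} (p : form L (s :: H)) a : Tr (Ex p) a <-> exists v, Tr p (cons_v v a).
Proof.
  split.
  - intro Hp. destruct (Tr_witness p a) as [?|Hn]; [auto|].
    now apply Tr_Not in Hn.
  - intros [v Hv]. rewrite <- (Tr_lift _ v). rewrite <- Tr_inst0 in Hv.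
    refine (Tr_prv1 _ _ _ Hv _).
    apply prv_exI with (t := Var vz), prv_hyp. now left.
Qed.

Lemma Tr_All {H s} (p : form L (s :: H)) a : Tr (All p) a <-> forall v, Tr p (cons_v v a).
Proof.
  split.
  - intros Hp v. rewrite <- Tr_inst0. rewrite <- (Tr_lift _ v) in Hp.
    refine (Tr_prv1 _ _ _ Hp _).
    refine (prv_allE T _ _ _ _ (Var vz) (prv_hyp T _ _ _ _)). now left.
  - intro Hp. destruct (Tr_complete (Ex (Not p)) a) as [E|E].
    + apply Tr_Ex in E as [v Hv]. apply Tr_Not in Hv. now destruct Hv.
    + apply (Tr_prv [Not (Ex (Not p))]); [|intros q [<-|[]]; auto].
      apply prv_allI, prv_raa, prv_impE with (p := lift (Ex (Not p)));
        [apply prv_hyp; cbn; auto|].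
      apply prv_exI with (t := Var vz).
      change (prv T (Not p :: map lift [Not (Ex (Not p))])
        (inst (ren_form (ren_up (shift (t := s))) (Not p)) (Var vz))).
      rewrite inst_shift. apply prv_hyp. now left.
Qed.

(** * The term model *)

Lemma Tr_eqE {H s} (p : form L (s :: H)) (t u : term L H s) a :
  Tr (Eq t u) a -> Tr (inst p t) a -> Tr (inst p u) a.
Proof.
  intros E Hp. apply (Tr_prv [Eq t u; inst p t]); [|intros q [<-|[<-|[]]]; auto].
  apply prv_eqE with t; apply prv_hyp; cbn; auto.
Qed.

Lemma Tr_refl {H s} (t : term L H s) a : Tr (Eq t t) a.
Proof. apply (Tr_prv []); [apply prv_eqI|intros q []]. Qed.

Lemma Tr_sym {H s} (t u : term L H s) a : Tr (Eq t u) a -> Tr (Eq u t) a.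
Proof.
  intro E. pose (p := Eq (Var vz) (ren_term (shift (t := s)) t)).
  assert (I : forall v, inst p v = Eq v t).
  { intro v. unfold p, inst. cbn. f_equal. rewrite sub_ren_term. cbn.
    rewrite (proj1 sub_Var_term_args _ _ _ (fun r x => x)). apply ren_id_term_args. }
  rewrite <- I. apply (Tr_eqE p t u a E). rewrite I. apply Tr_refl.
Qed.

Lemma Tr_trans {H s} (t u v : term L H s) a :
  Tr (Eq t u) a -> Tr (Eq u v) a -> Tr (Eq t v) a.
Proof.
  intros E F. pose (p := Eq (ren_term (shift (t := s)) t) (Var vz)).
  assert (I : forall v, inst p v = Eq t v).
  { intro w. unfold p, inst. cbn. f_equal. rewrite sub_ren_term. cbn.
    rewrite (proj1 sub_Var_term_args _ _ _ (fun r x => x)). apply ren_id_term_args. }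
  rewrite <- I. apply (Tr_eqE p u v a F). now rewrite I.
Qed.

(** Congruence for a whole tuple of terms, replaced one at a time from the head. *)
Lemma Tr_subst (l : list (sort L)) : forall {K} (p : form L (l ++ K))
    (sg ta : valu (term L K) l) a,
  (forall s x, Tr (Eq (sg s x) (ta s x)) a) ->
  Tr (sub_form (app_v l sg (fun s x => Var x)) p) a ->
  Tr (sub_form (app_v l ta (fun s x => Var x)) p) a.
Proof.
  induction l as [|s l IH]; intros K p sg ta a E Hp; [exact Hp|].
  cbn [app_v app] in *.
  set (sg' := app_v l (tl_v sg) (fun s x => Var x)) in *.
  set (ta' := app_v l (tl_v ta) (fun s x => Var x)).
  assert (I : forall (rho : valu (term L K) (l ++ K)) (u : term L K s),
    inst (sub_form (sub_up rho) p) u = sub_form (cons_v u rho) p).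
  { intros rho u. unfold inst. rewrite sub_sub. f_equal. funext2 r x.
    case_var x; [reflexivity|]. cbn. rewrite sub_ren_term. cbn.
    rewrite (proj1 sub_Var_term_args _ _ _ (fun r x => x)). apply ren_id_term_args. }
  rewrite <- I. apply (Tr_eqE _ (sg s vz) _ a (E s vz)). rewrite I.
  assert (J : forall rho : valu (term L K) l,
    sub_form (app_v l rho (fun s x => Var x))
      (inst p (ren_term (vright l) (sg s vz))) =
    sub_form (cons_v (sg s vz) (app_v l rho (fun s x => Var x))) p).
  { intros rho. unfold inst. rewrite sub_sub. f_equal. funext2 r x.
    case_var x; [|reflexivity]. cbn. rewrite sub_ren_term.
    rewrite app_v_right.
    rewrite (proj1 sub_Var_term_args _ _ _ (fun r x => x)). apply ren_id_term_args. }
  unfold ta'. rewrite <- J. apply (IH _ _ (tl_v sg)).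
  - intros r x. apply (E r (vs x)).
  - rewrite J. exact Hp.
Qed.

Definition eqv {s} (u v : name s) : Prop :=
  Tr (H := [s; s]) (Eq (Var vz) (Var (vs vz))) (cons_v u (cons_v v nov)).

Lemma Tr_eqv {H s} (x y : var H s) a : Tr (Eq (Var x) (Var y)) a <-> eqv (a s x) (a s y).
Proof.
  unfold eqv.
  change (Eq (Var x) (Var y)) with
    (ren_form (vcons (P := var H) x (vcons (P := var H) y vnil))
       (Eq (L := L) (G := [s; s]) (Var vz) (Var (vs vz)))).
  rewrite Tr_ren. replace (fun r z => _) with (cons_v (a s x) (cons_v (a s y) nov));
    [reflexivity|]. funext2 r z. case_var z; [reflexivity|]. case_var z; [reflexivity|].
  case_var z.
Qed.

Lemma eqv_refl {s} (u : name s) : eqv u u.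
Proof. apply (Tr_eqv (H := [s]) vz vz (cons_v u nov)), Tr_refl. Qed.

Lemma eqv_sym {s} (u v : name s) : eqv u v -> eqv v u.
Proof. intro E. apply (Tr_eqv (vs vz) vz (cons_v u (cons_v v nov))), Tr_sym, E. Qed.

Lemma eqv_trans {s} (u v w : name s) : eqv u v -> eqv v w -> eqv u w.
Proof.
  intros E F. set (a := cons_v u (cons_v v (cons_v w nov)) : valu name [s; s; s]).
  apply (Tr_eqv vz (vs (vs vz)) a), Tr_trans with (Var (vs vz)).
  - apply (Tr_eqv vz (vs vz) a), E.
  - apply (Tr_eqv (vs vz) (vs (vs vz)) a), F.
Qed.

Lemma Tr_replace {H s} (p : form L (s :: H)) (u v : name s) a :
  eqv u v -> Tr p (cons_v u a) -> Tr p (cons_v v a).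
Proof.
  intros E Hp.
  apply (Tr_inst p (fun r y => vs (vs y)) (vs vz) (cons_v u (cons_v v a))).
  apply Tr_eqE with (Var vz); [now apply Tr_eqv|]. now apply Tr_inst.
Qed.

(** The quotient by provable equality is realized by chosen representatives. *)
Definition rep {s} (v : name s) : name s := epsilon (inhabits v) (fun u => eqv v u).

Lemma rep_eqv {s} (v : name s) : eqv v (rep v).
Proof. unfold rep. apply epsilon_spec. exists v. apply eqv_refl. Qed.

Lemma rep_eq {s} (u v : name s) : eqv u v -> rep u = rep v.
Proof.
  intro E. unfold rep. rewrite (proof_irrelevance _ (inhabits u) (inhabits v)). f_equal.
  apply functional_extensionality. intro w. apply propositional_extensionality.
  split; intro F; [apply eqv_trans with u; auto using eqv_sym|apply eqv_trans with v; auto].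
Qed.

Definition tm_dom (s : sort L) : Type := {v : name s | rep v = v}.

Definition val {s} (d : tm_dom s) : name s := proj1_sig d.

Definition cls {s} (v : name s) : tm_dom s :=
  exist _ (rep v) (eq_sym (rep_eq _ _ (rep_eqv v))).

Lemma val_eqv {s} (d d' : tm_dom s) : eqv (val d) (val d') -> d = d'.
Proof.
  destruct d as [v E], d' as [v' E']. cbn. intro F. apply subset_eq_compat.
  rewrite <- E, <- E'. now apply rep_eq.
Qed.

Fixpoint tup {l G : list (sort L)} : valu (term L G) l -> args L G l :=
  match l return valu (term L G) l -> args L G l with
  | [] => fun _ => anil
  | s :: l' => fun f => acons (f s vz) (tup (tl_v f))
  end.

Fixpoint args_nth {l G} (a : args L G l) : valu (term L G) l :=
  match a with
  | anil => nov
  | acons t a' => cons_v t (args_nth a')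
  end.

Lemma tup_nth {l G} (a : args L G l) : tup (args_nth a) = a.
Proof. induction a; cbn; f_equal. exact IHa. Qed.

Lemma sub_args_tup {l G H} (sg : sub L G H) (f : valu (term L G) l) :
  sub_args sg (tup f) = tup (fun s x => sub_term sg (f s x)).
Proof. induction l as [|s l IH]; cbn; f_equal. apply IH. Qed.

Lemma args_nth_ren {l G H} (xi : ren G H) (a : args L G l) s x :
  args_nth (ren_args xi a) s x = ren_term xi (args_nth a s x).
Proof.
  revert s x. induction a as [|t l u a IH]; intros s x; [case_var x|].
  case_var x; [reflexivity|]. apply IH.
Qed.

(** Terms take values among the names; a name is the value of a term when the
    equation between them is true. *)
Definition denotes {K s} (t : term L K s) (e : valu name K) (v : name s) : Prop :=
  Tr (Eq (ren_term (shift (t := s)) t) (Var vz)) (cons_v v e).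

Lemma denotes_ren {K H s} (xi : ren K H) (y : var H s) (t : term L K s) a :
  denotes t (fun r x => a r (xi r x)) (a s y) ->
  Tr (Eq (ren_term xi t) (Var y)) a.
Proof.
  intro D. unfold denotes in D.
  replace (Eq (ren_term xi t) (Var y)) with
    (ren_form (vcons (P := var H) y xi) (Eq (ren_term (shift (t := s)) t) (Var vz)))
    by (cbn; now rewrite ren_ren_term).
  rewrite Tr_ren. replace (fun r z => _) with (cons_v (a s y) (fun r x => a r (xi r x)));
    [exact D|]. funext2 r z. case_var z; reflexivity.
Qed.

(** Substituting terms for variables amounts to assigning their values to the
    variables: in the context [l ++ K] both sides are substitution instances of one
    formula, by tuples of terms that are provably equal. *)
Lemma Tr_args {l K} (a : args L K l) (b : valu name l) (e : valu name K) :
  (forall s x, denotes (args_nth a s x) e (b s x)) ->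
  forall p : form L (l ++ K),
  Tr p (app_v l b e) <-> Tr (sub_form (app_v l (args_nth a) (fun s x => Var x)) p) e.
Proof.
  intros D p. set (A := app_v l b e).
  set (q := ren_form (ren_ups l (vright l)) p : form L (l ++ (l ++ K))).
  set (sg := (fun s x => Var (vleft l s x)) : valu (term L (l ++ K)) l).
  set (ta := (fun s x => ren_term (vright l) (args_nth a s x)) : valu (term L (l ++ K)) l).
  assert (E : forall s x, Tr (Eq (ta s x) (sg s x)) A).
  { intros s x. unfold ta, sg. apply denotes_ren. unfold A.
    rewrite app_v_right, app_v_vleft. apply D. }
  (* [q] instantiated by the variables of [l] is [p], and by [a] it is the right side. *)
  assert (Q1 : sub_form (app_v l sg (fun s x => Var x)) q = p).
  { unfold q. rewrite sub_ren, app_v_ren_ups.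
    replace (app_v l _ _) with (fun s (x : var (l ++ K) s) => @Var L _ s x).
    - now rewrite (sub_Var p _ (fun s x => x)), ren_id.
    - funext2 s x. rewrite <- (app_v_vars l K s x) at 1.
      apply (app_v_map (D := var (l ++ K)) (D' := term L (l ++ K)) (fun s x => Var x)). }
  assert (Q2 : sub_form (app_v l ta (fun s x => Var x)) q =
    ren_form (vright l) (sub_form (app_v l (args_nth a) (fun s x => Var x)) p)).
  { unfold q. rewrite sub_ren, app_v_ren_ups, ren_sub. f_equal. unfold ta. clear.
    funext2 s x. symmetry.
    apply (app_v_map (D := term L K) (D' := term L (l ++ K)) (fun s => ren_term (vright l))). }
  rewrite <- Q1 at 1.
  transitivity (Tr (sub_form (app_v l ta (fun s x => Var x)) q) A).
  - split; apply Tr_subst; auto. intros; now apply Tr_sym.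
  - rewrite Q2, Tr_ren. unfold A. now rewrite app_v_right.
Qed.

Lemma app_denotes (f : func L) (b : valu name (fdom f)) :
  exists v, Tr (H := fcod f :: fdom f)
    (Eq (App (tup (fun s x => Var (vs x)))) (Var vz)) (cons_v v b).
Proof.
  apply Tr_Ex, (Tr_prv []); [|intros q []].
  apply prv_exI with (t := App (tup (fun s x => Var x))).
  unfold inst. cbn. rewrite sub_args_tup. apply prv_eqI.
Qed.

(** Functions and relations are read off the truths about variables. *)
Definition term_model : structure L.
Proof.
  refine (Structure L tm_dom _
    (fun f b => cls (proj1_sig (constructive_indefinite_description _
       (app_denotes f (fun s x => val (b s x))))))
    (fun r b => Tr (Rel (tup (fun s x => Var x))) (fun s x => val (b s x)))).
  intro s.
  assert (E : Tr (Ex (Eq (Var (vz (s := s))) (Var vz))) nov).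
  { apply (Tr_prv []); [apply prv_inh|intros q []]. }
  apply Tr_Ex in E as [v _]. exact (inhabits (cls v)).
Defined.

Definition vals {H} (e : valu tm_dom H) : valu name H := fun s x => val (e s x).

Lemma term_model_app f (b : valu tm_dom (fdom f)) :
  Tr (H := fcod f :: fdom f) (Eq (App (tup (fun s x => Var (vs x)))) (Var vz))
    (cons_v (val (fint term_model f b)) (vals b)).
Proof.
  cbn. destruct constructive_indefinite_description as [v Hv]. cbn.
  apply Tr_replace with v; [apply rep_eqv|exact Hv].
Qed.

Lemma vals_cons {H s} (d : tm_dom s) (e : valu tm_dom H) :
  vals (cons_v d e) = cons_v (val d) (vals e).
Proof. funext2 r x. case_var x; reflexivity. Qed.

Lemma denotes_eval {H} :
  (forall s (t : term L H s) (e : valu tm_dom H),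
     denotes t (vals e) (val (eval term_model t e))) /\
  (forall l (a : args L H l) (e : valu tm_dom H) s x,
     denotes (args_nth a s x) (vals e) (val (eval_args term_model a e s x))).
Proof.
  apply (term_args_mutind L H
    (fun s t => forall e : valu tm_dom H,
       denotes t (vals e) (val (eval term_model t e)))
    (fun l a => forall (e : valu tm_dom H) s x,
       denotes (args_nth a s x) (vals e) (val (eval_args term_model a e s x)))).
  - intros s x e. apply (Tr_eqv (vs x) vz). apply eqv_refl.
  - intros f a IH e. unfold denotes. cbn [eval].
    set (b := eval_args term_model a e) in *. set (v := val (fint term_model f b)).
    pose proof (Tr_args (ren_args (shift (t := fcod f)) a) (vals b)
      (cons_v v (vals e))) as HA.
    assert (D : forall s x, denotes (args_nth (ren_args (shift (t := fcod f)) a) s x)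
      (cons_v v (vals e)) (vals b s x)).
    { intros s x. rewrite args_nth_ren. unfold denotes. rewrite ren_ren_term.
      apply denotes_ren with (a := cons_v _ (cons_v _ _)). apply IH. }
    specialize (HA D (Eq (App (tup (fun s x => Var (vleft _ s x))))
      (Var (vright (fdom f) _ vz)))).
    cbn in HA. rewrite sub_args_tup in HA. cbn in HA.
    rewrite app_v_left, tup_nth, app_v_vright in HA. apply HA. clear HA D.
    pose proof (term_model_app f b) as HT. fold v in HT.
    set (ze := vcons (P := var (fdom f ++ fcod f :: H)) (vright (fdom f) _ vz) (vleft _)).
    replace (Eq _ _) with (ren_form ze
      (Eq (App (tup (fun s x => Var (vs x)))) (Var vz))).
    + rewrite Tr_ren. replace (fun s x => _) with (cons_v v (vals b)); [exact HT|].
      funext2 s x. case_var x; cbn; [now rewrite app_v_vright|now rewrite app_v_vleft].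
    + cbn. rewrite <- (proj2 sub_Var_term_args), sub_args_tup. reflexivity.
  - intros e s x. case_var x.
  - intros s l t IHt a IHa e r x. case_var x; [apply IHt|apply IHa].
Qed.

(** In the quantifier cases the Henkin property produces a name, which is then replaced
    by the representative of its class. *)
Lemma truth {H} (p : form L H) : forall e : valu tm_dom H,
  sat term_model p e <-> Tr p (vals e).
Proof.
  induction p as [H|H s t u|H r a|H p IHp q IHq|H p IHp q IHq|H p IHp q IHq|H s p IH|H s p IH];
    intro e.
  - split; [intros []|apply Tr_Bot].
  - cbn [sat]. set (v := eval term_model t e). set (w := eval term_model u e).
    pose proof (proj1 denotes_eval s t e) as Dt. pose proof (proj1 denotes_eval s u e) as Du.
    fold v in Dt. fold w in Du.
    pose (A := cons_v (val v) (cons_v (val w) (vals e))).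
    pose proof (denotes_ren (fun r x => vs (vs x)) vz t A Dt) as Dt'.
    pose proof (denotes_ren (fun r x => vs (vs x)) (vs vz) u A Du) as Du'.
    assert (I : Tr (Eq (ren_term (fun r x => vs (vs x)) t)
      (ren_term (fun r x => vs (vs x)) u)) A <-> Tr (Eq t u) (vals e)).
    { apply (Tr_ren (fun r x => vs (vs x)) (Eq t u) A). }
    rewrite <- I. split.
    + intro E. apply Tr_trans with (Var vz); [exact Dt'|]. apply Tr_sym.
      apply Tr_trans with (Var (vs vz)); [exact Du'|]. apply Tr_eqv. cbn. rewrite E.
      apply eqv_refl.
    + intro E. apply val_eqv, (Tr_eqv vz (vs vz) A).
      apply Tr_trans with (ren_term (fun r x => vs (vs x)) t); [now apply Tr_sym|].
      now apply Tr_trans with (ren_term (fun r x => vs (vs x)) u).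
  - cbn [sat]. set (b := eval_args term_model a e).
    pose proof (Tr_args a (vals b) (vals e) (proj2 denotes_eval _ a e)
      (Rel (r := r) (tup (fun s x => Var (vleft _ s x))))) as HA.
    cbn in HA. rewrite sub_args_tup in HA. cbn in HA. rewrite app_v_left, tup_nth in HA.
    rewrite <- HA. cbn.
    replace (Rel (r := r) (tup (fun s x => Var (vleft _ s x)))) with
      (ren_form (vleft _ (G := H)) (Rel (r := r) (tup (fun s x => Var x)))).
    + rewrite Tr_ren. now rewrite app_v_left.
    + cbn. rewrite <- (proj2 sub_Var_term_args), sub_args_tup. reflexivity.
  - cbn. now rewrite Tr_And, IHp, IHq.
  - cbn. now rewrite Tr_Or, IHp, IHq.
  - cbn. now rewrite Tr_Imp, IHp, IHq.
  - cbn. rewrite Tr_All. split.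
    + intros Hp v. specialize (Hp (cls v)). rewrite IH, vals_cons in Hp.
      apply Tr_replace with (2 := Hp). apply eqv_sym, rep_eqv.
    + intros Hp d. rewrite IH, vals_cons. apply Hp.
  - cbn. rewrite Tr_Ex. split.
    + intros [d Hd]. exists (val d). now rewrite <- vals_cons, <- IH.
    + intros [v Hv]. exists (cls v). rewrite IH, vals_cons.
      apply Tr_replace with (2 := Hv). apply rep_eqv.
Qed.

Lemma model_existence : exists M, models M T /\ forall p, In p A0 -> sat M p nov.
Proof.
  exists term_model. split.
  - intros p Hp. apply truth, (Tr_prv []); [|intros q []].
    rewrite <- (ren_id p), <- (vnil_eta (fun s x => x)). now apply prv_ax.
  - intros p Hp. apply truth. exists 0, (fun s x => x). split; [funext2 s x; case_var x|].
    rewrite ren_id. now apply prv_hyp.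
Qed.

End Henkin.

(** * Completeness for countable signatures *)

Definition countable (X : Type) : Prop :=
  exists f : X -> nat, forall x y, f x = f y -> x = y.

Record countable_sig (L : signature) : Prop := {
  count_sort : countable (sort L);
  count_func : countable (func L);
  count_rel : countable (rel L)
}.

Section Coding.
Context {L : signature}.
Context (cs : sort L -> nat) (cs_inj : forall x y, cs x = cs y -> x = y).
Context (cf : func L -> nat) (cf_inj : forall x y, cf x = cf y -> x = y).
Context (cr : rel L -> nat) (cr_inj : forall x y, cr x = cr y -> x = y).

Notation pair := (fun m n => to_nat (m, n)).

Lemma pair_inj m n m' n' : pair m n = pair m' n' -> m = m' /\ n = n'.
Proof. intro E. apply to_nat_inj in E. now inversion E. Qed.

Fixpoint code_var {G : list (sort L)} {s} (x : var G s) : nat :=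
  match x with vz => 0 | vs y => S (code_var y) end.

Fixpoint code_term {G s} (t : term L G s) : nat :=
  match t with
  | Var x => pair 0 (code_var x)
  | @App _ _ f a => pair 1 (pair (cf f) (code_args a))
  end
with code_args {G l} (a : args L G l) : nat :=
  match a with
  | anil => 0
  | acons t a' => S (pair (code_term t) (code_args a'))
  end.

Fixpoint code_form {G} (p : form L G) : nat :=
  match p with
  | Bot => pair 0 0
  | Eq t u => pair 1 (pair (code_term t) (code_term u))
  | @Rel _ _ r a => pair 2 (pair (cr r) (code_args a))
  | And p q => pair 3 (pair (code_form p) (code_form q))
  | Or p q => pair 4 (pair (code_form p) (code_form q))
  | Imp p q => pair 5 (pair (code_form p) (code_form q))
  | @All _ _ s p => pair 6 (pair (cs s) (code_form p))
  | @Ex _ _ s p => pair 7 (pair (cs s) (code_form p))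
  end.

(** The codes leave out the indices of the families, so injectivity is proved across
    indices; it holds because a code determines its index. *)
Lemma code_var_inj {G : list (sort L)} : forall s (x : var G s) s' (y : var G s'),
  code_var x = code_var y -> existT (var G) s x = existT _ s' y.
Proof.
  induction G as [|t G IH]; intros s x; [case_var x|].
  case_var x; intros s' y; case_var y; cbn; intro E; try discriminate; [reflexivity|].
  injection E as E. apply IH in E. now inversion E.
Qed.

Lemma code_term_args_inj {G} :
  (forall s (t : term L G s) s' (t' : term L G s'),
     code_term t = code_term t' -> existT (term L G) s t = existT _ s' t') /\
  (forall l (a : args L G l) l' (a' : args L G l'),
     code_args a = code_args a' -> existT (args L G) l a = existT _ l' a').
Proof.
  apply (term_args_mutind L G
    (fun s t => forall s' (t' : term L G s'),
     code_term t = code_term t' -> existT (term L G) s t = existT _ s' t')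
    (fun l a => forall l' (a' : args L G l'),
     code_args a = code_args a' -> existT (args L G) l a = existT _ l' a')).
  - intros s x s' [s'' y|f a] E; cbn in E; apply pair_inj in E as [E1 E2]; [|discriminate].
    apply code_var_inj in E2. now inversion E2.
  - intros f a IH s' [s'' y|f' a'] E; cbn in E; apply pair_inj in E as [E1 E2];
      [discriminate|].
    apply pair_inj in E2 as [E2 E3]. apply cf_inj in E2 as <-. apply IH in E3.
    apply inj_pair2 in E3. now rewrite E3.
  - intros l' [|s l t a] E; [reflexivity|discriminate].
  - intros s l t IHt a IHa l' [|s' l'' t' a'] E; [discriminate|].
    cbn in E. injection E as E. apply pair_inj in E as [E1 E2].
    apply IHt in E1. apply IHa in E2.
    inversion E1; subst. inversion E2; subst.
    apply inj_pair2 in E1. apply inj_pair2 in E2. now subst.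
Qed.

Lemma code_form_inj {G} (p : form L G) : forall q, code_form p = code_form q -> p = q.
Proof.
  induction p as [G|G s t u|G r a|G p IHp q IHq|G p IHp q IHq|G p IHp q IHq|G s p IH|G s p IH];
    intros [| s' t' u'|r' a'|p' q'|p' q'|p' q'|s' p'|s' p'] E; cbn [code_form] in E;
    apply pair_inj in E as [E1 E2]; try discriminate; clear E1;
    try apply pair_inj in E2 as [E2 E3].
  - reflexivity.
  - apply code_term_args_inj in E2. apply code_term_args_inj in E3.
    inversion E2; subst. apply inj_pair2 in E2. apply inj_pair2 in E3. now subst.
  - apply cr_inj in E2 as <-. apply code_term_args_inj in E3. apply inj_pair2 in E3.
    now subst.
  - apply IHp in E2. apply IHq in E3. now subst.
  - apply IHp in E2. apply IHq in E3. now subst.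
  - apply IHp in E2. apply IHq in E3. now subst.
  - apply cs_inj in E2 as <-. apply IH in E3. now subst.
  - apply cs_inj in E2 as <-. apply IH in E3. now subst.
Qed.

End Coding.

Lemma countable_form {L : signature} (HL : countable_sig L) G : countable (form L G).
Proof.
  destruct HL as [[cs Hs] [cf Hf] [cr Hr]]. exists (code_form cs cf cr).
  now apply code_form_inj.
Qed.

Lemma countable_enum {X : Type} (x0 : X) : countable X ->
  exists f : nat -> X, forall x, exists n, f n = x.
Proof.
  intros [c Hc]. exists (fun n => epsilon (inhabits x0) (fun x => c x = n)).
  intro x. exists (c x). apply Hc. apply (epsilon_spec _ (fun y => c y = c x)). now exists x.
Qed.

Lemma countable_task {L : signature} (HL : countable_sig L) G : countable (task (L := L) G).
Proof.
  destruct HL as [[cs Hs] [cf Hf] [cr Hr]].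
  exists (fun t => to_nat (cs (projT1 t), code_form cs cf cr (projT2 t))).
  intros [s p] [s' p'] E. cbn [projT1 projT2] in E. apply to_nat_inj in E. inversion E as [[E1 E2]].
  apply Hs in E1 as <-. apply (code_form_inj cs Hs cf Hf cr Hr) in E2. now subst.
Qed.

(** If [p] is not provable then [Not p] is consistent, and the limit of the Henkin
    construction is a countermodel.  Countability allows all tasks to be listed; [s0]
    is needed for a context extension to exist at all. *)
Theorem completeness {L : signature} (HL : countable_sig L) (s0 : sort L)
    (T : theory L) (p : sentence L) :
  (forall M, models M T -> sat M p nov) -> proves T p.
Proof.
  intro HM. unfold proves. apply NNPP. intro Np.
  pose (enum := fun G => proj1_sig (constructive_indefinite_description _
    (countable_enum (existT _ s0 Bot) (countable_task HL G)))).
  assert (enum_surj : forall G t, exists j, enum G j = t).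
  { intro G. unfold enum. now destruct constructive_indefinite_description. }
  destruct (model_existence T s0 enum enum_surj [Not p]) as (M & HT & Hp).
  - intro C. now apply Np, prv_raa.
  - apply (Hp (Not p)); [now left|]. now apply HM.
Qed.

(** * Interpretations and models *)

Section Interpretation.
Context {S T : signature} (I : translation S T) (M : structure T).

(** The elements of the internal structure are those of [M] that satisfy the domain
    formulas. *)
Definition idom (s : sort S) : Type :=
  {v : dom M (tsort I s) | sat M (tdom I s) (cons_v v nov)}.

Definition ival {s} (v : idom s) : dom M (tsort I s) := proj1_sig v.

(** Tuples over [l] and tuples over [map (tsort I) l] are different types; [raw] and
    [var_map] pass from the first to the second. *)
Fixpoint raw (l : list (sort S)) : valu idom l -> valu (dom M) (map (tsort I) l) :=
  match l return valu idom l -> valu (dom M) (map (tsort I) l) with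
  | [] => fun _ => nov
  | s :: l' => fun a => cons_v (ival (a s vz)) (raw l' (tl_v a))
  end.

Fixpoint var_map (l : list (sort S)) : env I l (map (tsort I) l) :=
  match l return env I l (map (tsort I) l) with
  | [] => vnil
  | s :: l' => env_up I (var_map l')
  end.

Lemma ival_inj {s} (v w : idom s) : ival v = ival w -> v = w.
Proof. destruct v, w. apply subset_eq_compat. Qed.

Lemma raw_var_map l (a : valu idom l) : forall s x,
  raw l a _ (var_map l s x) = ival (a s x).
Proof.
  induction l as [|t l IH]; intros s x; case_var x; [reflexivity|].
  apply (IH (tl_v a)).
Qed.

Lemma sat_in_dom {G} s (x : var G (tsort I s)) e :
  sat M (in_dom I s x) e = sat M (tdom I s) (cons_v (e _ x) nov).
Proof.
  unfold in_dom. rewrite sat_ren. f_equal. funext2 r y. case_var y; [reflexivity|].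
  case_var y.
Qed.

Lemma sat_AllD {G} s (p : form T (tsort I s :: G)) e :
  sat M (AllD I s p) e <-> forall v : idom s, sat M p (cons_v (ival v) e).
Proof.
  cbn. split.
  - intros H [v Hv]. apply H. rewrite sat_in_dom. exact Hv.
  - intros H v Hv. rewrite sat_in_dom in Hv. exact (H (exist _ v Hv)).
Qed.

Lemma sat_ExD {G} s (p : form T (tsort I s :: G)) e :
  sat M (ExD I s p) e <-> exists v : idom s, sat M p (cons_v (ival v) e).
Proof.
  cbn. split.
  - intros (v & Hv & H). rewrite sat_in_dom in Hv. now exists (exist _ v Hv).
  - intros [[v Hv] H]. exists v. rewrite sat_in_dom. now split.
Qed.

Lemma sat_AllDs l : forall {G} (p : form T (map (tsort I) l ++ G)) e,
  sat M (AllDs I l p) e <-> forall a : valu idom l, sat M p (app_v _ (raw l a) e).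
Proof.
  induction l as [|s l IH]; intros G p e; cbn [AllDs].
  - split; [intros H a; exact H|]. intro H. apply (H nov).
  - rewrite IH. split.
    + intros H a. specialize (H (tl_v a)). rewrite sat_AllD in H. apply (H (a s vz)).
    + intros H a. rewrite sat_AllD. intro v. apply (H (cons_v v a)).
Qed.

Lemma sat_ExDs l : forall {G} (p : form T (map (tsort I) l ++ G)) e,
  sat M (ExDs I l p) e <-> exists a : valu idom l, sat M p (app_v _ (raw l a) e).
Proof.
  induction l as [|s l IH]; intros G p e; cbn [ExDs].
  - split; [intro H; now exists nov|]. intros [a H]. exact H.
  - rewrite IH. split.
    + intros [a H]. rewrite sat_ExD in H. destruct H as [v H]. now exists (cons_v v a).
    + intros [a H]. exists (tl_v a). rewrite sat_ExD. now exists (a s vz).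
Qed.

Lemma sat_fun_total f : sat M (fun_total I f) nov <->
  forall a : valu idom (fdom f), exists v : idom (fcod f),
    sat M (tfun I f) (cons_v (ival v) (raw _ a)) /\
    forall w : idom (fcod f), sat M (tfun I f) (cons_v (ival w) (raw _ a)) -> w = v.
Proof.
  unfold fun_total. rewrite sat_AllDs.
  assert (E1 : forall a v, sat M (ren_form (ren_up (vleft (map (tsort I) (fdom f))
      (G := []))) (tfun I f)) (cons_v v (app_v _ (raw _ a) nov)) =
    sat M (tfun I f) (cons_v v (raw _ a))).
  { intros a v. rewrite sat_ren, cons_v_ren_up, app_v_left. reflexivity. }
  assert (E2 : forall a v w, sat M (ren_form (vcons (P := var (tsort I (fcod f) ::
      tsort I (fcod f) :: map (tsort I) (fdom f) ++ []))
      vz (fun r x => vs (vs (vleft _ r x)))) (tfun I f))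
      (cons_v v (cons_v w (app_v _ (raw _ a) nov))) =
    sat M (tfun I f) (cons_v v (raw _ a))).
  { intros a v w. rewrite sat_ren. f_equal. funext2 s x. case_var x; [reflexivity|].
    cbn. now rewrite app_v_vleft. }
  split; intros H a; specialize (H a).
  - rewrite sat_ExD in H. destruct H as [v [H1 H2]]. exists v. rewrite E1 in H1.
    split; [exact H1|]. intros w Hw.
    change (sat M (AllD I (fcod f) (ren_form (vcons (P := var (tsort I (fcod f) ::
      tsort I (fcod f) :: map (tsort I) (fdom f) ++ []))
      vz (fun r x => vs (vs (vleft _ r x)))) (tfun I f) --> #0 == #1)%form)
      (cons_v (ival v) (app_v _ (raw _ a) nov))) in H2.
    rewrite sat_AllD in H2. apply ival_inj, (H2 w). rewrite E2. exact Hw.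
  - rewrite sat_ExD. destruct H as (v & H1 & H2). exists v. split; [now rewrite E1|].
    change (sat M (AllD I (fcod f) (ren_form (vcons (P := var (tsort I (fcod f) ::
      tsort I (fcod f) :: map (tsort I) (fdom f) ++ []))
      vz (fun r x => vs (vs (vleft _ r x)))) (tfun I f) --> #0 == #1)%form)
      (cons_v (ival v) (app_v _ (raw _ a) nov))).
    rewrite sat_AllD. intros w Hw. cbn. f_equal. apply H2. now rewrite E2 in Hw.
Qed.

Context (Hdom : forall s, sat M (dom_nonempty I s) nov).
Context (Hfun : forall f, sat M (fun_total I f) nov).

(** Functions are chosen by unique existence. *)
Definition internal : structure S.
Proof.
  refine (Structure S idom _
    (fun f a => proj1_sig (constructive_indefinite_description _
       (proj1 (sat_fun_total f) (Hfun f) a)))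
    (fun r a => sat M (trel I r) (raw _ a))).
  intro s. destruct (Hdom s) as [v Hv]. exact (inhabits (exist _ v Hv)).
Defined.

Lemma internal_fun f (a : valu idom (fdom f)) (w : idom (fcod f)) :
  sat M (tfun I f) (cons_v (ival w) (raw _ a)) <-> w = fint internal f a.
Proof.
  cbn. destruct constructive_indefinite_description as (v & H1 & H2). cbn.
  split; [apply H2|]. now intros ->.
Qed.

Definition agree {G H} (rho : env I G H) (e : valu (dom M) H) (e' : valu idom G) : Prop :=
  forall s x, e _ (rho s x) = ival (e' s x).

(** The value variable has to be assumed in the domain: uniqueness of values is only
    guaranteed there. *)
Lemma sat_tr_term_args {G} :
  (forall s (t : term S G s) H (rho : env I G H) y e e' (w : idom s),
     agree rho e e' -> e _ y = ival w ->
     sat M (tr_term I t rho y) e <-> w = eval internal t e') /\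
  (forall l (a : args S G l) H (rho : env I G H) (ys : ren (map (tsort I) l) H) e e' (w : valu idom l),
     agree rho e e' -> (forall s x, e _ (ys _ (var_map l s x)) = ival (w s x)) ->
     sat M (tr_args I a rho ys) e <-> w = eval_args internal a e').
Proof.
  apply (term_args_mutind S G
    (fun s t => forall H (rho : env I G H) y e e' (w : idom s),
     agree rho e e' -> e _ y = ival w ->
     sat M (tr_term I t rho y) e <-> w = eval internal t e')
    (fun l a => forall H (rho : env I G H) (ys : ren (map (tsort I) l) H) e e' (w : valu idom l),
     agree rho e e' -> (forall s x, e _ (ys _ (var_map l s x)) = ival (w s x)) ->
     sat M (tr_args I a rho ys) e <-> w = eval_args internal a e')).
  - intros s x H rho y e e' w Hag Hw. cbn. rewrite Hw, Hag. split; [apply ival_inj|].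
    now intros ->.
  - intros f a IH H rho y e e' w Hag Hw. cbn [tr_term eval]. rewrite sat_ExDs.
    rewrite <- internal_fun.
    assert (E : forall b : valu idom (fdom f),
      (sat M (tr_args I a (fun r x => vright (map (tsort I) (fdom f)) _ (rho r x))
        (vleft (map (tsort I) (fdom f)))) (app_v _ (raw _ b) e) <->
        b = eval_args internal a e') /\
      sat M (ren_form (vcons (P := var (map (tsort I) (fdom f) ++ H))
         (vright _ _ y) (vleft _)) (tfun I f)) (app_v _ (raw _ b) e) =
      sat M (tfun I f) (cons_v (ival w) (raw _ b))).
    { intro b. split.
      - apply IH.
        + intros s x. rewrite app_v_vright. apply Hag.
        + intros s x. rewrite app_v_vleft. apply raw_var_map.
      - rewrite sat_ren. f_equal. funext2 s x. case_var x; cbn.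
        + now rewrite app_v_vright.
        + now rewrite app_v_vleft. }
    split.
    + intros [b [H1 H2]]. apply E in H1 as ->. now rewrite (proj2 (E _)) in H2.
    + intro H2. exists (eval_args internal a e'). split; [now apply E|].
      now rewrite (proj2 (E _)).
  - intros H rho ys e e' w Hag Hw. cbn. split; [intros _; symmetry; apply nov_eta|auto].
  - intros s l t IHt a IHa H rho ys e e' w Hag Hw. cbn [tr_args eval_args sat].
    rewrite (IHt _ _ _ e e' (w s vz)) by (auto; apply (Hw s vz)).
    rewrite (IHa _ _ _ e e' (tl_v w)) by (auto; intros r x; apply (Hw r (vs x))).
    split.
    + intros [E1 E2]. exact (eq_trans (eq_sym (cons_v_eta w)) (f_equal2 cons_v E1 E2)).
    + intros ->. now split.
Qed.

(** The translation of a formula holds in [M] when the formula holds in the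
    structure that the interpretation carves out of [M]. *)
Lemma sat_tr_form {G} (p : form S G) : forall H (rho : env I G H) e e',
  agree rho e e' -> sat M (tr_form I p rho) e <-> sat internal p e'.
Proof.
  assert (U : forall G H s (rho : env I G H) e e' (v : idom s), agree rho e e' ->
    agree (env_up I rho) (cons_v (ival v) e) (cons_v v e')).
  { intros G' H s rho e e' v Hag r x. case_var x; [reflexivity|]. apply Hag. }
  induction p as [G|G s t u|G r a|G p IHp q IHq|G p IHp q IHq|G p IHp q IHq|G s p IH|G s p IH];
    intros H rho e e' Hag; cbn [tr_form].
  - reflexivity.
  - rewrite sat_ExD. cbn [sat].
    assert (E : forall w : idom s, sat M (tr_term I t (fun r x => vs (rho r x)) vz)
        (cons_v (ival w) e) <-> w = eval internal t e').
    { intro w. now apply sat_tr_term_args. }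
    assert (F : forall w : idom s, sat M (tr_term I u (fun r x => vs (rho r x)) vz)
        (cons_v (ival w) e) <-> w = eval internal u e').
    { intro w. now apply sat_tr_term_args. }
    split.
    + intros [w [H1 H2]]. apply E in H1. apply F in H2. congruence.
    + intro H1. exists (eval internal t e'). split; [now apply E|]. now apply F.
  - rewrite sat_ExDs. cbn [sat].
    assert (E : forall b : valu idom (rdom r),
      sat M (tr_args I a (fun r x => vright _ _ (rho r x))
        (vleft (map (tsort I) (rdom r)))) (app_v _ (raw _ b) e) <->
        b = eval_args internal a e').
    { intro b. apply sat_tr_term_args.
      - intros s x. rewrite app_v_vright. apply Hag.
      - intros s x. rewrite app_v_vleft. apply raw_var_map. }
    split.
    + intros [b [H1 H2]]. apply E in H1 as <-. rewrite sat_ren, app_v_left in H2. exact H2.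
    + intro H2. exists (eval_args internal a e'). split; [now apply E|].
      rewrite sat_ren, app_v_left. exact H2.
  - cbn [sat]. now rewrite (IHp _ _ _ _ Hag), (IHq _ _ _ _ Hag).
  - cbn [sat]. now rewrite (IHp _ _ _ _ Hag), (IHq _ _ _ _ Hag).
  - cbn [sat]. now rewrite (IHp _ _ _ _ Hag), (IHq _ _ _ _ Hag).
  - rewrite sat_AllD. cbn [sat]. split; intros Hp v; apply (IH _ _ _ _ (U _ _ _ _ _ _ v Hag)), Hp.
  - rewrite sat_ExD. cbn [sat].
    split; intros [v Hv]; exists v; revert Hv; apply (IH _ _ _ _ (U _ _ _ _ _ _ v Hag)).
Qed.

End Interpretation.

(** Soundness in the internal structure turns theorems of the source into formulas whose
    translations hold in all models of the target theory; completeness makes these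
    translations theorems. *)
Lemma interprets_by_models {S T : signature} (HT : countable_sig T) (s0 : sort T)
    (TT : theory T) (UU : theory S) (I : translation S T) :
  (forall M, models M TT ->
     exists (Hdom : forall s, sat M (dom_nonempty I s) nov)
            (Hfun : forall f, sat M (fun_total I f) nov),
       models (internal I M Hdom Hfun) UU) ->
  interprets TT UU.
Proof.
  intro HM. exists I. split; [|split].
  - intro s. apply (completeness HT s0). intros M HMT. now destruct (HM M HMT).
  - intro f. apply (completeness HT s0). intros M HMT. now destruct (HM M HMT) as (?&?&?).
  - intros p Hp. apply (completeness HT s0). intros M HMT.
    destruct (HM M HMT) as (Hdom & Hfun & HU). unfold tr_sentence.
    rewrite (sat_tr_form I M Hdom Hfun p _ _ _ nov) by (intros s x; case_var x).
    apply (soundness _ UU HU [] [] p Hp). intros q [].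
Qed.

(** * Fregean structures *)

Lemma countable_fsort : countable fsort.
Proof.
  exists (fun s => match s with Obj => 0 | Con k => S k end).
  intros [|k] [|k'] E; congruence.
Qed.

Lemma countable_freg {A : Set} (ar : A -> nat) : countable A -> countable_sig (freg ar).
Proof.
  intros [c Hc]. split; [exact countable_fsort| |now exists (fun n => n)].
  exists (fun f => match f with
    | Proj m n => to_nat (0, to_nat (m, n)) | Abs e => to_nat (1, c e) end).
  intros [m n|e] [m' n'|e'] E; apply pair_inj in E as [E1 E]; try discriminate.
  - apply pair_inj in E as [-> ->]. reflexivity.
  - now apply Hc in E as ->.
Qed.

Lemma countable_L0 : countable_sig L0.
Proof. apply countable_freg. exists (fun e : Empty_set => match e with end). intros []. Qed.

(** The proof carried by an element is irrelevant, so the formula determines it. *)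
Lemma countable_ProvEquiv : countable ProvEquiv.
Proof.
  pose (c := fun k => constructive_indefinite_description _
    (countable_form countable_L0 [Con k; Con k])).
  exists (fun E => to_nat (pe_ar E, proj1_sig (c (pe_ar E)) (pe_form E))).
  intros [k p Hp] [k' p' Hp'] E. cbn [pe_ar pe_form] in E.
  apply pair_inj in E as [<- E]. apply (proj2_sig (c k)) in E as <-.
  now rewrite (proof_irrelevance _ Hp Hp').
Qed.

Lemma countable_L1 : countable_sig L1.
Proof. apply countable_freg, countable_ProvEquiv. Qed.

Section Tuples.
Context {D : fsort -> Type}.

Fixpoint oapp {m n : nat} :
    valu D (objs m) -> valu D (objs n) -> valu D (objs (m + n)) :=
  match m return valu D (objs m) -> valu D (objs n) -> valu D (objs (m + n)) with
  | 0 => fun _ b => b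
  | S m' => fun a b => cons_v (a Obj vz) (oapp (tl_v a) b)
  end.

End Tuples.

(** The first [m] and the last [n] coordinates of a tuple of length [m + n]. *)
Fixpoint pre (m n : nat) : ren (objs m) (objs (m + n)) :=
  match m return ren (objs m) (objs (m + n)) with
  | 0 => vnil
  | S m' => ren_up (pre m' n)
  end.

Fixpoint suf (m n : nat) : ren (objs n) (objs (m + n)) :=
  match m return ren (objs n) (objs (m + n)) with
  | 0 => fun s x => x
  | S m' => fun s x => vs (suf m' n s x)
  end.

Lemma oapp_pre {D : fsort -> Type} m n (a : valu D (objs m)) (b : valu D (objs n)) :
  (fun s x => oapp a b s (pre m n s x)) = a.
Proof.
  induction m as [|m IH]; [funext2 s x; cbn in x; case_var x|].
  cbn. rewrite cons_v_ren_up, IH. apply cons_v_eta.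
Qed.

Lemma oapp_suf {D : fsort -> Type} m n (a : valu D (objs m)) (b : valu D (objs n)) :
  (fun s x => oapp a b s (suf m n s x)) = b.
Proof. induction m as [|m IH]; [reflexivity|]. apply (IH (tl_v a)). Qed.

Section FregeanModels.
Context {A : Set} {ar : A -> nat} (M : structure (freg ar)).
Notation L := (freg ar).
Notation D := (dom (L := L) M).

Definition ap {k} (R : D (Con k)) (a : valu D (objs (S k))) : Prop :=
  rint (L := L) M k (cons_v R a).

(** The projection of [R] at [a]. *)
Definition section {k m} (R : D (Con (m + S k))) (a : valu D (objs (S m))) : D (Con k) :=
  fint (L := L) M (Proj m k) (cons_v R a).

Lemma sat_pred {G k} (R : term L G (Con k)) a e :
  sat M (pred R a) e = ap (eval M R e) (eval_args M a e).
Proof. reflexivity. Qed.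

Lemma eval_obj_app {G m n} (a : args L G (objs m)) (b : args L G (objs n)) e :
  eval_args M (obj_app a b) e = oapp (eval_args M a e) (eval_args M b e).
Proof.
  revert a. induction m as [|m IH]; intro a; [reflexivity|].
  cbn [obj_app eval_args oapp]. rewrite IH. clear IH. cbn [objs repeat] in a.
  change (objs (S m)) with (Obj :: objs m) in *.
  assert (E : a = acons (args_hd a) (args_tl a)).
  { refine (match a as a' in args _ _ l' return
      match l' return args L G l' -> Prop with
      | [] => fun _ => True
      | s :: l => fun a => a = acons (args_hd a) (args_tl a) end a'
      with anil => Logic.I | acons _ _ => eq_refl end). }
  rewrite E. cbn. f_equal.
Qed.

Context (HM : models M OS).

Lemma model_ext {k} (R S : D (Con k)) : (forall a, ap R a <-> ap S a) -> R = S.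
Proof.
  intro H. pose proof (HM _ (OS_ext k)) as HE. unfold extensionality in HE.
  rewrite sat_close in HE. specialize (HE (cons_v R (cons_v S nov))).
  rewrite sat_Iff in HE. apply (proj2 HE). rewrite sat_foralls. intro a. rewrite sat_Iff, !sat_pred.
  rewrite !eval_block. cbn [eval]. rewrite !app_v_vright. apply H.
Qed.

Lemma model_proj {m n} (R : D (Con (m + S n))) a b :
  ap (section R a) b <-> ap R (oapp a b).
Proof.
  pose proof (HM _ (OS_proj m n)) as HP. unfold projection in HP.
  rewrite sat_close in HP. specialize (HP (cons_v R nov)).
  rewrite sat_foralls in HP. specialize (HP a).
  rewrite sat_foralls in HP. specialize (HP b).
  cbv zeta in HP. rewrite sat_Iff, !sat_pred in HP.
  unfold proj in HP. cbn [eval eval_args] in HP.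
  rewrite !app_v_vright in HP.
  set (e := app_v (objs (S n)) b (app_v (objs (S m)) a (cons_v R nov))) in HP.
  assert (Ea : eval_args M (ren_args (L := L) (vright (objs (S n)))
    (block (L := L) (objs (S m)))) e = a).
  { rewrite eval_args_ren. unfold e. rewrite app_v_right. apply (eval_block (L := L) M). }
  assert (Eb : eval_args M (block (L := L) (objs (S n))) e = b)
    by apply (eval_block (L := L) M).
  refine (iff_trans _ (iff_trans HP _)); match goal with |- ?P <-> ?Q =>
    enough (P = Q) as -> by reflexivity end.
  - exact (f_equal2 (fun x y => ap (section R x) y) (eq_sym Ea) (eq_sym Eb)).
  - refine (f_equal (ap R) (eq_trans (eval_obj_app (m := S m) (n := S n) _ _ _) _)).
    exact (f_equal2 oapp Ea Eb).
Qed.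

Lemma model_compr {G k} (p : form L (objs (S k) ++ G)) (e : valu D G) : first_order p ->
  exists R : D (Con k), forall a, ap R a <-> sat M p (app_v _ a e).
Proof.
  intro Hp. pose proof (HM _ (OS_compr G k p Hp)) as HC. unfold comprehension in HC.
  rewrite sat_close in HC. specialize (HC e). cbn [sat] in HC. destruct HC as [R HR]. exists R. intro a.
  rewrite sat_foralls in HR. specialize (HR a).
  rewrite sat_Iff, sat_pred, eval_block, sat_ren in HR. cbn [eval] in HR.
  rewrite app_v_vright, app_v_ren_ups in HR. exact HR.
Qed.

End FregeanModels.

From Corelib Require Import ssreflect.
Local Open Scope type_scope.

Lemma ex_iff {X : Type} (P Q : X -> Prop) :
  (forall x, P x <-> Q x) -> (exists x, P x) <-> (exists x, Q x).
Proof. firstorder. Qed.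

Lemma all_iff {X : Type} (P Q : X -> Prop) :
  (forall x, P x <-> Q x) -> (forall x, P x) <-> (forall x, Q x).
Proof. firstorder. Qed.

Lemma and_iff (P P' Q Q' : Prop) : (P <-> P') -> (Q <-> Q') -> P /\ Q <-> P' /\ Q'.
Proof. tauto. Qed.

(** * The reduct to the concept language *)

Section Reduct.
Context {A : Set} {ar : A -> nat} (M : structure (freg ar)).

Definition reduct : structure (freg no_abs) :=
  Structure (freg no_abs) (dom (L := freg ar) M) (dom_inh (L := freg ar) M)
    (fun f => match f return valu (dom (L := freg ar) M) (fdom (s := L0) f) ->
                dom (L := freg ar) M (fcod (s := L0) f) with
              | Proj m n => fint (L := freg ar) M (Proj m n)
              | Abs e => match e with end
              end)
    (fun k => rint (L := freg ar) M k).

Lemma eval_emb {G : list fsort} :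
  (forall s (t : term L0 G s) e, eval M (emb_term (ar := ar) t) e = eval reduct t e) /\
  (forall l (a : args L0 G l) e, eval_args M (emb_args (ar := ar) a) e = eval_args reduct a e).
Proof.
  apply (term_args_mutind L0 G
    (fun s t => forall e, eval M (emb_term (ar := ar) t) e = eval reduct t e)
    (fun l a => forall e, eval_args M (emb_args (ar := ar) a) e = eval_args reduct a e)).
  - reflexivity.
  - intros [m n|[]] a IH e. exact (f_equal (fint (L := freg ar) M (Proj m n)) (IH e)).
  - reflexivity.
  - intros s l t IHt a IHa e. exact (f_equal2 cons_v (IHt e) (IHa e)).
Qed.

Lemma sat_emb {G : list fsort} (p : form L0 G) : forall e,
  sat M (emb (ar := ar) p) e = sat reduct p e.
Proof.
  induction p as [G|G s t u|G r a|G p IHp q IHq|G p IHp q IHq|G p IHp q IHq|G s p IH|G s p IH];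
    intro e; cbn [emb sat].
  - reflexivity.
  - exact (f_equal2 eq (proj1 eval_emb _ t e) (proj1 eval_emb _ u e)).
  - exact (f_equal (rint (L := freg ar) M r) (proj2 eval_emb _ a e)).
  - now rewrite IHp IHq.
  - now rewrite IHp IHq.
  - now rewrite IHp IHq.
  - apply forall_eq. intro v. apply IH.
  - apply exists_eq. intro v. apply IH.
Qed.

End Reduct.

(** * Coding two concepts by one *)

Section Formulas.
Context {A : Set} {ar : A -> nat}.
Notation L := (freg ar).

(** The tag of a code is the equality pattern of two coordinates: this needs no
    constants, only two distinct objects, and unlike a cartesian product it loses
    nothing when one of the two coded concepts is empty. *)
Definition if_eq {G : list fsort} (x y : var G Obj) (p q : form L G) : form L G :=
  ((Var (L := L) x == Var (L := L) y /\ p) \/ (~ (Var (L := L) x == Var (L := L) y) /\ q))%form.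

Definition pairing {k j : nat} : form L (objs (S (S (S k + S j))) ++ [Con k; Con j]) :=
  let l := objs (S (S (S k + S j))) in
  if_eq (G := l ++ [Con k; Con j]) vz (vs vz)
    (pred (Var (L := L) (vright l _ vz))
       (var_args (L := L) (fun s x => vleft l s (vs (vs (pre (S k) (S j) s x))))))
    (pred (Var (L := L) (vright l _ (vs vz)))
       (var_args (L := L) (fun s x => vleft l s (vs (vs (suf (S k) (S j) s x)))))).

(** Quantifying over the coded pair is sound because a code determines it; no explicit
    decoding formulas are needed. *)
Definition decoded {k j : nat} {H : list fsort} (p : form L (Con k :: Con j :: H)) :
    form L (Con (S (S (k + S j))) :: H) :=
  let J := S (S (k + S j)) in
  let K := Con k :: Con j :: Con J :: H in
  Ex (L := L) (s := Con j) (Ex (L := L) (s := Con k) (And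
    (foralls (L := L) (objs (S J)) (G := K)
      (Iff (pred (Var (L := L) (vright (objs (S J)) _ (vs (vs vz)))) (block (L := L) (objs (S J))))
           (ren_form (L := L) (ren_ups (objs (S J))
              (vcons (P := var K) vz (vcons (P := var K) (vs vz) vnil))) pairing)))
    (ren_form (L := L) (vcons (P := var K) vz (vcons (P := var K) (vs vz)
       (fun s x => vs (vs (vs x))))) p))).

Fixpoint eqs {l G : list fsort} : ren l G -> ren l G -> form L G :=
  match l return ren l G -> ren l G -> form L G with
  | [] => fun _ _ => Not Bot
  | s :: l' => fun xs ys => And (Eq (L := L) (Var (L := L) (xs s vz)) (Var (L := L) (ys s vz)))
      (eqs (fun r x => xs r (vs x)) (fun r x => ys r (vs x)))
  end.

Lemma first_order_eqs {l G : list fsort} (xs ys : ren l G) : first_order (eqs xs ys).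
Proof. induction l; cbn; auto. Qed.

Lemma sat_eqs (M : structure L) {l G : list fsort} (xs ys : ren l G) (e : valu (dom (L := L) M) G) :
  sat M (eqs xs ys) e <-> (fun s x => e s (xs s x)) = (fun s x => e s (ys s x)).
Proof.
  induction l as [|t l IH]; cbn [eqs sat].
  - split; [|intros _ []]. intros _. funext2 s x. case_var x.
  - rewrite IH. cbn. split.
    + intros [E1 E2]. funext2 s x. case_var x; [exact E1|].
      exact (f_equal (fun f => f s x) E2).
    + intro E. split; [exact (f_equal (fun f => f t vz) E)|].
      funext2 s x. exact (f_equal (fun f => f s (vs x)) E).
Qed.

End Formulas.

(** The first component is a predicate rather than a concept, so that it also covers
    the singleton of a tuple. *)
Definition codes {A : Set} {ar : A -> nat} {M : structure (freg ar)} {k j : nat}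
    (R : dom (L := freg ar) M (Con (S (S (k + S j)))))
    (P : valu (dom (L := freg ar) M) (objs (S k)) -> Prop)
    (Q : dom (L := freg ar) M (Con j)) : Prop :=
  forall b : valu (dom (L := freg ar) M) (objs (S (S (S k + S j)))), ap M R b <->
    (b Obj vz = b Obj (vs vz) /\ P (fun s x => b s (vs (vs (pre (S k) (S j) s x))))) \/
    (b Obj vz <> b Obj (vs vz) /\ ap M Q (fun s x => b s (vs (vs (suf (S k) (S j) s x))))).

Lemma sat_pairing {A : Set} {ar : A -> nat} (M : structure (freg ar)) {k j} P Q
  (b : valu (dom (L := freg ar) M) (objs (S (S (S k + S j))))) :
  sat M (pairing (k := k) (j := j)) (app_v _ b (cons_v P (cons_v Q nov))) <->
    (b Obj vz = b Obj (vs vz) /\ ap M P (fun s x => b s (vs (vs (pre (S k) (S j) s x))))) \/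
    (b Obj vz <> b Obj (vs vz) /\ ap M Q (fun s x => b s (vs (vs (suf (S k) (S j) s x))))).
Proof.
  unfold pairing, if_eq. cbn [sat]. rewrite !sat_pred !eval_var_args. cbn [eval].
  rewrite !app_v_vright.
  replace (fun s x => app_v _ b _ s (vleft _ s (vs (vs (pre (S k) (S j) s x)))))
    with (fun s x => b s (vs (vs (pre (S k) (S j) s x))))
    by (funext2 s x; symmetry; apply app_v_vleft).
  replace (fun s x => app_v _ b _ s (vleft _ s (vs (vs (suf (S k) (S j) s x)))))
    with (fun s x => b s (vs (vs (suf (S k) (S j) s x))))
    by (funext2 s x; symmetry; apply app_v_vleft).
  reflexivity.
Qed.

Lemma sat_decoded {A : Set} {ar : A -> nat} (M : structure (freg ar)) {k j H}
    (p : form (freg ar) (Con k :: Con j :: H)) R h :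
  sat M (decoded p) (cons_v R h) <->
  exists Q P, codes R (ap M P) Q /\ sat M p (cons_v P (cons_v Q h)).
Proof.
  unfold decoded. cbn [sat]. apply ex_iff. intro Q. apply ex_iff. intro P.
  rewrite sat_foralls. apply and_iff.
  - unfold codes. apply all_iff. intro b.
    rewrite sat_Iff sat_pred eval_block sat_ren. cbn [eval].
    rewrite app_v_vright app_v_ren_ups -sat_pairing. cbn.
    replace (fun s x => _) with (cons_v P (cons_v Q nov)); [reflexivity|].
    funext2 s x. case_var x; [reflexivity|]. case_var x; [reflexivity|]. case_var x.
  - rewrite sat_ren. replace (fun r x => _) with (cons_v P (cons_v Q h)); [reflexivity|].
    funext2 s x. case_var x; [reflexivity|]. case_var x; reflexivity.
Qed.

(** * Impredicative comprehension in models of the Fregean theory *)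

Lemma oapp_pre_at {D : fsort -> Type} m n (a : valu D (objs m)) (b : valu D (objs n)) s x :
  oapp a b s (pre m n s x) = a s x.
Proof. exact (f_equal (fun f => f s x) (oapp_pre m n a b)). Qed.

Lemma oapp_suf_at {D : fsort -> Type} m n (a : valu D (objs m)) (b : valu D (objs n)) s x :
  oapp a b s (suf m n s x) = b s x.
Proof. exact (f_equal (fun f => f s x) (oapp_suf m n a b)). Qed.

Fixpoint filler {D : fsort -> Type} (d : D Obj) (n : nat) : valu D (objs n) :=
  match n return valu D (objs n) with 0 => nov | S n' => cons_v d (filler d n') end.

Definition same_value {J : nat} (p : form L0 [Con J]) : form L0 [Con J; Con J] :=
  Iff (ren_form (L := L0) (H := [Con J; Con J]) (vcons (P := var [Con J; Con J]) vz vnil) p)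
      (ren_form (L := L0) (H := [Con J; Con J]) (vcons (P := var [Con J; Con J]) (vs vz) vnil) p).

Lemma sat_same_value {J} (p : form L0 [Con J]) (M : structure L0) R S :
  sat M (same_value p) (cons_v R (cons_v S nov)) <->
  (sat M p (cons_v R nov) <-> sat M p (cons_v S nov)).
Proof.
  unfold same_value. rewrite sat_Iff !sat_ren.
  assert (E : forall e : valu (dom M) [Con J], (fun r x => e r x) = cons_v (e _ vz) nov).
  { intro e. funext2 r x. case_var x; [reflexivity|]. case_var x. }
  rewrite (E (fun r x => cons_v R _ r _)) (E (fun r x => cons_v R (cons_v S nov) r (vcons (P := var [Con J; Con J]) (vs vz) vnil r x))).
  reflexivity.
Qed.

Lemma sat_app2 {A : Set} {ar : A -> nat} (M : structure (freg ar)) {G k}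
    (E : form (freg ar) [Con k; Con k]) (R S : term (freg ar) G (Con k)) e :
  sat M (app2 E R S) e = sat M E (cons_v (eval M R e) (cons_v (eval M S e) nov)).
Proof.
  unfold app2. rewrite sat_sub. f_equal. funext2 r x. case_var x; [reflexivity|].
  case_var x; [reflexivity|]. case_var x.
Qed.

Lemma equiv_same_value {J} (p : form L0 [Con J]) : proves SOS (Equiv (same_value p)).
Proof.
  apply (completeness countable_L0 Obj). intros M _. unfold Equiv.
  rewrite sat_close. intro e. cbn [sat].
  rewrite !sat_app2. rewrite !sat_same_value. tauto.
Qed.

(** The relation [same_value p] is an equivalence relation in every structure, by
    propositional logic alone; its abstraction operator maps a concept to the truth
    value of [p]. *)
Definition truth_value {J} (p : form L0 [Con J]) : ProvEquiv :=
  {| pe_ar := J; pe_form := same_value p; pe_prf := equiv_same_value p |}.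

Lemma equiv_Eq : proves SOS (Equiv (k := 0) (Eq (L := L0) #0 #1)).
Proof.
  apply (completeness countable_L0 Obj). intros M _. unfold Equiv.
  rewrite sat_close. intro e. cbn [sat]. rewrite !sat_app2. cbn [sat eval].
  repeat split; cbn; intuition congruence.
Qed.

(** The extension operator of Basic Law V, for unary concepts. *)
Definition extension : ProvEquiv :=
  {| pe_ar := 0; pe_form := Eq (L := L0) #0 #1; pe_prf := equiv_Eq |}.

(** Reduces the equivalence of one formula under two assignments to the equality of the
    assignments. *)
Ltac sat_same :=
  match goal with |- sat ?M ?p ?a <-> sat ?M ?p ?b =>
    let E := fresh in
    assert (E : a = b); [|exact (eq_ind a (fun c => sat M p a <-> sat M p c) (iff_refl _) b E)]
  end.

Section Models.
Context (M : structure L1) (HM : models M PFT).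
Notation D := (dom (L := L1) M).
Notation LC := (freg no_abs).
Notation M0 := (reduct (ar := pe_ar) M).
Notation ap := (ap (ar := pe_ar) M).

Lemma model_OS : models (L := freg pe_ar) M OS.
Proof. intros p Hp. apply HM. now constructor. Qed.

Lemma model_abs (E : ProvEquiv) (R S : D (Con (pe_ar E))) :
  fint M (Abs E) (cons_v R nov) = fint M (Abs E) (cons_v S nov) <->
  sat M0 (pe_form E) (cons_v R (cons_v S nov)).
Proof.
  pose proof (HM _ (PFT_abs E)) as HA. unfold abstraction in HA.
  rewrite sat_close in HA. specialize (HA (cons_v R (cons_v S nov))).
  rewrite sat_Iff sat_emb in HA. exact HA.
Qed.

Definition ext (X : D (Con 0)) : D Obj := fint M (Abs extension) (cons_v X nov).

Lemma ext_inj X Y : ext X = ext Y <-> X = Y.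
Proof. exact (model_abs extension X Y). Qed.

Lemma first_order_compr {G : list fsort} (k : nat) (p : form (freg pe_ar) (objs (S k) ++ G))
  (e : valu D G) : first_order p ->
  exists R : D (Con k), forall a, ap R a <-> sat M p (app_v _ a e).
Proof. exact (model_compr (ar := pe_ar) M model_OS p e). Qed.

Lemma exists_empty k : exists R : D (Con k), forall a, ~ ap R a.
Proof.
  destruct (first_order_compr (G := []) k Bot nov Logic.I) as [R HR].
  exists R. intros a Ha. now apply HR in Ha.
Qed.

Lemma exists_tuple {k} (a : valu D (objs (S k))) :
  exists R : D (Con k), forall b, ap R b <-> b = a.
Proof.
  destruct (first_order_compr (G := objs (S k)) k
    (eqs (vleft (objs (S k))) (vright (objs (S k)))) a (first_order_eqs _ _)) as [R HR].
  exists R. intro b. rewrite HR sat_eqs.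
  rewrite app_v_left app_v_right. reflexivity.
Qed.

Definition one_obj (v : D Obj) : valu D (objs 1) := cons_v v nov.

Lemma one_obj_eta (a : valu D (objs 1)) : a = one_obj (a Obj vz).
Proof. funext2 s x. cbn in x. case_var x; [reflexivity|]. case_var x. Qed.

(** The extensions of the empty concept and of a singleton. *)
Lemma two_objects : exists o o' : D Obj, o <> o'.
Proof.
  destruct (exists_empty 0) as [X HX]. destruct (exists_tuple (one_obj (ext X))) as [Y HY].
  exists (ext X), (ext Y). intro E. apply ext_inj in E. apply (HX (one_obj (ext X))).
  subst Y. now apply HY.
Qed.

Lemma exists_pair {k j} (P : D (Con k)) (Q : D (Con j)) :
  exists R : D (Con (S (S (k + S j)))), codes (M := M) R (ap P) Q.
Proof.
  destruct (first_order_compr (S (S (k + S j))) pairing (cons_v P (cons_v Q nov)))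
    as [R HR].
  - cbn. tauto.
  - exists R. intro b. rewrite HR. apply (sat_pairing (ar := pe_ar) M).
Qed.

Definition tagged {m : nat} (o o' : D Obj) (b : valu D (objs m)) : valu D (objs (S (S m))) :=
  cons_v (G := objs (S m)) o (cons_v (G := objs m) o' b).

Lemma codes_tagged {k j} (R : D (Con (S (S (k + S j))))) P Q :
  codes (M := M) (k := k) (j := j) R P Q -> forall o o' w z,
  ap R (tagged o o' (oapp (m := S k) (n := S j) w z)) <-> (o = o' /\ P w) \/ (o <> o' /\ ap Q z).
Proof.
  intros H o o' w z. refine (iff_trans (H _) _).
  enough (F : forall u v, u = w -> v = z ->
    (o = o' /\ P u) \/ (o <> o' /\ ap Q v) <-> (o = o' /\ P w) \/ (o <> o' /\ ap Q z))
    by exact (F _ _ (oapp_pre _ _ w z) (oapp_suf _ _ w z)).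
  now intros u v -> ->.
Qed.

(** A code is evaluated at equal tags to recover the first component, and at distinct
    tags to recover the second. *)
Lemma codes_inj {k j} (R : D (Con (S (S (k + S j))))) (P P' : D (Con k)) (Q Q' : D (Con j)) :
  codes (M := M) R (ap P) Q -> codes (M := M) R (ap P') Q' -> P = P' /\ Q = Q'.
Proof.
  intros H H'. destruct two_objects as (o & o' & Ho).
  pose proof (codes_tagged R _ _ H) as F. pose proof (codes_tagged R _ _ H') as F'.
  split; apply (model_ext (ar := pe_ar) M model_OS); intro a.
  - specialize (F o o a (filler o (S j))). specialize (F' o o a (filler o (S j))). tauto.
  - specialize (F o o' (filler o (S k)) a). specialize (F' o o' (filler o (S k)) a). tauto.
Qed.

Lemma decoded_code {k j H} (p : form LC (Con k :: Con j :: H)) R P Q h :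
  codes (M := M) R (ap P) Q ->
  sat M0 (decoded p) (cons_v R h) <-> sat M0 p (cons_v P (cons_v Q h)).
Proof.
  intro HR. rewrite sat_decoded. split.
  - intros (Q' & P' & HR' & Hp). destruct (codes_inj R P P' Q Q' HR HR') as [-> ->].
    exact Hp.
  - intro Hp. exists Q, P. now split.
Qed.

(** Definability by L0-formulas with a parameter.  Allowing a single concept parameter
    is no restriction, since pairs are coded by concepts. *)
Definition definable (H : list fsort) (X : valu D H -> Prop) : Prop :=
  exists j (Q : D (Con j)) (p : form LC (Con j :: H)),
    forall h, X h <-> sat M0 p (cons_v Q h).

(** * Closure properties of definability *)

Lemma def_iff {H} (X Y : valu D H -> Prop) :
  (forall h, X h <-> Y h) -> definable H Y -> definable H X.
Proof.
  intros E (j & Q & p & Hp). exists j, Q, p. intro h. now rewrite E Hp.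
Qed.

(** Formulas with different parameters become formulas in a common one, a code of
    both. *)
Lemma def_common {H} (X Y : valu D H -> Prop) : definable H X -> definable H Y ->
  exists j (Q : D (Con j)) (p q : form LC (Con j :: H)),
    (forall h, X h <-> sat M0 p (cons_v Q h)) /\ (forall h, Y h <-> sat M0 q (cons_v Q h)).
Proof.
  intros (k & P & p & Hp) (j & Q & q & Hq). destruct (exists_pair P Q) as [R HR].
  exists _, R,
    (decoded (ren_form (L := LC) (H := Con k :: Con j :: H)
      (vcons (P := var (Con k :: Con j :: H)) vz (fun s x => vs (vs x))) p)),
    (decoded (ren_form (L := LC) (H := Con k :: Con j :: H) (fun s x => vs x) q)).
  split; intro h; rewrite (decoded_code _ R P Q h HR) sat_ren.
  - rewrite Hp. sat_same. funext2 s x. case_var x; reflexivity.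
  - rewrite Hq. reflexivity.
Qed.

Lemma def_and {H} (X Y : valu D H -> Prop) :
  definable H X -> definable H Y -> definable H (fun h => X h /\ Y h).
Proof.
  intros HX HY. destruct (def_common X Y HX HY) as (j & Q & p & q & Hp & Hq).
  exists j, Q, (And p q). intro h. cbn. now rewrite Hp Hq.
Qed.

Lemma def_or {H} (X Y : valu D H -> Prop) :
  definable H X -> definable H Y -> definable H (fun h => X h \/ Y h).
Proof.
  intros HX HY. destruct (def_common X Y HX HY) as (j & Q & p & q & Hp & Hq).
  exists j, Q, (Or p q). intro h. cbn. now rewrite Hp Hq.
Qed.

Lemma def_imp {H} (X Y : valu D H -> Prop) :
  definable H X -> definable H Y -> definable H (fun h => X h -> Y h).
Proof.
  intros HX HY. destruct (def_common X Y HX HY) as (j & Q & p & q & Hp & Hq).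
  exists j, Q, (Imp p q). intro h. cbn. now rewrite Hp Hq.
Qed.

Lemma def_False {H} : definable H (fun _ => False).
Proof.
  destruct (dom_inh M (Con 0)) as [Q]. now exists 0, Q, Bot.
Qed.

Definition swap {s t : fsort} {H : list fsort} : ren (s :: t :: H) (t :: s :: H) :=
  vcons (P := var (t :: s :: H)) (vs vz) (vcons (P := var (t :: s :: H)) vz (fun r x => vs (vs x))).

Lemma sat_swap {s t : fsort} {H} (p : form LC (s :: t :: H)) u v h :
  sat M0 (ren_form (L := LC) swap p) (cons_v v (cons_v u h)) = sat M0 p (cons_v u (cons_v v h)).
Proof.
  rewrite sat_ren. f_equal. funext2 r x. case_var x; [reflexivity|]. case_var x; reflexivity.
Qed.

(** The shape of the premise, [X] applied to the head and the tail of an assignment,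
    makes the conclusion a higher-order pattern, so that proofs of definability can be
    found by unification; likewise for [def_ex]. *)
Lemma def_all {H} (s : fsort) (X : D s -> valu D H -> Prop) :
  definable (s :: H) (fun h => X (h s vz) (fun r x => h r (vs x))) ->
  definable H (fun h => forall v, X v h).
Proof.
  intros (j & Q & p & Hp). exists j, Q, (All (L := LC) (s := s) (ren_form (L := LC) swap p)).
  intro h. cbn [sat]. apply all_iff. intro v. rewrite sat_swap -Hp. reflexivity.
Qed.

Lemma def_ex {H} (s : fsort) (X : D s -> valu D H -> Prop) :
  definable (s :: H) (fun h => X (h s vz) (fun r x => h r (vs x))) ->
  definable H (fun h => exists v, X v h).
Proof.
  intros (j & Q & p & Hp). exists j, Q, (Ex (L := LC) (s := s) (ren_form (L := LC) swap p)).
  intro h. cbn [sat]. apply ex_iff. intro v. rewrite sat_swap -Hp. reflexivity.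
Qed.

Lemma def_ren {H K : list fsort} (xi : ren H K) (X : valu D H -> Prop) :
  definable H X -> definable K (fun h => X (fun s x => h s (xi s x))).
Proof.
  intros (j & Q & p & Hp). exists j, Q, (ren_form (L := LC) (ren_up xi) p).
  intro h. rewrite sat_ren Hp. now rewrite cons_v_ren_up.
Qed.

Lemma def_eq {H : list fsort} (s : fsort) (x y : var H s) :
  definable H (fun h => h s x = h s y).
Proof.
  destruct (dom_inh M (Con 0)) as [Q].
  exists 0, Q, (Eq (L := LC) (Var (L := LC) (vs x)) (Var (L := LC) (vs y))). reflexivity.
Qed.

Lemma def_ap {H : list fsort} {k} (R : D (Con k)) (xs : ren (objs (S k)) H) :
  definable H (fun h => ap R (fun s x => h s (xs s x))).
Proof.
  exists k, R, (pred (Var (L := LC) vz) (var_args (L := LC) (fun s x => vs (xs s x)))).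
  intro h. rewrite sat_pred eval_var_args. reflexivity.
Qed.

Lemma def_ap_var {H : list fsort} {k} (X : var H (Con k)) (xs : ren (objs (S k)) H) :
  definable H (fun h => ap (h _ X) (fun s x => h s (xs s x))).
Proof.
  destruct (dom_inh M (Con 0)) as [Q].
  exists 0, Q, (pred (Var (L := LC) (vs X)) (var_args (L := LC) (fun s x => vs (xs s x)))).
  intro h. rewrite sat_pred eval_var_args. reflexivity.
Qed.

(** Parameters may be fixed: a concept is merged into the parameter, and an object is
    given by its singleton. *)
Lemma def_inst {H} (s : fsort) (v : D s) (X : valu D (s :: H) -> Prop) :
  definable (s :: H) X -> definable H (fun h => X (cons_v v h)).
Proof.
  destruct s as [|k].
  - intro HX. destruct (exists_tuple (one_obj v)) as [R HR].
    apply (def_iff _ (fun h => exists w, ap R (one_obj w) /\ X (cons_v w h))).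
    + intro h. split.
      * intro Hv. exists v. split; [now apply HR|exact Hv].
      * intros (w & Hw & HXw). apply HR in Hw.
        apply (f_equal (fun f => f Obj vz)) in Hw. cbn in Hw. now subst.
    + apply (def_ex Obj (fun w h => ap R (one_obj w) /\ X (cons_v w h))).
      apply def_and.
      * eapply def_iff; [|apply (def_ap R (vcons (P := var (Obj :: H)) vz vnil))].
        intro h. cbn beta. match goal with |- ap R ?a <-> ap R ?b => replace b with a end.
        -- reflexivity.
        -- symmetry. apply one_obj_eta.
      * eapply def_iff; [|exact HX]. intro h. cbn beta.
        now rewrite (cons_v_eta h : cons_v (h Obj vz) (fun r x => h r (vs x)) = h).
  - intros (j & Q & p & Hp). destruct (exists_pair Q v) as [R HR].
    exists _, R, (decoded p). intro h. now rewrite (decoded_code p R Q v h HR) Hp.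
Qed.

Lemma def_params (l : list fsort) : forall {H} (a : valu D l) (X : valu D (l ++ H) -> Prop),
  definable (l ++ H) X -> definable H (fun h => X (app_v l a h)).
Proof.
  induction l as [|s l IH]; intros H a X HX; [exact HX|].
  apply (IH H (tl_v a) (fun h => X (cons_v (a s vz) h))).
  apply (def_inst s (a s vz) X). exact HX.
Qed.

(** * Comprehension *)

Lemma sat_if_eq {G : list fsort} (x y : var G Obj) (p q : form (freg pe_ar) G) e :
  sat M (if_eq x y p q) e <-> (e _ x = e _ y /\ sat M p e) \/ (e _ x <> e _ y /\ sat M q e).
Proof. reflexivity. Qed.

(** Singletons of tuples are sections of the identity relation, so codes of
    [({a}, Q)] are uniformly the sections of one concept. *)
Lemma exists_codes {k j} (Q : D (Con j)) :
  exists R : D (Con (k + S (S (S (k + S j))))), forall a : valu D (objs (S k)),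
    codes (M := M) (section (ar := pe_ar) M R a) (fun b => b = a) Q.
Proof.
  set (J := S (S (k + S j))).
  pose (l := objs (S k + S J)). pose (K := l ++ [Con j]).
  destruct (first_order_compr (G := [Con j]) (k + S J)
    (if_eq (G := K) (vleft l _ (suf (S k) (S J) _ vz)) (vleft l _ (suf (S k) (S J) _ (vs vz)))
       (eqs (l := objs (S k)) (G := K)
          (fun s x => vleft l s (suf (S k) (S J) s (vs (vs (pre (S k) (S j) s x)))))
          (fun s x => vleft l s (pre (S k) (S J) s x)))
       (pred (Var (L := freg pe_ar) (vright l _ vz)) (var_args (L := freg pe_ar) (l := objs (S j)) (G := K)
          (fun s x => vleft l s (suf (S k) (S J) s (vs (vs (suf (S k) (S j) s x))))))))
    (cons_v Q nov)) as [R HR].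
  - cbn [first_order if_eq]. repeat split; apply first_order_eqs.
  - exists R. intros a b. rewrite (model_proj (ar := pe_ar) M model_OS) HR sat_if_eq sat_eqs.
    set (e := app_v _ _ _).
    assert (Ep : forall s x, e s (vleft l s (pre (S k) (S J) s x)) = a s x).
    { intros s x. exact (eq_trans (app_v_vleft l _ _ s _) (oapp_pre_at (S k) (S J) a b s x)). }
    assert (Es : forall s x, e s (vleft l s (suf (S k) (S J) s x)) = b s x).
    { intros s x. exact (eq_trans (app_v_vleft l _ _ s _) (oapp_suf_at (S k) (S J) a b s x)). }
    assert (E1 := functional_extensionality_dep _ _ (fun s =>
      functional_extensionality_dep _ _ (fun x => Ep s x))).
    assert (E2 := functional_extensionality_dep _ _ (fun s =>
      functional_extensionality_dep _ _ (fun x : var (objs (S k)) s =>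
        Es s (vs (vs (pre (S k) (S j) s x)))))).
    assert (E3 := functional_extensionality_dep _ _ (fun s =>
      functional_extensionality_dep _ _ (fun x : var (objs (S j)) s =>
        Es s (vs (vs (suf (S k) (S j) s x)))))).
    rewrite sat_pred eval_var_args. cbn beta in *.
    rewrite E1 E2 E3 !Es. cbn [eval].
    replace (e _ (vright l _ vz)) with Q by (symmetry; apply (app_v_vright l)).
    reflexivity.
Qed.

(** Here impredicativity enters.  The abstract of the section at [a] records the truth
    value of [p], so comparing it with the abstract [c] of one section that satisfies [p]
    is a quantifier-free condition equivalent to [p]. *)
Lemma section_compr {k J} (R : D (Con (k + S J))) (p : form L0 [Con J]) :
  exists Y : D (Con k), forall a, ap Y a <->
    sat M0 p (cons_v (section (ar := pe_ar) M R a) nov).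
Proof.
  (* A reference value [c] is available when some section satisfies [p]; otherwise the
     empty concept will do. *)
  destruct (classic (exists a, sat M0 p (cons_v (section (ar := pe_ar) M R a) nov)))
    as [[a0 H0]|N].
  - pose (c := fint M (Abs (truth_value p)) (cons_v (section (ar := pe_ar) M R a0) nov)).
    destruct (first_order_compr (G := [Con (k + S J); Obj]) k
      (Eq (L := freg pe_ar)
         (abs (truth_value p) (proj (Var (L := freg pe_ar) (vright (objs (S k)) _ vz))
            (block (L := freg pe_ar) (objs (S k)))))
         (Var (L := freg pe_ar) (vright (objs (S k)) _ (vs vz))))
      (cons_v R (cons_v c nov)) Logic.I) as [Y HY].
    exists Y. intro a. rewrite HY. cbn [sat].
    set (e := app_v _ _ _).
    assert (E : eval M (abs (truth_value p) (proj (Var (L := freg pe_ar) (vright (objs (S k)) _ vz))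
            (block (L := freg pe_ar) (objs (S k))))) e =
        fint M (Abs (truth_value p)) (cons_v (section (ar := pe_ar) M R a) nov)).
    { transitivity (fint M (Abs (truth_value p)) (cons_v (section (ar := pe_ar) M
        (e _ (vright (objs (S k)) _ vz)) (eval_args M (block (L := freg pe_ar) (objs (S k))) e)) nov)).
      - reflexivity.
      - unfold e. rewrite (eval_block (L := freg pe_ar) M) app_v_vright. reflexivity. }
    rewrite E. cbn [eval].
    assert (Ec : e Obj (vright (objs (S k)) Obj (vs vz)) = c)
      by apply (app_v_vright (objs (S k))).
    rewrite Ec.
    refine (iff_trans (model_abs (truth_value p) _ _) _).
    change (sat M0 (same_value p) (cons_v (section (ar := pe_ar) M R a)
      (cons_v (section (ar := pe_ar) M R a0) nov)) <->
      sat M0 p (cons_v (section (ar := pe_ar) M R a) nov)).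
    rewrite sat_same_value. tauto.
  - destruct (exists_empty k) as [Y HY]. exists Y. intro a. split; intro H; exfalso.
    + now apply (HY a).
    + apply N. now exists a.
Qed.

(** The section at [a] codes [({a}, Q)], so the property [p] of [Q] and [a] becomes the
    L0-property of the code: [p] holds of [Q] and every element of the first
    component. *)
Theorem comprehension_definable {k} (X : valu D (objs (S k)) -> Prop) :
  definable (objs (S k)) X -> exists R : D (Con k), forall a, ap R a <-> X a.
Proof.
  intros (j & Q & p & Hp). destruct (exists_codes (k := k) Q) as [R HR].
  set (l := objs (S k)).
  (* [q] says of a first component [P] and a second component [Q] that [p] holds of [Q]
     and every tuple in [P]. *)
  pose (q := foralls (L := LC) l (G := [Con k; Con j])
    (Imp (pred (Var (L := LC) (vright l _ vz)) (block (L := LC) l))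
         (ren_form (L := LC) (H := l ++ [Con k; Con j])
            (vcons (P := var (l ++ [Con k; Con j])) (vright l _ (vs vz)) (vleft l)) p))).
  destruct (section_compr R (decoded q)) as [Y HY].
  exists Y. intro a. rewrite HY. clear HY Y.
  destruct (exists_tuple a) as [P HP].
  assert (HR' : codes (M := M) (section (ar := pe_ar) M R a) (ap P) Q).
  { intro b. now rewrite (HR a b) HP. }
  refine (iff_trans (decoded_code q _ P Q nov HR') _). unfold q.
  rewrite sat_foralls.
  assert (F : forall b, sat M0 (ren_form (L := LC) (H := l ++ [Con k; Con j])
     (vcons (P := var (l ++ [Con k; Con j])) (vright l _ (vs vz)) (vleft l)) p)
     (app_v l b (cons_v P (cons_v Q nov))) <-> X b).
  { intro b. rewrite Hp sat_ren. sat_same. funext2 s x.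
    case_var x.
    - exact (app_v_vright l b (cons_v P (cons_v Q nov)) (Con j) (vs vz)).
    - exact (app_v_vleft l b (cons_v P (cons_v Q nov)) s x). }
  assert (F' : forall b, sat M0 (pred (Var (L := LC) (vright l (G := [Con k; Con j]) _ vz))
     (block (L := LC) l)) (app_v l b (cons_v P (cons_v Q nov))) <-> b = a).
  { intro b. rewrite sat_pred eval_block. cbn [eval]. rewrite app_v_vright. apply HP. }
  split.
  - intro H. apply F, (H a), F'. reflexivity.
  - intros H b Hb. apply F' in Hb as ->. now apply F.
Qed.

End Models.

(** * Formulas of arithmetic in the language of abstracts *)

Section ArithmeticFormulas.
Notation L := (freg pe_ar).

(** These abbreviations fix the sort type to [fsort], where [sort L1] would
    otherwise be inferred and block unification. *)
Definition fm (G : list fsort) : Set := form L G.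
Definition ov {G : list fsort} (x : var G Obj) : term L G Obj := Var (L := L) x.
Definition cv {G : list fsort} {k} (x : var G (Con k)) : term L G (Con k) := Var (L := L) x.
Definition fAll {G : list fsort} (s : fsort) (p : fm (s :: G)) : fm G := All (L := L) (s := s) p.
Definition fEx {G : list fsort} (s : fsort) (p : fm (s :: G)) : fm G := Ex (L := L) (s := s) p.

Definition pred1 {G : list fsort} (X : var G (Con 0)) (x : var G Obj) : fm G :=
  pred (cv X) (acons (L := L) (ov x) (anil (L := L))).

Definition pred3 {G : list fsort} (X : var G (Con 2)) (x y z : var G Obj) : fm G :=
  pred (cv X) (acons (L := L) (ov x) (acons (L := L) (ov y) (acons (L := L) (ov z) (anil (L := L))))).

Definition ext_term {G : list fsort} (X : var G (Con 0)) : term L G Obj :=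
  abs extension (cv (k := pe_ar extension) X).

Definition zeroF {G : list fsort} (x : var G Obj) : fm G :=
  fEx (Con 0) (And (fAll Obj (Not (pred1 (vs vz) vz)))
                   (Eq (L := L) (ov (vs x)) (ext_term vz))).

Definition succF {G : list fsort} (x y : var G Obj) : fm G :=
  fEx (Con 0) (And (fAll Obj (Iff (pred1 (vs vz) vz) (Eq (L := L) (ov vz) (ov (vs (vs x))))))
                   (Eq (L := L) (ov (vs y)) (ext_term vz))).

Definition numF {G : list fsort} (x : var G Obj) : fm G :=
  fAll (Con 0) (Imp (fAll Obj (Imp (zeroF vz) (pred1 (vs vz) vz)))
    (Imp (fAll Obj (fAll Obj (Imp (pred1 (vs (vs vz)) (vs vz))
            (Imp (succF (vs vz) vz) (pred1 (vs (vs vz)) vz)))))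
         (pred1 vz (vs x)))).

(** The least relation [F] such that [F x 0 z] whenever [b x z], and [F x (y + 1) z']
    whenever [F x y z] and [s x z z'].  The clauses [b] and [s] take the context as an
    argument because they are used under different binders. *)
Definition recF (b : forall G : list fsort, var G Obj -> var G Obj -> fm G)
    (s : forall G : list fsort, var G Obj -> var G Obj -> var G Obj -> fm G)
    {G : list fsort} (x y z : var G Obj) : fm G :=
  fAll (Con 2) (Imp
    (fAll Obj (fAll Obj (fAll Obj
       (Imp (zeroF (vs vz)) (Imp (b _ (vs (vs vz)) vz)
          (pred3 (vs (vs (vs vz))) (vs (vs vz)) (vs vz) vz))))))
    (Imp
      (fAll Obj (fAll Obj (fAll Obj (fAll Obj (fAll Obj
         (Imp (pred3 (vs (vs (vs (vs (vs vz))))) (vs (vs (vs (vs vz)))) (vs (vs (vs vz))) (vs (vs vz)))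
           (Imp (succF (vs (vs (vs vz))) (vs vz))
             (Imp (s _ (vs (vs (vs (vs vz)))) (vs (vs vz)) vz)
               (pred3 (vs (vs (vs (vs (vs vz))))) (vs (vs (vs (vs vz)))) (vs vz) vz)))))))))
      (pred3 vz (vs x) (vs y) (vs z)))).

Definition plusF : forall {G : list fsort}, var G Obj -> var G Obj -> var G Obj -> fm G :=
  @recF (fun G x z => Eq (L := L) (ov z) (ov x)) (fun G x w z => succF w z).

Definition timesF : forall {G : list fsort}, var G Obj -> var G Obj -> var G Obj -> fm G :=
  @recF (fun G x z => zeroF z) (fun G x w z => plusF w x z).

Definition oneF {G : list fsort} (x : var G Obj) : fm G :=
  fEx Obj (And (zeroF vz) (succF vz (vs x))).

Definition lessF {G : list fsort} (x y : var G Obj) : fm G :=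
  fEx Obj (fEx Obj (And (numF (vs vz)) (And (succF (vs vz) vz)
    (plusF (vs (vs x)) vz (vs (vs y)))))).

End ArithmeticFormulas.

Section Arithmetic.
Context (M : structure L1) (HM : models M PFT).
Notation D := (dom (L := L1) M).
Notation O := (D Obj).
Notation ap := (ap (ar := pe_ar) M).
Notation ext := (ext M).
Notation definable := (definable M).

Definition tuple1 (a : O) : valu D (objs 1) := cons_v (G := objs 0) a nov.
Definition tuple2 (a b : O) : valu D (objs 2) := cons_v (G := objs 1) a (tuple1 b).
Definition tuple3 (a b c : O) : valu D (objs 3) := cons_v (G := objs 2) a (tuple2 b c).
Definition ap1 (X : D (Con 0)) a : Prop := ap X (tuple1 a).
Definition ap2 (X : D (Con 1)) a b : Prop := ap X (tuple2 a b).
Definition ap3 (X : D (Con 2)) a b c : Prop := ap X (tuple3 a b c).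

(** The relations below are what the formulas above mean in [M]: satisfaction computes
    to them, and [Rec] to [recF]. *)
Definition IsZero (x : O) : Prop := exists X, (forall w, ~ ap1 X w) /\ x = ext X.
Definition IsSucc (x y : O) : Prop :=
  exists X, (forall w, ap1 X w <-> w = x) /\ y = ext X.
Definition IsNum (x : O) : Prop := forall X : D (Con 0),
  (forall u, IsZero u -> ap1 X u) ->
  (forall u v, ap1 X u -> IsSucc u v -> ap1 X v) -> ap1 X x.
Definition Rec (B : O -> O -> Prop) (St : O -> O -> O -> Prop) (x y z : O) : Prop :=
  forall F : D (Con 2),
  (forall u v w, IsZero v -> B u w -> ap3 F u v w) ->
  (forall u v w v' w', ap3 F u v w -> IsSucc v v' -> St u w w' -> ap3 F u v' w') ->
  ap3 F x y z.
Definition IsSum : O -> O -> O -> Prop := Rec (fun x z => z = x) (fun x w z => IsSucc w z).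
Definition IsProd : O -> O -> O -> Prop := Rec (fun x z => IsZero z) (fun x w z => IsSum w x z).
Definition IsOne (x : O) : Prop := exists z, IsZero z /\ IsSucc z x.
Definition IsLess (x y : O) : Prop := exists d d', IsNum d /\ IsSucc d d' /\ IsSum x d' y.

(** * Definability of the arithmetical relations *)

Lemma def1 {H : list fsort} (X : D (Con 0)) (x : var H Obj) :
  definable H (fun h => ap1 X (h _ x)).
Proof.
  apply (def_iff M) with (2 := def_ap M X (vcons (P := var H) x vnil)).
  intro h. unfold ap1. match goal with |- ap X ?a <-> ap X ?b => replace b with a end;
    [reflexivity|]. funext2 s y. cbn in y. case_var y; [reflexivity|case_var y].
Qed.

Lemma def2 {H : list fsort} (X : D (Con 1)) (x y : var H Obj) :
  definable H (fun h => ap2 X (h _ x) (h _ y)).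
Proof.
  apply (def_iff M) with (2 := def_ap M X (vcons (P := var H) x (vcons (P := var H) y vnil))).
  intro h. unfold ap2. match goal with |- ap X ?a <-> ap X ?b => replace b with a end;
    [reflexivity|]. funext2 s z. cbn in z. case_var z; [reflexivity|].
  case_var z; [reflexivity|case_var z].
Qed.

Lemma def3 {H : list fsort} (X : D (Con 2)) (x y z : var H Obj) :
  definable H (fun h => ap3 X (h _ x) (h _ y) (h _ z)).
Proof.
  apply (def_iff M) with (2 := def_ap M X
    (vcons (P := var H) x (vcons (P := var H) y (vcons (P := var H) z vnil)))).
  intro h. unfold ap3. match goal with |- ap X ?a <-> ap X ?b => replace b with a end;
    [reflexivity|]. funext2 s u. cbn in u. case_var u; [reflexivity|].
  case_var u; [reflexivity|]. case_var u; [reflexivity|case_var u].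
Qed.

Lemma def1_var {H : list fsort} (X : var H (Con 0)) (x : var H Obj) :
  definable H (fun h => ap1 (h _ X) (h _ x)).
Proof.
  apply (def_iff M) with (2 := def_ap_var M X (vcons (P := var H) x vnil)).
  intro h. unfold ap1. match goal with |- ap _ ?a <-> ap _ ?b => replace b with a end;
    [reflexivity|]. funext2 s y. cbn in y. case_var y; [reflexivity|case_var y].
Qed.

Lemma def3_var {H : list fsort} (X : var H (Con 2)) (x y z : var H Obj) :
  definable H (fun h => ap3 (h _ X) (h _ x) (h _ y) (h _ z)).
Proof.
  apply (def_iff M) with (2 := def_ap_var M X
    (vcons (P := var H) x (vcons (P := var H) y (vcons (P := var H) z vnil)))).
  intro h. unfold ap3. match goal with |- ap _ ?a <-> ap _ ?b => replace b with a end;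
    [reflexivity|]. funext2 s u. cbn in u. case_var u; [reflexivity|].
  case_var u; [reflexivity|]. case_var u; [reflexivity|case_var u].
Qed.

Lemma compr1 (P : O -> Prop) : definable [Obj] (fun h => P (h Obj vz)) ->
  exists X, forall a, ap1 X a <-> P a.
Proof.
  intro HP. destruct (comprehension_definable M HM (k := 0) _ HP) as [X HX].
  exists X. intro a. apply HX.
Qed.

Lemma compr3 (P : O -> O -> O -> Prop) :
  definable [Obj; Obj; Obj] (fun h => P (h Obj vz) (h Obj (vs vz)) (h Obj (vs (vs vz)))) ->
  exists X, forall a b c, ap3 X a b c <-> P a b c.
Proof.
  intro HP. destruct (comprehension_definable M HM (k := 2) _ HP) as [X HX].
  exists X. intros a b c. apply HX.
Qed.

(** * Zero and successor *)

Lemma exists_singleton (v : O) : exists X, forall w, ap1 X w <-> w = v.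
Proof.
  destruct (exists_tuple M HM (k := 0) (tuple1 v)) as [X HX]. exists X. intro w.
  unfold ap1. rewrite HX. split; [|now intros ->].
  intro E. exact (f_equal (fun f => f Obj vz) E).
Qed.

Lemma ap1_ext X Y : (forall w, ap1 X w <-> ap1 Y w) -> X = Y.
Proof.
  intro H. apply (model_ext (ar := pe_ar) M (model_OS M HM)). intro a.
  rewrite (one_obj_eta M a). apply H.
Qed.

Lemma zero_spec : exists z, forall x, IsZero x <-> x = z.
Proof.
  destruct (exists_empty M HM 0) as [X HX]. exists (ext X). intro x. split.
  - intros (Y & HY & ->). f_equal. apply ap1_ext. intro w.
    split; intro Hw; [now apply HY in Hw|now apply HX in Hw].
  - intros ->. exists X. split; [intro w; apply HX|reflexivity].
Qed.

Definition zero_obj : O := proj1_sig (constructive_indefinite_description _ zero_spec).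

Lemma IsZeroE x : IsZero x <-> x = zero_obj.
Proof. unfold zero_obj. now destruct constructive_indefinite_description. Qed.

Lemma succ_spec x : exists y, forall y', IsSucc x y' <-> y' = y.
Proof.
  destruct (exists_singleton x) as [X HX]. exists (ext X). intro y. split.
  - intros (Y & HY & ->). f_equal. apply ap1_ext. intro w. now rewrite HX HY.
  - intros ->. now exists X.
Qed.

Definition succ_obj (x : O) : O := proj1_sig (constructive_indefinite_description _ (succ_spec x)).

Lemma IsSuccE x y : IsSucc x y <-> y = succ_obj x.
Proof. unfold succ_obj. now destruct constructive_indefinite_description. Qed.

Lemma succ_inj x y : succ_obj x = succ_obj y -> x = y.
Proof.
  intro E. assert (Hx : IsSucc x (succ_obj x)) by now apply IsSuccE.
  assert (Hy : IsSucc y (succ_obj y)) by now apply IsSuccE.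
  destruct Hx as (X & HX & EX), Hy as (Y & HY & EY). rewrite EX EY in E.
  apply (ext_inj M HM) in E as ->. apply HY, HX. reflexivity.
Qed.

Lemma succ_neq_zero x : succ_obj x <> zero_obj.
Proof.
  intro E. assert (Hx : IsSucc x (succ_obj x)) by now apply IsSuccE.
  assert (Hz : IsZero zero_obj) by now apply IsZeroE.
  destruct Hx as (X & HX & EX), Hz as (Y & HY & EY). rewrite EX EY in E.
  apply (ext_inj M HM) in E as ->. apply (HY x). now apply HX.
Qed.

Lemma def_zero {H : list fsort} (x : var H Obj) : definable H (fun h => IsZero (h _ x)).
Proof.
  destruct (exists_singleton zero_obj) as [Z HZ].
  apply (def_iff M) with (2 := def1 Z x). intro h. now rewrite HZ IsZeroE.
Qed.

(** The graph of the successor is a concept by first-order comprehension, because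
    the singletons are the sections of the identity relation. *)
Lemma def_succ {H : list fsort} (x y : var H Obj) :
  definable H (fun h => IsSucc (h _ x) (h _ y)).
Proof.
  (* [R] is the identity relation and [S] the graph of the successor. *)
  destruct (first_order_compr M HM (G := []) 1
    (Eq (L := freg pe_ar) (ov vz) (ov (vs vz))) nov Logic.I) as [R HR].
  destruct (first_order_compr M HM (G := [Con 1]) 1
    (Eq (L := freg pe_ar) (ov (vs vz))
      (abs extension (proj (m := 0) (n := 0) (cv (vs (vs vz))) (acons (L := freg pe_ar) (ov vz) anil))))
    (cons_v R nov) Logic.I) as [S HS].
  apply (def_iff M) with (2 := def2 S x y). intro h. unfold ap2. rewrite HS. cbn [sat].
  set (u := h _ x). set (v := h _ y).
  change (IsSucc u v <-> v = ext (section (ar := pe_ar) M (m := 0) R (tuple1 u))).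
  assert (F : forall w, ap1 (section (ar := pe_ar) M (m := 0) R (tuple1 u)) w <-> w = u).
  { intro w. unfold ap1. rewrite (model_proj (ar := pe_ar) M (model_OS M HM)) HR.
    split; intro E; symmetry; exact E. }
  split.
  - intros (X & HX & ->). f_equal. apply ap1_ext. intro w. now rewrite HX F.
  - intros ->. now exists (section (ar := pe_ar) M (m := 0) R (tuple1 u)).
Qed.

(** The atomic cases come first: the rules for connectives would unfold the defined
    relations. *)
Ltac def_step :=
  first [ match goal with E : _ |- _ => apply E end
        | apply def1_var | apply def3_var | apply def_zero | apply def_succ
        | apply def1 | apply def3 | apply (def_eq M)
        | apply (def_False M)
        | apply (def_and M HM) | apply (def_or M HM) | apply (def_imp M HM)
        | apply (def_all M); cbn beta | apply (def_ex M); cbn beta ].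
Ltac def := repeat def_step.

Lemma def_num {H : list fsort} (x : var H Obj) : definable H (fun h => IsNum (h _ x)).
Proof. unfold IsNum. def. Qed.

Lemma def_Rec (B : O -> O -> Prop) (St : O -> O -> O -> Prop) :
  (forall H (x z : var H Obj), definable H (fun h => B (h _ x) (h _ z))) ->
  (forall H (x w z : var H Obj), definable H (fun h => St (h _ x) (h _ w) (h _ z))) ->
  forall H (x y z : var H Obj), definable H (fun h => Rec B St (h _ x) (h _ y) (h _ z)).
Proof. intros HB HS H x y z. unfold Rec. def. Qed.

Lemma def_sum {H : list fsort} (x y z : var H Obj) :
  definable H (fun h => IsSum (h _ x) (h _ y) (h _ z)).
Proof. unfold IsSum. apply def_Rec; intros; def. Qed.

Lemma def_prod {H : list fsort} (x y z : var H Obj) :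
  definable H (fun h => IsProd (h _ x) (h _ y) (h _ z)).
Proof. unfold IsProd. apply def_Rec; intros; [def|apply def_sum]. Qed.

Lemma def_one {H : list fsort} (x : var H Obj) : definable H (fun h => IsOne (h _ x)).
Proof. unfold IsOne. def. Qed.

Lemma def_less {H : list fsort} (x y : var H Obj) :
  definable H (fun h => IsLess (h _ x) (h _ y)).
Proof.
  unfold IsLess. apply (def_ex M); cbn beta. apply (def_ex M); cbn beta.
  apply (def_and M HM); [apply def_num|]. apply (def_and M HM); [apply def_succ|].
  apply def_sum.
Qed.

(** * Induction and recursion *)

Lemma num_zero : IsNum zero_obj.
Proof. intros X H0 _. apply H0. now apply IsZeroE. Qed.

Lemma num_succ x : IsNum x -> IsNum (succ_obj x).
Proof.
  intros Hx X H0 HS. apply (HS x); [now apply Hx|]. now apply IsSuccE.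
Qed.

(** The numbers that satisfy [P] form a concept closed under successor. *)
Lemma num_ind (P : O -> Prop) : definable [Obj] (fun h => P (h Obj vz)) ->
  P zero_obj -> (forall x, IsNum x -> P x -> P (succ_obj x)) -> forall x, IsNum x -> P x.
Proof.
  intros HP H0 HS x Hx.
  destruct (compr1 (fun x => IsNum x /\ P x)) as [X HX].
  { apply (def_and M HM); [apply def_num|exact HP]. }
  enough (ap1 X x) by now apply HX.
  apply Hx.
  - intros u Hu. apply IsZeroE in Hu as ->. apply HX. split; [apply num_zero|exact H0].
  - intros u v Hu Hv. apply IsSuccE in Hv as ->. apply HX in Hu as [Hu HPu].
    apply HX. split; [now apply num_succ|now apply HS].
Qed.

Lemma num_cases x : IsNum x -> x = zero_obj \/ exists y, IsNum y /\ x = succ_obj y.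
Proof.
  revert x. apply num_ind.
  - apply (def_iff M) with (Y := fun h => IsZero (h Obj vz) \/
      exists y, IsNum y /\ IsSucc y (h Obj vz)).
    + intro h. rewrite IsZeroE. apply or_iff_compat_l, ex_iff. intro y.
      now rewrite IsSuccE.
    + apply (def_or M HM); [apply def_zero|]. apply (def_ex M); cbn beta.
      apply (def_and M HM); [apply def_num|apply def_succ].
  - now left.
  - intros x Hx _. right. now exists x.
Qed.

Section Recursion.
Context (B : O -> O -> Prop) (St : O -> O -> O -> Prop).
Context (defB : forall H (x z : var H Obj), definable H (fun h => B (h _ x) (h _ z))).
Context (defS : forall H (x w z : var H Obj), definable H (fun h => St (h _ x) (h _ w) (h _ z))).

(** The least relation satisfies its own closure conditions in reverse, because the
    triples that arise from a clause form a concept [F] closed under the clauses. *)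
Lemma Rec_inv x y z : Rec B St x y z ->
  (y = zero_obj /\ B x z) \/ exists v w, y = succ_obj v /\ Rec B St x v w /\ St x w z.
Proof.
  intro Hxyz.
  destruct (compr3 (fun x y z => (IsZero y /\ B x z) \/
    exists v w, IsSucc v y /\ Rec B St x v w /\ St x w z)) as [F HF].
  { pose proof (def_Rec B St defB defS) as defR.
    apply (def_or M HM); [apply (def_and M HM); [apply def_zero|apply defB]|].
    apply (def_ex M); cbn beta. apply (def_ex M); cbn beta.
    apply (def_and M HM); [apply def_succ|]. apply (def_and M HM); [apply defR|apply defS]. }
  assert (HR : forall x y z, ap3 F x y z -> Rec B St x y z).
  { intros x' y' z' H. apply HF in H as [[H1 H2]|(v & w & H1 & H2 & H3)]; intros G G0 GS.
    - now apply G0.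
    - apply (GS x' v w); [now apply H2|exact H1|exact H3]. }
  assert (HFx : ap3 F x y z).
  { apply Hxyz.
    - intros u v w Hv Hw. apply HF. now left.
    - intros u v w v' w' HFu Hv Hw. apply HF. right. exists v, w.
      split; [exact Hv|]. split; [now apply HR|exact Hw]. }
  apply HF in HFx as [[H1 H2]|(v & w & H1 & H2 & H3)].
  - left. now apply IsZeroE in H1.
  - right. apply IsSuccE in H1. now exists v, w.
Qed.

Lemma Rec_zero x z : Rec B St x zero_obj z <-> B x z.
Proof.
  split.
  - intro H. destruct (Rec_inv _ _ _ H) as [[_ H']|(v & w & E & _)]; [exact H'|].
    now apply eq_sym, succ_neq_zero in E.
  - intros H F F0 _. apply F0; [now apply IsZeroE|exact H].
Qed.

Lemma Rec_succ x y z : Rec B St x (succ_obj y) z <-> exists w, Rec B St x y w /\ St x w z.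
Proof.
  split.
  - intro H. destruct (Rec_inv _ _ _ H) as [[E _]|(v & w & E & H1 & H2)].
    + now apply succ_neq_zero in E.
    + apply succ_inj in E as ->. now exists w.
  - intros (w & H1 & H2) F F0 FS. apply (FS x y w); [now apply H1| |exact H2].
    now apply IsSuccE.
Qed.

(** The premises ask for unique values among all objects, not only among numbers, since
    the least relation may relate numbers to arbitrary objects. *)
Lemma Rec_total :
  (forall x, IsNum x -> exists z, IsNum z /\ forall z', B x z' <-> z' = z) ->
  (forall x w, IsNum x -> IsNum w -> exists z, IsNum z /\ forall z', St x w z' <-> z' = z) ->
  forall x y, IsNum x -> IsNum y -> exists z, IsNum z /\ forall z', Rec B St x y z' <-> z' = z.
Proof.
  intros HB HS x y Hx. revert y. apply num_ind.
  - apply (def_inst M HM Obj x (fun h : valu D [Obj; Obj] => exists z, IsNum z /\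
      forall z', Rec B St (h Obj vz) (h Obj (vs vz)) z' <-> z' = z)).
    pose proof (def_Rec B St defB defS) as defR.
    apply (def_ex M); cbn beta. apply (def_and M HM); [apply def_num|].
    apply (def_all M); cbn beta. apply (def_and M HM); apply (def_imp M HM).
    all: first [apply defR | apply (def_eq M)].
  - destruct (HB x Hx) as (z & Hz & Ez). exists z. split; [exact Hz|].
    intro z'. now rewrite Rec_zero.
  - intros y Hy (w & Hw & Ew). destruct (HS x w Hx Hw) as (z & Hz & Ez).
    exists z. split; [exact Hz|]. intro z'. rewrite Rec_succ -Ez. split.
    + intros (w' & H1 & H2). now apply Ew in H1 as ->.
    + intro H. exists w. split; [now apply Ew|exact H].
Qed.

End Recursion.

Lemma sum_zero x z : IsSum x zero_obj z <-> z = x.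
Proof.
  refine (Rec_zero (fun x z => z = x) (fun x w z => IsSucc w z) _ _ x z); intros; def.
Qed.

Lemma sum_succ x y z : IsSum x (succ_obj y) z <-> exists w, IsSum x y w /\ z = succ_obj w.
Proof.
  refine (iff_trans
    (Rec_succ (fun x z => z = x) (fun x w z => IsSucc w z) _ _ x y z) _); try (intros; def).
  apply ex_iff. intro w. now rewrite IsSuccE.
Qed.

Lemma sum_total x y : IsNum x -> IsNum y ->
  exists z, IsNum z /\ forall z', IsSum x y z' <-> z' = z.
Proof.
  refine (Rec_total (fun x z => z = x) (fun x w z => IsSucc w z) _ _ _ _ x y);
    [intros; def|intros; def| |].
  - intros u Hu. now exists u.
  - intros u w Hu Hw. exists (succ_obj w). split; [now apply num_succ|]. apply IsSuccE.
Qed.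

Lemma prod_zero x z : IsProd x zero_obj z <-> z = zero_obj.
Proof.
  refine (iff_trans (Rec_zero (fun x z => IsZero z) (fun x w z => IsSum w x z) _ _ x z)
    (IsZeroE z)); intros; [def|apply def_sum].
Qed.

Lemma prod_succ x y z : IsProd x (succ_obj y) z <-> exists w, IsProd x y w /\ IsSum w x z.
Proof.
  refine (Rec_succ (fun x z => IsZero z) (fun x w z => IsSum w x z) _ _ x y z); intros;
    [def|apply def_sum].
Qed.

Lemma prod_total x y : IsNum x -> IsNum y ->
  exists z, IsNum z /\ forall z', IsProd x y z' <-> z' = z.
Proof.
  refine (Rec_total (fun x z => IsZero z) (fun x w z => IsSum w x z) _ _ _ _ x y);
    [intros; def|intros; apply def_sum| |].
  - intros u Hu. exists zero_obj. split; [apply num_zero|]. apply IsZeroE.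
  - intros u w Hu Hw. now apply sum_total.
Qed.

Lemma IsOneE x : IsOne x <-> x = succ_obj zero_obj.
Proof.
  split.
  - intros (z & Hz & Hx). apply IsZeroE in Hz as ->. now apply IsSuccE.
  - intros ->. exists zero_obj. split; [now apply IsZeroE|now apply IsSuccE].
Qed.

Lemma less_zero x : ~ IsLess x zero_obj.
Proof.
  intros (d & d' & _ & Hd & Hs). apply IsSuccE in Hd as ->.
  apply sum_succ in Hs as (w & _ & E). symmetry in E. now apply succ_neq_zero in E.
Qed.

Lemma less_succ x y : IsLess x (succ_obj y) <-> IsLess x y \/ x = y.
Proof.
  assert (E : forall d, IsSum x (succ_obj d) (succ_obj y) <-> IsSum x d y).
  { intro d. rewrite sum_succ. split.
    - intros (w & Hw & Ew). now apply succ_inj in Ew as ->.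
    - intro H. now exists y. }
  split.
  - intros (d & d' & Hd & Hd' & Hs). apply IsSuccE in Hd' as ->. apply E in Hs.
    destruct (num_cases d Hd) as [->|(c & Hc & ->)].
    + right. apply sum_zero in Hs. now symmetry.
    + left. exists c, (succ_obj c). split; [exact Hc|]. split; [now apply IsSuccE|exact Hs].
  - intros [(d & d' & Hd & Hd' & Hs)| ->].
    + apply IsSuccE in Hd' as ->. exists (succ_obj d), (succ_obj (succ_obj d)).
      split; [now apply num_succ|]. split; [now apply IsSuccE|now apply E].
    + exists zero_obj, (succ_obj zero_obj). split; [apply num_zero|]. split; [now apply IsSuccE|].
      apply E. now apply sum_zero.
Qed.

End Arithmetic.

(** * The interpretation of second-order arithmetic *)

(** Every unary concept is a set.  Two concepts that agree on the numbers but differ on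
    other objects are different sets. *)
Definition arith : translation LPA2 L1 :=
  Translation LPA2 L1
    (fun s : pa_sort => match s with Num => Obj | Sets => Con 0 end)
    (fun s => match s return form L1 [match s with Num => Obj | Sets => Con 0 end] with
       | Num => numF (G := [Obj]) vz
       | Sets => Not Bot
       end)
    (fun f => match f return form L1 (Obj :: map _ (fdom (s := LPA2) f)) with
       | Zero => zeroF (G := [Obj]) vz
       | One => oneF (G := [Obj]) vz
       | Plus => plusF (G := [Obj; Obj; Obj]) (vs vz) (vs (vs vz)) vz
       | Times => timesF (G := [Obj; Obj; Obj]) (vs vz) (vs (vs vz)) vz
       end)
    (fun r => match r return form L1 (map _ (rdom (s := LPA2) r)) with
       | Less => lessF (G := [Obj; Obj]) vz (vs vz)
       | Mem => pred1 (G := [Obj; Con 0]) (vs vz) vz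
       end).

Section DefinableTranslation.
Context (M : structure L1) (HM : models M PFT).
Notation definable := (definable M).
Context {S : signature} (I : translation S L1).
Context (def_dom : forall s, definable [tsort I s] (fun h => sat M (tdom I s) h)).
Context (def_fun : forall f, definable _ (fun h => sat M (tfun I f) h)).
Context (def_rel : forall r, definable _ (fun h => sat M (trel I r) h)).

Lemma def_sat_ren {H K : list fsort} (xi : ren H K) (p : form L1 H) :
  definable H (fun h => sat M p h) -> definable K (fun h => sat M (ren_form (L := L1) xi p) h).
Proof.
  intro Hp. apply (def_iff M) with (2 := def_ren M xi _ Hp).
  intro h. cbn beta. now rewrite sat_ren.
Qed.

Lemma def_in_dom {H : list fsort} s (x : var H (tsort I s)) :
  definable H (fun h => sat M (in_dom I s x) h).
Proof. apply def_sat_ren, def_dom. Qed.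

Lemma def_ExD {H : list fsort} s (p : form L1 (tsort I s :: H)) :
  definable (tsort I s :: H) (fun h => sat M p h) -> definable H (fun h => sat M (ExD I s p) h).
Proof.
  intro Hp. apply (def_ex M (tsort I s) (fun v h => sat M (in_dom I s vz /\ p)%form (cons_v v h))).
  apply (def_iff M) with (Y := fun h => sat M (in_dom I s vz) h /\ sat M p h).
  - intro h. cbn beta. now rewrite (cons_v_eta h : cons_v _ (fun r x => h r (vs x)) = h).
  - apply (def_and M HM); [apply def_in_dom|exact Hp].
Qed.

Lemma def_AllD {H : list fsort} s (p : form L1 (tsort I s :: H)) :
  definable (tsort I s :: H) (fun h => sat M p h) -> definable H (fun h => sat M (AllD I s p) h).
Proof.
  intro Hp. apply (def_all M (tsort I s) (fun v h => sat M (in_dom I s vz --> p)%form (cons_v v h))).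
  apply (def_iff M) with (Y := fun h => sat M (in_dom I s vz) h -> sat M p h).
  - intro h. cbn beta. now rewrite (cons_v_eta h : cons_v _ (fun r x => h r (vs x)) = h).
  - apply (def_imp M HM); [apply def_in_dom|exact Hp].
Qed.

Lemma def_ExDs l : forall {H : list fsort} (p : form L1 (map (tsort I) l ++ H)),
  definable (map (tsort I) l ++ H) (fun h => sat M p h) ->
  definable H (fun h => sat M (ExDs I l p) h).
Proof.
  induction l as [|s l IH]; intros H p Hp; cbn [ExDs]; [exact Hp|].
  apply IH, def_ExD, Hp.
Qed.

Lemma def_tr_term_args {G} :
  (forall s (t : term S G s) (H : list fsort) (rho : env I G H) (y : var H (tsort I s)),
     definable H (fun h => sat M (tr_term I t rho y) h)) /\
  (forall l (a : args S G l) (H : list fsort) (rho : env I G H) (ys : ren (map (tsort I) l) H),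
     definable H (fun h => sat M (tr_args I a rho ys) h)).
Proof.
  apply (term_args_mutind S G
    (fun s t => forall (H : list fsort) (rho : env I G H) (y : var H (tsort I s)),
     definable H (fun h => sat M (tr_term I t rho y) h))
    (fun l a => forall (H : list fsort) (rho : env I G H) (ys : ren (map (tsort I) l) H),
     definable H (fun h => sat M (tr_args I a rho ys) h))).
  - intros s x H rho y. apply (def_eq M).
  - intros f a IH H rho y. cbn [tr_term]. apply def_ExDs.
    apply (def_and M HM); [apply IH|apply def_sat_ren, def_fun].
  - intros H rho ys. apply (def_imp M HM); apply (def_False M).
  - intros s l t IHt a IHa H rho ys. apply (def_and M HM); [apply IHt|apply IHa].
Qed.

(** A translated formula quantifies over the sorts of the concept language and is
    otherwise built from definable relations. *)
Lemma def_tr_form {G} (p : form S G) : forall (H : list fsort) (rho : env I G H),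
  definable H (fun h => sat M (tr_form I p rho) h).
Proof.
  induction p as [G|G s t u|G r a|G p IHp q IHq|G p IHp q IHq|G p IHp q IHq|G s p IH|G s p IH];
    intros H rho; cbn [tr_form].
  - apply (def_False M).
  - apply def_ExD. apply (def_and M HM); apply def_tr_term_args.
  - apply def_ExDs. apply (def_and M HM); [apply def_tr_term_args|apply def_sat_ren, def_rel].
  - apply (def_and M HM); auto.
  - apply (def_or M HM); auto.
  - apply (def_imp M HM); auto.
  - apply def_AllD, IH.
  - apply def_ExD, IH.
Qed.

End DefinableTranslation.

Section ArithmeticModel.
Context (M : structure L1) (HM : models M PFT).
Notation D := (dom (L := L1) M).

Lemma arith_dom s : sat M (dom_nonempty arith s) nov.
Proof.
  destruct s; cbn.
  - exists (zero_obj M HM). exact (num_zero M HM).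
  - destruct (dom_inh M (Con 0)) as [X]. exists X. intros [].
Qed.

Definition num_idom (x : D Obj) (Hx : IsNum M x) : idom arith M Num := exist _ x Hx.

Lemma num_ival (n : idom arith M Num) : IsNum M (ival arith M n).
Proof. exact (proj2_sig n). Qed.

Lemma total_by (f : func LPA2) (a : valu (idom arith M) (fdom f))
    (P : D Obj -> Prop) :
  (exists z, IsNum M z /\ forall z', P z' <-> z' = z) ->
  (forall v : idom arith M (fcod f), sat M (tfun arith f) (cons_v (ival arith M v) (raw arith M _ a))
     <-> P (ival arith M (s := Num) v)) ->
  exists v : idom arith M (fcod f), sat M (tfun arith f) (cons_v (ival arith M v) (raw arith M _ a)) /\
    forall w : idom arith M (fcod f),
      sat M (tfun arith f) (cons_v (ival arith M w) (raw arith M _ a)) -> w = v.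
Proof.
  intros (z & Hz & Ez) HP. exists (num_idom z Hz). split.
  - apply HP, Ez. reflexivity.
  - intros w Hw. apply HP, Ez in Hw. now apply (ival_inj arith M).
Qed.

Lemma arith_fun f : sat M (fun_total arith f) nov.
Proof.
  apply sat_fun_total. intro a. destruct f.
  - apply total_by with (P := IsZero M); [|reflexivity].
    exists (zero_obj M HM). split; [apply num_zero|apply IsZeroE].
  - apply total_by with (P := IsOne M); [|reflexivity].
    exists (succ_obj M HM (zero_obj M HM)). split; [apply num_succ, num_zero|apply IsOneE].
  - apply total_by with (P := IsSum M (ival arith M (a Num vz)) (ival arith M (a Num (vs vz))));
      [|reflexivity].
    apply (sum_total M HM); apply num_ival.
  - apply total_by with (P := IsProd M (ival arith M (a Num vz)) (ival arith M (a Num (vs vz))));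
      [|reflexivity].
    apply (prod_total M HM); apply num_ival.
Qed.

Notation N := (internal arith M arith_dom arith_fun).

Lemma arith_definable {G : list pa_sort} (p : form LPA2 G) (H : list fsort) (rho : env arith G H) :
  definable M H (fun h => sat M (tr_form arith p rho) h).
Proof.
  apply (def_tr_form M HM arith).
  - intros [|]; cbn.
    + apply (def_num M HM).
    + apply (def_imp M HM); apply (def_False M).
  - intros [| | |].
    + apply (def_zero M HM).
    + apply (def_one M HM).
    + apply (def_sum M HM).
    + apply (def_prod M HM).
  - intros [|].
    + apply (def_less M HM).
    + apply (def1_var M).
Qed.

Definition value {G} (t : term LPA2 G Num) (e : valu (dom N) G) : D Obj :=
  ival arith M (s := Num) (eval N t e).

Lemma value_inj {G G'} (t : term LPA2 G Num) (t' : term LPA2 G' Num) e e' :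
  value t e = value t' e' <-> eval N t e = eval N t' e'.
Proof. split; [exact (ival_inj arith M (s := Num) _ _)|]. unfold value. now intros ->. Qed.

Lemma value_num {G} (t : term LPA2 G Num) e : IsNum M (value t e).
Proof. apply num_ival. Qed.

Lemma value_zero {G} (e : valu (dom N) G) : value zero e = zero_obj M HM.
Proof.
  apply IsZeroE. exact (proj2 (internal_fun arith M arith_dom arith_fun Zero nov _) eq_refl).
Qed.

Lemma value_one {G} (e : valu (dom N) G) : value one e = succ_obj M HM (zero_obj M HM).
Proof.
  apply IsOneE. exact (proj2 (internal_fun arith M arith_dom arith_fun One nov _) eq_refl).
Qed.

Lemma value_plus {G} (t u : term LPA2 G Num) e z :
  IsSum M (value t e) (value u e) z <-> z = value (plus t u) e.
Proof.
  destruct (sum_total M HM _ _ (value_num t e) (value_num u e)) as (w & _ & Hw).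
  rewrite Hw. enough (value (plus t u) e = w) as -> by reflexivity. apply Hw.
  exact (proj2 (internal_fun arith M arith_dom arith_fun Plus
    (cons_v (eval N t e) (cons_v (eval N u e) nov)) _) eq_refl).
Qed.

Lemma value_times {G} (t u : term LPA2 G Num) e z :
  IsProd M (value t e) (value u e) z <-> z = value (times t u) e.
Proof.
  destruct (prod_total M HM _ _ (value_num t e) (value_num u e)) as (w & _ & Hw).
  rewrite Hw. enough (value (times t u) e = w) as -> by reflexivity. apply Hw.
  exact (proj2 (internal_fun arith M arith_dom arith_fun Times
    (cons_v (eval N t e) (cons_v (eval N u e) nov)) _) eq_refl).
Qed.

Lemma value_succ {G} (t : term LPA2 G Num) e :
  value (plus t one) e = succ_obj M HM (value t e).
Proof.
  symmetry. apply value_plus. rewrite value_one. apply sum_succ.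
  exists (value t e). split; [now apply sum_zero|reflexivity].
Qed.

Lemma sat_less {G} (t u : term LPA2 G Num) e :
  sat N (less t u) e <-> IsLess M (value t e) (value u e).
Proof. reflexivity. Qed.

Lemma sat_mem {G} (t : term LPA2 G Num) (X : term LPA2 G Sets) e :
  sat N (mem t X) e <-> ap1 M (ival arith M (s := Sets) (eval N X e)) (value t e).
Proof. reflexivity. Qed.

Lemma sat_eq_num {G} (t u : term LPA2 G Num) e :
  sat N (Eq t u) e <-> value t e = value u e.
Proof. symmetry. apply value_inj. Qed.

(** The comprehension variable is put last in the context of the translation, because
    parameters are fixed from the head. *)
Lemma sat_comprehension {G} (p : form LPA2 (Num :: G)) (e : valu (dom N) G) :
  exists X : dom N Sets, forall n : dom N Num,
    ap1 M (ival arith M (s := Sets) X) (ival arith M (s := Num) n) <-> sat N p (cons_v n e).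
Proof.
  set (l := map (tsort arith) G).
  set (rho := vcons (X := pa_sort) (t := Num)
     (P := fun s => var (l ++ [Obj]) (tsort arith s)) (vright l _ vz)
     (fun s x => vleft l _ (var_map arith G s x)) : env arith (Num :: G) (l ++ [Obj])).
  (* The context lists the images of the parameters, then the comprehension variable. *)
  destruct (compr1 M HM (fun v => sat M (tr_form arith p rho)
    (app_v l (raw arith M G e) (cons_v v nov)))) as [X HX].
  - apply (def_iff M) with (Y := fun h : valu D [Obj] => sat M (tr_form arith p rho)
      (app_v l (raw arith M G e) h)).
    + intro h. pose proof (one_obj_eta M h) as E.
      change (cons_v (h Obj vz) nov) with (one_obj M (h Obj vz)). now rewrite -E.
    + apply (def_params M HM l). apply arith_definable.
  - exists (exist (fun X : D (Con 0) => sat M (tdom arith Sets) (cons_v X nov)) X (fun f => f)).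
    intro n. cbn [ival proj1_sig]. rewrite HX.
    apply (sat_tr_form arith M arith_dom arith_fun p).
    intros s x. case_var x.
    + exact (app_v_vright l _ _ _ vz).
    + exact (eq_trans (app_v_vleft l _ _ _ _) (raw_var_map arith M G e s x)).
Qed.

Lemma arith_model : models N PA2.
Proof.
  intros p Hp. destruct Hp; unfold pa_forall; rewrite sat_close; intro e; cbn [sat].
  - intro E. apply sat_eq_num in E. rewrite value_succ value_zero in E.
    now apply succ_neq_zero in E.
  - intro E. apply sat_eq_num in E. rewrite !value_succ in E. apply sat_eq_num.
    now apply succ_inj in E.
  - apply sat_eq_num. symmetry. apply value_plus. rewrite value_zero. now apply sum_zero.
  - apply sat_eq_num. symmetry. apply value_plus. rewrite value_succ.
    apply sum_succ. exists (value (plus #1 #0) e). split; [now apply value_plus|].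
    now rewrite value_succ.
  - apply sat_eq_num. symmetry. apply value_times. rewrite value_zero. now apply prod_zero.
  - apply sat_eq_num. symmetry. apply value_times. rewrite value_succ.
    apply prod_succ. exists (value (times #1 #0) e). split; [now apply value_times|].
    now apply value_plus.
  - intro E. apply sat_less in E. rewrite value_zero in E. now apply less_zero in E.
  - split.
    + intro E. apply sat_less in E. rewrite value_succ in E.
      apply less_succ in E as [E|E]; [left; exact E|right; now apply sat_eq_num].
    + intros [E|E]; apply sat_less; rewrite value_succ; apply less_succ;
        [left; exact E|right; now apply sat_eq_num].
  - intros [H0 HS] n. apply sat_mem. apply sat_mem in H0. rewrite value_zero in H0.
    set (X := ival arith M (s := Sets) (e Sets vz)) in *.
    apply (num_ind M HM (fun x => ap1 M X x)).
    + apply (def1 M).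
    + exact H0.
    + intros x Hx HXx. specialize (HS (num_idom x Hx) HXx). apply sat_mem in HS.
      rewrite value_succ in HS. exact HS.
    + apply value_num.
  - destruct (sat_comprehension p e) as [X HX]. exists X. intro n.
    rewrite sat_Iff sat_ren cons_v_ren_up. exact (HX n).
Qed.

End ArithmeticModel.

Theorem theorem3p2 : interprets PFT PA2.
Proof.
  apply (interprets_by_models countable_L1 Obj PFT PA2 arith). intros M HM.
  exists (arith_dom M HM), (arith_fun M HM). apply arith_model.
Qed.
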